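(* Let $F$ be a global function field of characteristic $p>0$ and $E/F$ a non-isotrivial elliptic curve having either good or split multiplicative reduction at every place of $F$. Let $\mathcal{F}/F$ be a Galois extension with $\Gamma=Gal(\mathcal{F}/F)\simeq\mathbb{Z}_p^{\mathbb{N}}$, and let $F=F_0\subset F_1\subset\cdots$ be finite extensions of $F$ with $\bigcup_n F_n=\mathcal{F}$; put $\Gamma_n=Gal(\mathcal{F}/F_n)$. Let $l\neq p$ be a prime. Then for every $n$ the restriction map $Sel_E(F_n)_l\to Sel_E(\mathcal{F})_l^{\Gamma_n}$ is an isomorphism.
   Context: Non-isotrivial means $j(E)$ is not in the constant field of $F$. $\mathbb{Z}_p^{\mathbb{N}}$ denotes a countable product of copies of $\mathbb{Z}_p$. For an algebraic extension $L/F$ and $l\ne p$, write $E[l^\infty]=\bigcup_n E[l^n](\overline F)$ and $H^1(L,\cdot)=H^1(G_L,\cdot)$ (Galois cohomology). For each place $v$ of $L$, with completion $L_v$, let $\kappa_v:E(L_v)\otimes\mathbb{Q}_l/\mathbb{Z}_l\hookrightarrow H^1(L_v,E[l^\infty])$ be the Kummer map (direct limit of the coboundaries of $0\to E[l^n]\to E\xrightarrow{l^n} E\to 0$). The $l$-part of the Selmer group is $Sel_E(L)_l=\ker\big(H^1(L,E[l^\infty])\to\prod_{v}H^1(L_v,E[l^\infty])/\mathrm{Im}\,\kappa_v\big)$, the product over all places $v$ of $L$. $\Gamma_n$ acts on $Sel_E(\mathcal{F})_l$ naturally. *)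

(* Defs.v *)
From HB Require Import structures.
From mathcomp Require Import all_boot all_order all_algebra all_field.
From mathcomp Require Import boolp classical_sets functions filter.

Set Implicit Arguments.
Unset Strict Implicit.
Unset Printing Implicit Defensive.

Import GRing.Theory.
Local Open Scope classical_set_scope.
Local Open Scope ring_scope.

(* The curve y^2 + a1 xy + a3 y = x^3 + a2 x^2 + a4 x + a6 *)
Record weierstrass (K : Type) :=
  Weierstrass { a1 : K; a2 : K; a3 : K; a4 : K; a6 : K }.

Definition map_curve (K K' : Type) (f : K -> K') (W : weierstrass K) :=
  Weierstrass (f (a1 W)) (f (a2 W)) (f (a3 W)) (f (a4 W)) (f (a6 W)).

(* An affine point, or [None] for the point at infinity. *)
Definition point (K : Type) := option (K * K).

Definition map_point (K K' : Type) (f : K -> K') : point K -> point K' :=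
  omap (fun P => (f P.1, f P.2)).

Section Curve.
Variables (K : fieldType) (W : weierstrass K).

Definition b2 := a1 W ^+ 2 + 4%:R * a2 W.
Definition b4 := 2%:R * a4 W + a1 W * a3 W.
Definition b6 := a3 W ^+ 2 + 4%:R * a6 W.
Definition b8 := a1 W ^+ 2 * a6 W + 4%:R * a2 W * a6 W
  - a1 W * a3 W * a4 W + a2 W * a3 W ^+ 2 - a4 W ^+ 2.
Definition c4 := b2 ^+ 2 - 24%:R * b4.
Definition disc := - b2 ^+ 2 * b8 - 8%:R * b4 ^+ 3 - 27%:R * b6 ^+ 2
  + 9%:R * b2 * b4 * b6.
Definition jinv := c4 ^+ 3 / disc.

Definition weq (x y : K) := y ^+ 2 + a1 W * x * y + a3 W * y
  - (x ^+ 3 + a2 W * x ^+ 2 + a4 W * x + a6 W).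
Definition weq_x (x y : K) :=
  a1 W * y - (3%:R * x ^+ 2 + 2%:R * a2 W * x + a4 W).
Definition weq_y (x y : K) := 2%:R * y + a1 W * x + a3 W.

Definition points (L : set K) : set (point K) :=
  [set P | if P is Some (x, y) then [/\ L x, L y & weq x y = 0] else True].

Definition popp (P : point K) : point K :=
  if P is Some (x, y) then Some (x, - y - a1 W * x - a3 W) else None.

Definition padd (P Q : point K) : point K :=
  match P, Q with
  | None, _ => Q
  | _, None => P
  | Some (x1, y1), Some (x2, y2) =>
    if (x1 == x2) && (y1 + y2 + a1 W * x2 + a3 W == 0) then None else
    let m := if x1 == x2 then - weq_x x1 y1 / weq_y x1 y1
             else (y2 - y1) / (x2 - x1) in
    let x := m ^+ 2 + a1 W * m - a2 W - x1 - x2 in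
    Some (x, - (m + a1 W) * x - (y1 - m * x1) - a3 W)
  end.

Definition pmul (n : nat) (P : point K) : point K := iter n (padd P) None.

Definition ltorsion (l : nat) (M : set K) : set (point K) :=
  [set P | points M P /\ exists n, pmul (l ^ n)%N P = None].

End Curve.

(* [W'] is obtained from [W] by x = u^2 x' + r, y = u^3 y' + u^2 s x' + t. *)
Definition isomorphic_curves (K : fieldType) (W W' : weierstrass K) : Prop :=
  exists u r s t : K, u != 0 /\
  [/\ u * a1 W' = a1 W + 2%:R * s,
      u ^+ 2 * a2 W' = a2 W - s * a1 W + 3%:R * r - s ^+ 2,
      u ^+ 3 * a3 W' = a3 W + r * a1 W + 2%:R * t,
      u ^+ 4 * a4 W' = a4 W - s * a3 W + 2%:R * r * a2 W
        - (t + r * s) * a1 W + 3%:R * r ^+ 2 - 2%:R * s * t &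
      u ^+ 6 * a6 W' = a6 W + r * a4 W + r ^+ 2 * a2 W + r ^+ 3
        - t * a3 W - t ^+ 2 - r * t * a1 W].

(* A place of the subfield [L] is given by its valuation ring, different from
   [L] itself. On an algebraic extension of a global function field these
   valuation rings are exactly the ones of the nontrivial absolute values (up
   to equivalence), as all of them have rank one. *)
Definition is_place (K : fieldType) (L V : set K) : Prop :=
  [/\ V `<=` L, subring_closed [in V],
      forall x, L x -> V x \/ V x^-1 & V <> L].

Record place (K : fieldType) :=
  Place { place_ring :> set K; place_ringP : is_place setT place_ring }.

Definition maximal_ideal (K : fieldType) (V : set K) : set K :=
  [set x | V x /\ (x = 0 \/ ~ V x^-1)].

(* The sets x + a V with a != 0 form a basis of the valuation topology; density
   and completeness (every Cauchy filter converges) refer to this topology. *)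
Record completion (K : fieldType) (V : set K) := Completion {
  compl_field :> fieldType;
  compl_ring : set compl_field;
  compl_emb : {rmorphism K -> compl_field};
  compl_ringP : is_place setT compl_ring;
  compl_embP : forall x, compl_ring (compl_emb x) <-> V x;
  compl_dense : forall x a : compl_field, a != 0 ->
    exists y, compl_ring ((x - compl_emb y) / a);
  compl_complete : forall U : set_system compl_field, ProperFilter U ->
    (forall a, a != 0 -> exists x, U [set y | compl_ring ((y - x) / a)]) ->
    exists x, forall a, a != 0 -> U [set y | compl_ring ((y - x) / a)]
}.

Definition integral_model (K : fieldType) (V : set K) (W : weierstrass K) :=
  [/\ V (a1 W), V (a2 W), V (a3 W), V (a4 W) & V (a6 W)].

(* Among the integral models of [W], [W'] has a discriminant of least
   valuation. *)
Definition minimal_model (K : fieldType) (V : set K) (W W' : weierstrass K) :=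
  [/\ isomorphic_curves W W', integral_model V W' &
      forall W'', isomorphic_curves W W'' -> integral_model V W'' ->
        V (disc W'' / disc W')].

(* The reduction of a minimal model is again an elliptic curve. *)
Definition good_reduction (K : fieldType) (V : set K) (W : weierstrass K) :=
  exists W', minimal_model V W W' /\ ~ maximal_ideal V (disc W').

(* Modulo the maximal ideal, (x0, y0) is a singular point of the reduction of
   a minimal model, with tangent cone
     Y^2 + a1 XY - (3 x0 + a2) X^2 = (Y - alpha X) (Y - beta X);
   it is a node, with tangents defined over the residue field. *)
Definition split_multiplicative_reduction (K : fieldType) (V : set K)
    (W : weierstrass K) :=
  exists W', minimal_model V W W' /\
  exists x0 y0 alpha beta : K, let m := maximal_ideal V in
  [/\ V x0, V y0, V alpha & V beta] /\
  [/\ m (weq W' x0 y0), m (weq_x W' x0 y0) & m (weq_y W' x0 y0)] /\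
  [/\ m (alpha + beta + a1 W'),
      m (alpha * beta + 3%:R * x0 + a2 W') &
      ~ m (alpha - beta)].

(* For subfields L <= M of [K], Gal(M/L) is represented by functions on [K];
   being the identity outside [M], they are determined by their restriction to
   [M]. The group law is composition. For [M] an algebraic closure of [L] this
   is the absolute Galois group of [L] (the restriction map from Aut(M/L) to
   the Galois group of the separable closure is an isomorphism of topological
   groups). *)
Definition galois_group (K : fieldType) (M L : set K) : set (K -> K) :=
  [set sigma |
    [/\ set_bij M M sigma,
        forall x y, M x -> M y ->
          sigma (x + y) = sigma x + sigma y /\
          sigma (x * y) = sigma x * sigma y,
        forall x, L x -> sigma x = x &
        forall x, ~ M x -> sigma x = x]].

(* Continuity, for the Krull topology, of a map to a discrete space. *)
Definition locally_constant (K : fieldType) (T : Type) (G : set (K -> K))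
    (c : (K -> K) -> T) :=
  forall sigma, G sigma -> exists s : seq K, forall tau, G tau ->
    (forall x, x \in s -> tau x = sigma x) -> c tau = c sigma.

(* Z_p^N, where Z_p is the inverse limit of the Z/p^(n+1) *)
Definition ZpN (p : nat) : set (nat -> forall n, 'Z_(p ^ n.+1)) :=
  [set x | forall i n, ((x i n.+1 : nat) = x i n %[mod p ^ n.+1])%N].

Definition isomorphic_ZpN (p : nat) (K : fieldType) (G : set (K -> K)) :=
  exists phi : (K -> K) -> nat -> forall n, 'Z_(p ^ n.+1),
  [/\ set_bij G (@ZpN p) phi,
      forall sigma tau, G sigma -> G tau -> forall i n,
        phi (sigma \o tau) i n = phi sigma i n + phi tau i n,
      forall i n, locally_constant G (fun sigma => phi sigma i n) &
      forall sigma x, G sigma -> exists N, forall tau, G tau ->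
        (forall i n, (i < N)%N -> (n < N)%N -> phi tau i n = phi sigma i n) ->
        tau x = sigma x].

Section Extensions.
Variables (F Fbar : fieldType) (iota : {rmorphism F -> Fbar}).

Definition intermediate_field (L : set Fbar) :=
  divring_closed [in L] /\ range iota `<=` L.

Definition finite_over (L : set Fbar) :=
  exists n (b : 'I_n -> Fbar), forall x, L x ->
    exists a : 'I_n -> F, x = \sum_i iota (a i) * b i.

Definition separable_over (L : set Fbar) :=
  forall x, L x -> exists q : {poly F},
    separable_poly q /\ root (map_poly iota q) x.

Definition normal_over (L : set Fbar) :=
  forall q : {poly F}, irreducible_poly q -> forall x y,
    L x -> root (map_poly iota q) x -> root (map_poly iota q) y -> L y.

Definition galois_over (L : set Fbar) :=
  [/\ intermediate_field L, separable_over L & normal_over L].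

End Extensions.

(* The algebraic closure, in [F], of the image of F_p. *)
Definition constant_field (p : nat) (F : fieldExtType {fraction {poly 'F_p}})
    : set F :=
  [set x | algebraicOver (fun c : 'F_p => ((tofrac c%:P)%:A : F)) x].

(* Cocycles on [G] with values in the group [A] of points of [W]. A class is
   the set of all cocycles representing it; cocycles are only compared on [G],
   so that their values outside [G] are irrelevant. *)
Section Cohomology.
Variables (K : fieldType) (W : weierstrass K).
Implicit Types (G : set (K -> K)) (A : set (point K)).
Implicit Types (c d : (K -> K) -> point K) (X Y : set ((K -> K) -> point K)).

Definition cocycle G A c :=
  [/\ forall sigma, G sigma -> A (c sigma),
      forall sigma tau, G sigma -> G tau ->
        c (sigma \o tau) = padd W (c sigma) (map_point sigma (c tau)) &
      locally_constant G c].

(* sigma |-> sigma Q - Q *)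
Definition coboundary (Q : point K) (sigma : K -> K) : point K :=
  padd W (map_point sigma Q) (popp W Q).

Definition coh_class G A c : set ((K -> K) -> point K) :=
  [set d | cocycle G A d /\
    exists2 T, A T & forall sigma, G sigma ->
      d sigma = padd W (c sigma) (coboundary T sigma)].

Definition H1 G A : set (set ((K -> K) -> point K)) :=
  [set X | exists2 c, cocycle G A c & X = coh_class G A c].

Definition H1_add G A X Y : set ((K -> K) -> point K) :=
  [set d | exists c c', [/\ X c, Y c' &
    coh_class G A (fun sigma => padd W (c sigma) (c' sigma)) d]].

Definition H1_res G A X : set ((K -> K) -> point K) :=
  [set d | exists2 c, X c & coh_class G A c d].

(* The action of an element [g] normalizing [G]:
   (g c)(sigma) = g (c (g^-1 sigma g)). *)
Definition H1_conj G A (g : K -> K) X : set ((K -> K) -> point K) :=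
  [set d | exists2 c, X c & coh_class G A
    (fun sigma =>
       map_point g (c ('pinv_(fun=> 0) setT g \o sigma \o g))) d].

End Cohomology.

Section Selmer.
Variables (Fbar : fieldType) (C : forall w : place Fbar, completion w).
Variables (W : weierstrass Fbar) (l : nat).

(* The closure of [L] in the completion of [Fbar] at [w] is the completion of
   [L] at the place induced by [w]; its algebraic closure is taken inside the
   completion of [Fbar], which is algebraically closed. *)
Definition local_field (w : place Fbar) (L : set Fbar) : set (C w) :=
  [set x | forall a, a != 0 ->
    exists2 y, L y & compl_ring ((x - compl_emb (C w) y) / a)].

Definition local_closure (w : place Fbar) (L : set Fbar) : set (C w) :=
  [set x | exists q : {poly C w},
    [/\ q != 0, forall i, local_field L q`_i & root q x]].

Definition local_curve (w : place Fbar) : weierstrass (C w) :=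
  map_curve (compl_emb (C w)) W.

Definition local_galois_group (w : place Fbar) (L : set Fbar) :=
  galois_group (@local_closure w L) (@local_field w L).

Definition local_ltorsion (w : place Fbar) (L : set Fbar) :=
  ltorsion (local_curve w) l (@local_closure w L).

Definition restrict_galois (w : place Fbar) (tau : C w -> C w) : Fbar -> Fbar :=
  'pinv_(fun=> 0) setT (compl_emb (C w)) \o tau \o compl_emb (C w).

Definition localization (w : place Fbar) (L : set Fbar)
    (X : set ((Fbar -> Fbar) -> point Fbar)) :=
  [set d | exists2 c, X c &
    coh_class (local_curve w) (local_galois_group L) (local_ltorsion L)
      (fun tau : C w -> C w =>
         map_point (compl_emb (C w)) (c (restrict_galois tau))) d].

(* The image of the Kummer map: P (x) l^-n is sent to the class of
   sigma |-> sigma Q - Q for any Q with l^n Q = P, and every element of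
   E(L_v) (x) Q_l/Z_l is of the form P (x) l^-n. *)
Definition kummer_image (w : place Fbar) (L : set Fbar)
    : set (set ((C w -> C w) -> point (C w))) :=
  [set X | exists (n : nat) (P Q : point (C w)),
    [/\ points (local_curve w) (@local_field w L) P,
        points (local_curve w) (@local_closure w L) Q,
        pmul (local_curve w) (l ^ n)%N Q = P &
        X = coh_class (local_curve w) (local_galois_group L) (local_ltorsion L)
              (coboundary (local_curve w) Q)]].

(* [L] is a subfield over which [Fbar] is algebraic. Each place v of [L]
   extends to a place w of [Fbar], unique up to conjugation by the absolute
   Galois group of [L], so that the condition at v does not depend on w. *)
Definition selmer (L : set Fbar)
    : set (set ((Fbar -> Fbar) -> point Fbar)) :=
  [set X | H1 W (galois_group setT L) (ltorsion W l setT) X /\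
    forall v, is_place L v ->
    forall w : place Fbar, (w : set Fbar) `&` L = v ->
      kummer_image L (@localization w L X)].

Definition selmer_add (L : set Fbar) :=
  H1_add W (galois_group setT L) (ltorsion W l setT).

Definition selmer_res (L' : set Fbar) :=
  H1_res W (galois_group setT L') (ltorsion W l setT).

(* The invariants of the Selmer group of [L'] under Gal(L'/L); an element gamma
   of Gal(L'/L) acts through any extension g of gamma to [Fbar]. *)
Definition selmer_invariants (L L' : set Fbar) :=
  [set X | selmer L' X /\
    forall gamma g, galois_group L' L gamma -> galois_group setT L g ->
      (forall x, L' x -> g x = gamma x) ->
      H1_conj W (galois_group setT L') (ltorsion W l setT) g X = X].

End Selmer.

(* Main.v *)
(** Write L = F_n and M = calF. As M/L is pro-p and l <> p, averaging a cocycle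
    over the finite p-groups Gal(L'/L), L' in M, kills a p-power multiple of its
    class, which gives the injectivity of the restriction
    H^1(L, E[l^oo]) -> H^1(M, E[l^oo]), and corestriction from finite layers lifts
    the invariant classes.

    For the Selmer conditions, let k <= kk be the closures of L and M in the
    completed algebraic closure at a place w, and let d be a cocycle over k that
    becomes the coboundary of a point Q over kk. Approximate Q by a global
    algebraic point Q2; then d - dQ2 takes values in the points near the origin.
    These form a Z_p-module in which p is topologically nilpotent, so division by
    primes other than p is possible and unique there, over any complete field. The
    average of d - dQ2 can thus be divided, and d becomes the coboundary of an
    algebraic point over kk, hence over k by Krasner's lemma and averaging over a
    finite p-group. A Galois invariant multiple of that point is defined over the
    perfect closure of k; by means of the invariant differential a p-power multiple
    of it is defined over k. *)

Require Import Defs.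
From HB Require Import structures.
From mathcomp Require Import all_boot all_order all_algebra all_field.
From mathcomp Require Import all_fingroup all_solvable.
From mathcomp Require Import boolp classical_sets functions filter.
From mathcomp Require Import ring.
Import Defs.

Set Implicit Arguments.
Unset Strict Implicit.
Unset Printing Implicit Defensive.

Import GRing.Theory.
Local Open Scope classical_set_scope.
Local Open Scope ring_scope.

(** * The group law *)

(** The local obstacle is that the closure of [calF] in [C w] need not be algebraic over the closure
    of [Fn n]. A point Q splitting the cocycle over it may have transcendental coordinates, so no
    finite quotient of the local Galois group sees Q. Only the cocycle minus the coboundary of Q2
    has algebraic values. Its average may be divided by the prime-to-p part of the group order,
    because near the origin p is contracting and integers prime to p are invertible; the remaining
    power of p is undone on l-power torsion. Galois groups here are groups of automorphisms of
    algebraic closures of possibly imperfect fields. What they fix is only a p-power root of an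
    element of the base field. This is harmless for automorphisms, since p-power roots are unique,
    but for points it costs a power of p. The limit arguments use sequences and the powers of one
    small element t, so places must be shown to have rank one; this comes from algebraicity over
    F_p(t). *)

Lemma normalized_assoc (K : fieldType) (u v r t mu al1 al3 N N' : K) :
  mu != 0 -> t = mu ^+ 2 + al1 * mu + u + v - r ->
  al3 * mu = (r - u) * (r - v) - mu ^+ 2 * r - al1 * mu * r ->
  N * (r - v) = mu * r + al1 * v + al3 ->
  N * (mu * r + al1 * (r - v)) = r ^+ 2 - u * r + al1 * (al1 * v + al3) ->
  (v = r -> r != 0) ->
  N' * (t - u) = - mu * t - al1 * t - al3 ->
  N' * (- mu * t) = t ^+ 2 - v * t ->
  (u = t -> u != 0) ->
  let X := N ^+ 2 + al1 * N + u - r in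
  X = N' ^+ 2 + al1 * N' + v - t /\ N * (X - r) + mu * r = N' * (X - u).
Proof.
move=> mu0 Et E3 c1 t1 d1 c2 t2 d2.
(* Here Q = (0, 0), the line PQ is y = 0 with abscissas u, v, and the line QR is y = mu x with
   abscissas r, t. The equations c1, t1 (and c2, t2) give the slope N (and N') in chord form and in
   a form that survives when the two abscissas coincide. Eliminating al1 and al3 leaves field
   identities. *)
have {}E3 : al3 = ((r - u) * (r - v) - mu ^+ 2 * r - al1 * mu * r) / mu.
  by rewrite -E3 mulfK.
have EN : N = if v == r then (r - u) / mu - al1 else
    (mu * r + al1 * v + al3) / (r - v).
  case: eqP => [vr|/eqP vr]; last first.
    by rewrite -c1 mulfK // subr_eq0 eq_sym.
  have r0 := d1 vr; move: t1; rewrite E3 vr => t1.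
  apply: (mulIf (mulf_neq0 mu0 r0)).
  have -> : N * (mu * r) = N * (mu * r + al1 * (r - r)) by ring.
  by rewrite t1; field.
have EN' : N' = if u == t then (v - t) / mu else
    (- mu * t - al1 * t - al3) / (t - u).
  case: eqP => [ut|/eqP ut]; last first.
    by rewrite -c2 mulfK // subr_eq0 eq_sym.
  have t0 : t != 0 by rewrite -ut; exact: d2.
  apply: (mulIf (mulf_neq0 mu0 t0)).
  have -> : N' * (mu * t) = - (N' * (- mu * t)) by ring.
  by rewrite t2; field.
have E1 : al1 = (t + r - u - v) / mu - mu.
  by rewrite Et; field.
have {Et c1 t1 d1 c2 t2 d2} := (EN, EN').
have [vr|vr] := eqVneq v r; have [ut|ut] := eqVneq u t => -[-> ->];
  rewrite /= ?E3 E1 ?vr ?ut; split; field; rewrite ?mu0 ?subr_eq0 ?[r == v]eq_sym ?[t == u]eq_sym ?vr ?ut //.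
Qed.

Section GroupLaw.
Variables (K : fieldType) (W : weierstrass K).

(** The equation and its partial derivatives can be solved for [a6], [a4] and [a3]; with these
    values the discriminant vanishes identically. *)
Lemma singular_disc (x y : K) :
  weq W x y = 0 -> weq_x W x y = 0 -> weq_y W x y = 0 -> disc W = 0.
Proof.
rewrite /weq /weq_x /weq_y => e ex ey.
have E3 : a3 W = - (2%:R * y + a1 W * x).
  by apply/eqP; rewrite -addr_eq0; apply/eqP; rewrite -[RHS]ey; ring.
have E4 : a4 W = a1 W * y - (3%:R * x ^+ 2 + 2%:R * a2 W * x).
  by apply/esym/eqP; rewrite -subr_eq0; apply/eqP; rewrite -[RHS]ex; ring.
have E6 : a6 W = y ^+ 2 + a1 W * x * y + a3 W * y
    - (x ^+ 3 + a2 W * x ^+ 2 + a4 W * x).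
  by apply/esym/eqP; rewrite -subr_eq0; apply/eqP; rewrite -[RHS]e; ring.
by rewrite /disc /b2 /b4 /b6 /b8 E6 E4 E3; ring.
Qed.

(* The line y = m x + c meets the curve in the points of abscissas x1, x2, x3,
   counted with multiplicity. *)
Definition collinear (m c x1 x2 x3 : K) :=
  [/\ x1 + x2 + x3 = m ^+ 2 + a1 W * m - a2 W,
      x1 * x2 + x1 * x3 + x2 * x3
        = a4 W - 2%:R * m * c - a1 W * c - a3 W * m &
      x1 * x2 * x3 = c ^+ 2 + a3 W * c - a6 W].

(** The reflection of the third intersection point of the line, that is, the sum of the other
    two. *)
Definition third (m c x : K) : point K :=
  Some (x, - (m * x + c) - a1 W * x - a3 W).

Lemma collinearC m c x1 x2 x3 : collinear m c x1 x2 x3 -> collinear m c x2 x1 x3.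
Proof. by case=> e1 e2 e3; split; [rewrite -e1 | rewrite -e2 | rewrite -e3]; ring. Qed.

Lemma collinearCA m c x1 x2 x3 : collinear m c x1 x2 x3 -> collinear m c x1 x3 x2.
Proof. by case=> e1 e2 e3; split; [rewrite -e1 | rewrite -e2 | rewrite -e3]; ring. Qed.

Lemma collinear_coefs m c x1 x2 x3 : collinear m c x1 x2 x3 ->
  [/\ a2 W = m ^+ 2 + a1 W * m - (x1 + x2 + x3),
      a4 W = x1 * x2 + x1 * x3 + x2 * x3 + (2%:R * m * c + a1 W * c + a3 W * m) &
      a6 W = c ^+ 2 + a3 W * c - x1 * x2 * x3].
Proof. by case=> e1 e2 e3; rewrite e1 e2 e3; split; ring. Qed.

Lemma collinear_weq m c x1 x2 x3 :
  collinear m c x1 x2 x3 -> weq W x1 (m * x1 + c) = 0.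
Proof. by case/collinear_coefs=> e2 e4 e6; rewrite /weq e2 e4 e6; ring. Qed.

Lemma popp_weq x y : weq W x (- y - a1 W * x - a3 W) = weq W x y.
Proof. by rewrite /weq; ring. Qed.

Hypothesis nz : disc W != 0.

Lemma collinear_padd m c x1 x2 x3 : collinear m c x1 x2 x3 ->
  padd W (Some (x1, m * x1 + c)) (Some (x2, m * x2 + c)) = third m c x3.
Proof.
move=> col; have [e2 e4 e6] := collinear_coefs col.
(* In the tangent case x1 is a double root, so the derivative of the equation along the line
   vanishes there. *)
have tg : x1 = x2 -> m * weq_y W x1 (m * x1 + c) = - weq_x W x1 (m * x1 + c).
  by move=> e; rewrite /weq_x /weq_y e4 e2 -e; ring.
rewrite /padd; case: ifP => [/andP[/eqP ex /eqP ey]|].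
  (* Opposite points on the line y = m x + c are equal, so weq_y vanishes; then [tg] kills weq_x too
     and the curve would be singular. *)
  have wy : weq_y W x1 (m * x1 + c) = 0 by rewrite -ey /weq_y ex; ring.
  have wx : weq_x W x1 (m * x1 + c) = 0.
    by apply/eqP; rewrite -oppr_eq0 -tg // wy mulr0.
  by move: nz; rewrite (singular_disc (collinear_weq col) wx wy) eqxx.
move=> neg; set M := (if _ then _ else _).
have -> : M = m.
  rewrite /M; case: eqVneq neg => [ex /= ey|ne _].
    have wy : weq_y W x1 (m * x1 + c) != 0.
      apply/negP => /eqP wy; move/negP: ey; apply; apply/eqP.
      by rewrite -[RHS]wy /weq_y ex; ring.
    by rewrite -tg // mulfK.
  have n0 : x2 - x1 != 0 by rewrite subr_eq0 eq_sym.
  by apply: (mulIf n0); rewrite divfK //; ring.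
by rewrite /third /=; congr (Some (_, _)); rewrite e2; ring.
Qed.

Lemma line_through x1 y1 x2 y2 : weq W x1 y1 = 0 -> weq W x2 y2 = 0 ->
  ~~ ((x1 == x2) && (y1 + y2 + a1 W * x2 + a3 W == 0)) ->
  exists m c x3, [/\ y1 = m * x1 + c, y2 = m * x2 + c & collinear m c x1 x2 x3].
Proof.
move=> w1 w2; have [ex|nx] := eqVneq x1 x2 => /= neg.
  have ey : y1 = y2.
    apply/eqP; rewrite -subr_eq0; move: (mulf_eq0 (y1 - y2) (y1 + y2 + a1 W * x2 + a3 W)).
    rewrite (negPf neg) orbF => <-; apply/eqP.
    rewrite -[RHS](subrr (weq W x1 y1)) {2}w1 -w2 /weq ex; ring.
  rewrite -{}ey -{}ex {w2} in neg *.
  have wy : weq_y W x1 y1 != 0.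
    by apply/negP => /eqP h; move/negP: neg; apply; apply/eqP; rewrite -[RHS]h /weq_y; ring.
  pose m := - weq_x W x1 y1 / weq_y W x1 y1.
  have hm : m * weq_y W x1 y1 = - weq_x W x1 y1 by rewrite /m divfK.
  exists m, (y1 - m * x1), (m ^+ 2 + a1 W * m - a2 W - x1 - x1).
  have e2 : 3%:R * x1 ^+ 2 + 2%:R * a2 W * x1 + a4 W = a1 W * y1 + m * weq_y W x1 y1.
    by rewrite hm /weq_x; ring.
  split; [by ring | by ring |]; clearbody m.
  have E4 : a4 W = a1 W * y1 + m * weq_y W x1 y1 - 3%:R * x1 ^+ 2 - 2%:R * a2 W * x1.
    by rewrite -e2; ring.
  have E6 : a6 W = y1 ^+ 2 + a1 W * x1 * y1 + a3 W * y1
     - (x1 ^+ 3 + a2 W * x1 ^+ 2 + a4 W * x1).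
    by apply/esym/eqP; rewrite -subr_eq0; apply/eqP; rewrite -[RHS]w1 /weq; ring.
  by split; rewrite ?E6 ?E4 /weq_y; ring.
have n0 : x2 - x1 != 0 by rewrite subr_eq0 eq_sym.
pose m := (y2 - y1) / (x2 - x1).
have e2 : y2 = m * x2 + (y1 - m * x1).
  by apply/eqP; rewrite addrCA -mulrBr /m divfK // addrC subrK.
exists m, (y1 - m * x1), (m ^+ 2 + a1 W * m - a2 W - x1 - x2).
split; [by ring | by [] |]; clearbody m.
rewrite {}e2 in w2.
have E4 : a4 W = x1 * x2 + (x1 + x2) * (m ^+ 2 + a1 W * m - a2 W - x1 - x2)
    + 2%:R * m * (y1 - m * x1) + a1 W * (y1 - m * x1) + a3 W * m.
  apply: (mulfI n0); apply/eqP; rewrite -subr_eq0; apply/eqP.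
  by rewrite -[RHS](subrr (0 : K)) -{1}w1 -w2 /weq; ring.
have E6 : a6 W = y1 ^+ 2 + a1 W * x1 * y1 + a3 W * y1
   - (x1 ^+ 3 + a2 W * x1 ^+ 2 + a4 W * x1).
  by apply/esym/eqP; rewrite -subr_eq0; apply/eqP; rewrite -[RHS]w1 /weq; ring.
by split; rewrite ?E6 ?E4; ring.
Qed.

Lemma collinear_opp m c x1 x2 x3 : collinear m c x1 x2 x3 ->
  collinear (- m - a1 W) (- c - a3 W) x1 x2 x3.
Proof.
by case=> e1 e2 e3; split; [rewrite e1 | rewrite e2 | rewrite e3]; ring.
Qed.

Lemma paddNone P : padd W P None = P.
Proof. by case: P => [[]|]. Qed.

Lemma padd_popp P : padd W P (popp W P) = None.
Proof.
case: P => [[x y]|] //=; rewrite eqxx ifT //=; apply/eqP; ring.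
Qed.

Lemma popp_points P : points W setT P -> points W setT (popp W P).
Proof. by case: P => [[x y] [_ _ w]|//]; split=> //; rewrite popp_weq. Qed.

Variant padd_spec (P Q : point K) : point K -> Type :=
| PaddNoneL of P = None : padd_spec P Q Q
| PaddNoneR of Q = None : padd_spec P Q P
| PaddOpp of Q = popp W P : padd_spec P Q None
| PaddLine m c x1 x2 x3 of P = Some (x1, m * x1 + c) & Q = Some (x2, m * x2 + c)
    & collinear m c x1 x2 x3 & Q <> popp W P : padd_spec P Q (third m c x3).

Lemma paddP P Q : points W setT P -> points W setT Q -> padd_spec P Q (padd W P Q).
Proof.
case: P => [[x1 y1]|]; last by constructor.
case: Q => [[x2 y2]|] [_ _ w1]; last by rewrite paddNone; constructor.
case=> _ _ w2.
have [/andP[/eqP ex /eqP ey]|/negP/negP neg] :=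
  boolP ((x1 == x2) && (y1 + y2 + a1 W * x2 + a3 W == 0)).
  rewrite /padd ex ey !eqxx /=; constructor; congr (Some (_, _)).
  by apply/eqP; rewrite -subr_eq0; apply/eqP; rewrite -[RHS]ey; ring.
have /cid[m /cid[c /cid[x3 [e1 e2 col]]]] := line_through w1 w2 neg.
rewrite e1 e2 (collinear_padd col); apply: (PaddLine _ _ col) => // -[ex ey].
by case/negP: neg; rewrite e2 ey e1 ex eqxx; apply/eqP; ring.
Qed.

Lemma third_points m c x1 x2 x3 :
  collinear m c x1 x2 x3 -> points W setT (third m c x3).
Proof.
move=> /collinearCA/collinearC/collinear_weq h; split=> //.
by rewrite popp_weq.
Qed.

Lemma padd_points P Q :
  points W setT P -> points W setT Q -> points W setT (padd W P Q).
Proof.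
by move=> pP pQ; case: paddP => // m c x1 x2 x3 _ _ /third_points.
Qed.

Lemma paddC P Q : points W setT P -> points W setT Q -> padd W P Q = padd W Q P.
Proof.
move=> pP pQ; case: (paddP pP pQ).
- by move=> ->; rewrite paddNone.
- by move=> ->.
- move=> ->; case: P {pP} => [[x y]|] //=; rewrite eqxx ifT //=; apply/eqP; ring.
- by move=> m c x1 x2 x3 -> -> /collinearC/collinear_padd -> _.
Qed.

Lemma poppK P : popp W (popp W P) = P.
Proof. by case: P => [[x y]|] //=; congr (Some (_, _)); ring. Qed.

Lemma popp_padd P : padd W (popp W P) P = None.
Proof. by rewrite -{2}[P]poppK padd_popp. Qed.

(** The reflected line of [collinear_opp] passes through -P, P + Q and -Q. *)
Lemma padd_oppK P Q : points W setT P -> points W setT Q ->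
  padd W (popp W P) (padd W P Q) = Q.
Proof.
move=> pP pQ; case: (paddP pP pQ).
- by move=> ->.
- by move=> ->; rewrite -{2}[P]poppK padd_popp.
- by move=> ->; rewrite paddNone.
- move=> m c x1 x2 x3 -> -> /collinear_opp/collinearCA/collinear_padd h _.
  have -> : popp W (Some (x1, m * x1 + c)) =
      Some (x1, (- m - a1 W) * x1 + (- c - a3 W)).
    by congr (Some (_, _)); ring.
  have -> : third m c x3 = Some (x3, (- m - a1 W) * x3 + (- c - a3 W)).
    by congr (Some (_, _)); ring.
  by rewrite h; congr (Some (_, _)); ring.
Qed.

(** Reduces an equation to a polynomial identity: A = B is a combination of hypotheses chosen so
    that [ring] proves the second premise. *)
Lemma linear_comb1 (A B x y : K) : A = B -> x - y = A - B -> x = y.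
Proof. by move=> ->; rewrite subrr => /subr0_eq. Qed.

(** Once the positions with a vertical chord or with P, Q, R on one line are settled, an affine
    change of coordinates leads to [normalized_assoc]. *)
Lemma paddA P Q R : points W setT P -> points W setT Q -> points W setT R ->
  padd W (padd W P Q) R = padd W P (padd W Q R).
Proof.
move=> pP pQ pR.
case: (paddP pP pQ) (padd_points pP pQ) => [-> //|->|EQ _|m c u q v EP EQ col _ pA].
- by [].
- by rewrite EQ -{1}[P]poppK padd_oppK // ?popp_points // -EQ.
case: (paddP pQ pR) (padd_points pQ pR) => [EQ' //|->|ER _|m' c' q' r t EQ' ER col' _ pB].
- by rewrite EQ' in EQ.
- by rewrite paddNone -(collinear_padd col) -EP -EQ.
- rewrite ER paddNone -(collinear_padd col) -EP -EQ (paddC pP pQ).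
  have pO := popp_points pQ.
  by rewrite (paddC _ pO); [rewrite padd_oppK | exact: padd_points].
have [eq eyq] : q' = q /\ m' * q + c' = m * q + c.
  by move: EQ; rewrite EQ' => -[-> e]; rewrite e.
subst q' P R; rewrite {EQ'} in pP pR *.
(* In the first case P + (Q + R) = 0, so P is the third point of the line through Q and R. *)
have [EB|nB] := eqVneq (third m' c' t) (popp W (Some (u, m * u + c))).
  have eP : Some (u, m * u + c) = Some (t, m' * t + c').
    by rewrite -[LHS]poppK -EB; congr (Some (_, _)); ring.
  rewrite EB padd_popp -(collinear_padd col) eP -eyq.
  by rewrite (collinear_padd (collinearC (collinearCA col'))); exact: (popp_padd (Some (r, m' * r + c'))).
have [e12 e14 _] := collinear_coefs col.
have [e22 e24 _] := collinear_coefs col'.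
have ec : c' = c - (m' - m) * q by apply: (linear_comb1 eyq); ring.
have Et : t = m' ^+ 2 + a1 W * m' - (m ^+ 2 + a1 W * m - (u + q + v)) - q - r.
  by apply: (linear_comb1 (etrans (esym e12) e22)); ring.
(* Equal slopes put P, Q, R on one line, so r is u or v: either R = P, or R is the third point of
   the line PQ, which [nB] excludes. *)
have [emm|nmm] := eqVneq m' m.
  have ecc : c' = c by rewrite ec emm; ring.
  have : (r - u) * (r - v) = 0.
    apply: (linear_comb1 (etrans (esym e14) e24)).
    by rewrite Et emm ecc; ring.
  move=> /eqP; rewrite mulf_eq0 !subr_eq0 => /orP[] /eqP er.
    rewrite -(collinear_padd col) -(collinear_padd col') emm ecc er.
    by rewrite -EQ (paddC (padd_points pP pQ) pP) (paddC pP pQ).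
  case/eqP: nB; rewrite -(collinear_padd col') eyq emm ecc er.
  by rewrite (collinear_padd (collinearCA (collinearC col))).
case: (paddP pA pR) => [//|//|ER|n d v0 r0 X [<- EA] [<- ER] colA nA].
  have eR : Some (r, m' * r + c') = Some (v, m * v + c).
    by rewrite ER; congr (Some (_, _)); ring.
  rewrite -(collinear_padd col') eR eyq.
  by rewrite (collinear_padd (collinearCA (collinearC col))); exact/esym/(padd_popp (Some (u, m * u + c))).
case: (paddP pP pB) => [//|//|EB|n' d' u0 t0 X' [<- EP] [<- EB] colB _].
  by rewrite EB eqxx in nB.
have [e32 e34 _] := collinear_coefs colA.
have [e42 e44 _] := collinear_coefs colB.
have EX : X = n ^+ 2 + a1 W * n - (m ^+ 2 + a1 W * m - (u + q + v)) - v - r.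
  by apply: (linear_comb1 (etrans (esym e12) e32)); ring.
have EX' : X' = n' ^+ 2 + a1 W * n' - (m ^+ 2 + a1 W * m - (u + q + v)) - u - t.
  by apply: (linear_comb1 (etrans (esym e12) e42)); ring.
have Ed : d = m' * r + c' - n * r by rewrite ER; ring.
have Ed' : d' = m * u + c - n' * u by rewrite EP; ring.
(* Translate Q to the origin and subtract the slope m, so that the line PQ becomes the x-axis; a1
   and a3 change accordingly. *)
have [] := @normalized_assoc K (u - q) (v - q) (r - q) (t - q) (m' - m)
  (a1 W + 2%:R * m) (q * (a1 W + 2%:R * m) + 2%:R * c + a3 W) (n - m) (n' - m).
- by rewrite subr_eq0.
- by rewrite Et; ring.
- by apply: (linear_comb1 (etrans (esym e24) e14)); rewrite Et ec; ring.
- by apply: (linear_comb1 EA); rewrite Ed ec; ring.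
- have E : a4 W - (n + m + a1 W) * (n * v + d)
     = a4 W - (n + m + a1 W) * (- (m * v + c) - a1 W * v - a3 W) by rewrite EA.
  rewrite {1}e34 e14 in E.
  by apply: (linear_comb1 E); rewrite EX Ed ec; ring.
- move=> /addIr evr; subst v; rewrite subr_eq0; apply/eqP => erq; subst r.
  by apply: nA; rewrite eyq; congr (Some (_, _)); ring.
- by apply: (linear_comb1 (esym EB)); rewrite Ed' ec; ring.
- have E : a4 W - (n' - m) * (n' * t + d')
     = a4 W - (n' - m) * (- (m' * t + c') - a1 W * t - a3 W) by rewrite EB.
  rewrite {1}e44 e14 in E.
  by apply: (linear_comb1 E); rewrite EX' Ed' ec; ring.
- move=> /addIr eut; subst u; rewrite subr_eq0; apply/eqP => erq; subst t.
  by case/eqP: nB; rewrite -eyq /third.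
move=> E1 E2.
have EXX : X = X' by apply: (linear_comb1 E1); rewrite EX EX'; ring.
rewrite /third EXX; congr (Some (_, _)).
rewrite -EXX.
by have := congr2 +%R E2 (erefl 0); rewrite !addr0 => E3; apply: (linear_comb1 (esym E3)); rewrite Ed Ed' ec EX; ring.
Qed.

End GroupLaw.

(** * Subfields and rational points *)

Section Subfield.
Variables (K : fieldType) (B : set K).
Hypothesis sB : divring_closed [in B].

Lemma sub1 : B 1.
Proof. by case: sB => /set_mem. Qed.
Lemma subB x y : B x -> B y -> B (x - y).
Proof. by case: sB => _ h _ /mem_set Bx /mem_set By; apply/set_mem/h. Qed.
Lemma subdiv x y : B x -> B y -> B (x / y).
Proof. by case: sB => _ _ h /mem_set Bx /mem_set By; apply/set_mem/h. Qed.
Lemma sub0 : B 0.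
Proof. by rewrite -(subrr 1); apply: subB; apply: sub1. Qed.
Lemma subN x : B x -> B (- x).
Proof. by rewrite -sub0r; apply: subB; apply: sub0. Qed.
Lemma subD x y : B x -> B y -> B (x + y).
Proof. by move=> Bx By; rewrite -[y]opprK; apply/subB/subN. Qed.
Lemma subV x : B x -> B x^-1.
Proof. by rewrite -div1r; apply: subdiv; apply: sub1. Qed.
Lemma subM x y : B x -> B y -> B (x * y).
Proof. by move=> Bx By; rewrite -[y]invrK; apply/subdiv/subV. Qed.
Lemma subX x n : B x -> B (x ^+ n).
Proof. by move=> Bx; elim: n => [|n IH]; [apply: sub1 | rewrite exprS; apply: subM]. Qed.
Lemma subMn x n : B x -> B (x *+ n).
Proof.
by move=> Bx; elim: n => [|n IH]; [apply: sub0 | rewrite mulrS; apply: subD].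
Qed.
Lemma subsum I (r : seq I) (P : pred I) (f : I -> K) :
  (forall i, P i -> B (f i)) -> B (\sum_(i <- r | P i) f i).
Proof. by move=> h; elim/big_ind: _ => //; [apply: sub0 | apply: subD]. Qed.

End Subfield.

Lemma subfield_setT (K : fieldType) : divring_closed [in [set: K]].
Proof. split; try by move=> *; apply/mem_set. Qed.

Lemma range_subfield (K K' : fieldType) (f : {rmorphism K -> K'}) :
  divring_closed [in range f].
Proof.
split.
- by apply/mem_set; exists 1 => //; rewrite rmorph1.
- by move=> _ _ /set_mem[x _ <-] /set_mem[y _ <-]; apply/mem_set; exists (x - y) => //; rewrite rmorphB.
- by move=> _ _ /set_mem[x _ <-] /set_mem[y _ <-]; apply/mem_set; exists (x / y) => //; rewrite fmorph_div.
Qed.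

Ltac subf sB := repeat first [assumption | exact: (sub1 sB) | exact: (sub0 sB)
  | apply: (subD sB) | apply: (subN sB) | apply: (subM sB) | apply: (subV sB)
  | apply: (subX sB) | apply: (subMn sB)].

(** Elements of [galois_group] are total functions that respect the operations only on a subfield,
    so morphisms are taken relative to B. *)
Definition partial_hom (K K' : fieldType) (B : set K) (f : K -> K') :=
  [/\ forall x y, B x -> B y -> f (x + y) = f x + f y,
      forall x y, B x -> B y -> f (x * y) = f x * f y & f 1 = 1].

Lemma rmorph_partial_hom (K K' : fieldType) (f : {rmorphism K -> K'}) :
  partial_hom setT f.
Proof. by split=> [x y _ _|x y _ _|]; rewrite ?rmorphD ?rmorphM ?rmorph1. Qed.

Section PartialHom.
Variables (K K' : fieldType) (B : set K) (f : K -> K').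
Hypotheses (sB : divring_closed [in B]) (fP : partial_hom B f).

Lemma phomD x y : B x -> B y -> f (x + y) = f x + f y.
Proof. by case: fP => h _ _; apply: h. Qed.
Lemma phomM x y : B x -> B y -> f (x * y) = f x * f y.
Proof. by case: fP => _ h _; apply: h. Qed.
Lemma phom1 : f 1 = 1. Proof. by case: fP. Qed.
Lemma phom0 : f 0 = 0.
Proof.
by apply: (@addrI _ (f 0)); rewrite -phomD ?addr0 //; apply: sub0.
Qed.
Lemma phomN x : B x -> f (- x) = - f x.
Proof.
move=> Bx; apply: (@addrI _ (f x)); rewrite -phomD ?subrr ?phom0 //.
exact: subN.
Qed.
Lemma phomB x y : B x -> B y -> f (x - y) = f x - f y.
Proof. by move=> Bx By; rewrite phomD ?phomN //; apply: subN. Qed.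
Lemma phomX x n : B x -> f (x ^+ n) = f x ^+ n.
Proof.
move=> Bx; elim: n => [|n IH]; first by rewrite !expr0 phom1.
by rewrite !exprS phomM ?IH //; apply: subX.
Qed.
Lemma phomMn x n : B x -> f (x *+ n) = f x *+ n.
Proof.
move=> Bx; elim: n => [|n IH]; first by rewrite !mulr0n phom0.
by rewrite !mulrS phomD ?IH //; apply: subMn.
Qed.
Lemma phom_nat n : f n%:R = n%:R.
Proof. by rewrite phomMn ?phom1 //; apply: sub1. Qed.
Lemma phom_eq0 x : B x -> (f x == 0) = (x == 0).
Proof.
move=> Bx; have [->|x0] := eqVneq x 0; first by rewrite phom0 eqxx.
apply/eqP => fx0; have := phom1; rewrite -(mulfV x0) phomM //; last exact: subV.
by rewrite fx0 mul0r => /esym/eqP; rewrite oner_eq0.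
Qed.
Lemma phom_inj x y : B x -> B y -> f x = f y -> x = y.
Proof.
move=> Bx By e; apply/eqP; rewrite -subr_eq0 -phom_eq0; last exact: subB.
by rewrite phomB // e subrr.
Qed.
Lemma phom_eq x y : B x -> B y -> (f x == f y) = (x == y).
Proof. by move=> Bx By; apply/eqP/eqP => [/phom_inj|->] //; apply. Qed.
Lemma phomV x : B x -> f x^-1 = (f x)^-1.
Proof.
move=> Bx; have [->|x0] := eqVneq x 0; first by rewrite invr0 phom0 invr0.
apply: (@mulfI _ (f x)); first by rewrite phom_eq0.
by rewrite -phomM ?mulfV ?phom1 ?phom_eq0 //; apply: subV.
Qed.
Lemma phomdiv x y : B x -> B y -> f (x / y) = f x / f y.
Proof. by move=> Bx By; rewrite phomM ?phomV //; apply: subV. Qed.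
Lemma phom_sum I (r : seq I) (P : pred I) (g : I -> K) :
  (forall i, P i -> B (g i)) ->
  f (\sum_(i <- r | P i) g i) = \sum_(i <- r | P i) f (g i).
Proof.
move=> Bg; have [//] : B (\sum_(i <- r | P i) g i) /\
  f (\sum_(i <- r | P i) g i) = \sum_(i <- r | P i) f (g i).
elim/big_rec2: _ => [|i x y Pi [By <-]]; first by rewrite phom0; split=> //; apply: sub0.
by split; [apply: subD; auto | rewrite phomD //; auto].
Qed.

End PartialHom.

Definition coefs_in (K : fieldType) (B : set K) (W : weierstrass K) :=
  [/\ B (a1 W), B (a2 W), B (a3 W), B (a4 W) & B (a6 W)].

Section MapPoint.
Variables (K K' : fieldType) (B : set K) (f : K -> K') (W : weierstrass K).
Hypotheses (sB : divring_closed [in B]) (fP : partial_hom B f) (cW : coefs_in B W).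

Let B1 : B (a1 W). Proof. by case: cW. Qed.
Let B2 : B (a2 W). Proof. by case: cW. Qed.
Let B3 : B (a3 W). Proof. by case: cW. Qed.
Let B4 : B (a4 W). Proof. by case: cW. Qed.
Let B6 : B (a6 W). Proof. by case: cW. Qed.

Lemma weqx_rat x y : B x -> B y -> B (weq_x W x y).
Proof. by move=> *; rewrite /weq_x; subf sB. Qed.
Lemma weqy_rat x y : B x -> B y -> B (weq_y W x y).
Proof. by move=> *; rewrite /weq_y; subf sB. Qed.

Ltac phm := repeat first [assumption
  | rewrite (phom_nat sB fP) | rewrite (phomdiv sB fP) | rewrite (phomD fP) | rewrite (phomB sB fP)
  | rewrite (phomN sB fP) | rewrite (phomX sB fP) | rewrite (phomM fP)]; try by subf sB.

Lemma weq_map x y : B x -> B y -> weq (map_curve f W) (f x) (f y) = f (weq W x y).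
Proof. move=> Bx By; rewrite /weq; phm. Qed.
Lemma weqx_map x y : B x -> B y -> weq_x (map_curve f W) (f x) (f y) = f (weq_x W x y).
Proof. by move=> Bx By; rewrite /weq_x; phm. Qed.
Lemma weqy_map x y : B x -> B y -> weq_y (map_curve f W) (f x) (f y) = f (weq_y W x y).
Proof. by move=> Bx By; rewrite /weq_y; phm. Qed.
Lemma disc_map : disc (map_curve f W) = f (disc W).
Proof. by rewrite /disc /b2 /b4 /b6 /b8; phm. Qed.

Lemma popp_rat P : points W B P -> points W B (popp W P).
Proof.
by case: P => [[x y] [Bx By w]|//]; split; rewrite ?popp_weq //; subf sB.
Qed.

Lemma padd_rat P Q : disc W != 0 ->
  points W B P -> points W B Q -> points W B (padd W P Q).
Proof.
move=> nz pP pQ.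
have pT R : points W B R -> points W setT R by case: R => [[x y] []|].
have := padd_points nz (pT _ pP) (pT _ pQ).
case: P Q pP pQ => [[x1 y1]|] // [[x2 y2]|] // [Bx1 By1 _] [Bx2 By2 _].
rewrite /padd; case: ifP => // _; set m := (if _ then _ else _).
have Bm : B m.
  have wx := weqx_rat Bx1 By1; have wy := weqy_rat Bx1 By1.
  by rewrite /m; case: ifP => _; subf sB.
by case=> _ _ w; split=> //; subf sB.
Qed.

Lemma padd_map P Q : points W B P -> points W B Q ->
  padd (map_curve f W) (map_point f P) (map_point f Q) = map_point f (padd W P Q).
Proof.
case: P Q => [[x1 y1]|] // [[x2 y2]|] // [Bx1 By1 _] [Bx2 By2 _].
rewrite /padd /= (phom_eq sB fP) //.
have -> : (f y1 + f y2 + f (a1 W) * f x2 + f (a3 W) == 0) =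
    (y1 + y2 + a1 W * x2 + a3 W == 0).
  by rewrite -(phom_eq0 sB fP); [congr (_ == _); phm | subf sB].
case: ifP => // _.
have -> : (if x1 == x2 then - weq_x (map_curve f W) (f x1) (f y1) /
      weq_y (map_curve f W) (f x1) (f y1) else (f y2 - f y1) / (f x2 - f x1)) =
    f (if x1 == x2 then - weq_x W x1 y1 / weq_y W x1 y1 else (y2 - y1) / (x2 - x1)).
  have wx := weqx_rat Bx1 By1; have wy := weqy_rat Bx1 By1.
  by case: ifP => _; rewrite ?weqx_map ?weqy_map //; phm.
set m := (if _ then _ else _).
have Bm : B m.
  have wx := weqx_rat Bx1 By1; have wy := weqy_rat Bx1 By1.
  by rewrite /m; case: ifP => _; subf sB.
by congr (Some (_, _)); phm.
Qed.

Lemma points_map P : points W B P -> points (map_curve f W) setT (map_point f P).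
Proof.
case: P => [[x y] [Bx By w]|//]; split=> //.
by rewrite weq_map // w (phom0 sB fP).
Qed.

End MapPoint.

(** * Elliptic curves and their groups of points *)

Record ecurve (K : fieldType) :=
  Ecurve { curve_of :> weierstrass K; curve_nz : disc curve_of != 0 }.

Section EPoint.
Variables (K : fieldType) (E : ecurve K).

(** Membership is stated as a boolean, so its proof is unique and [pt] is injective. *)
Record epoint := EPoint { pt : point K; ptP_ : `[< points E setT pt >] }.
HB.instance Definition _ := [isSub for pt].
HB.instance Definition _ := [Choice of epoint by <:].

Lemma ptP (P : epoint) : points E setT (pt P).
Proof. exact/asboolP/ptP_. Qed.

Definition mkpt (P : point K) (h : points E setT P) : epoint := EPoint (introT (asboolP _) h).

Definition eadd (P Q : epoint) := mkpt (padd_points (curve_nz E) (ptP P) (ptP Q)).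
Definition eopp (P : epoint) := mkpt (popp_points (ptP P)).
Definition ezero : epoint := @mkpt None I.

Lemma eaddA : associative eadd.
Proof. by move=> P Q R; apply/val_inj/esym/paddA; rewrite ?curve_nz //; apply: ptP. Qed.
Lemma eaddC : commutative eadd.
Proof. by move=> P Q; apply/val_inj/paddC; rewrite ?curve_nz //; apply: ptP. Qed.
Lemma eadd0 : left_id ezero eadd.
Proof. by move=> P; apply/val_inj. Qed.
Lemma eaddN : left_inverse ezero eopp eadd.
Proof. by move=> P; apply/val_inj/popp_padd. Qed.

HB.instance Definition _ := GRing.isZmodule.Build epoint eaddA eaddC eadd0 eaddN.

Lemma pt_inj : injective pt. Proof. exact: val_inj. Qed.
Lemma ptD (P Q : epoint) : pt (P + Q) = padd E (pt P) (pt Q). Proof. by []. Qed.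
Lemma ptN (P : epoint) : pt (- P) = popp E (pt P). Proof. by []. Qed.
Lemma ptMn (P : epoint) n : pt (P *+ n) = pmul E n (pt P).
Proof. by elim: n => [|n IH] //=; rewrite mulrS ptD IH. Qed.
Lemma pt_eq0 (P : epoint) : (pt P == None) = (P == 0).
Proof. by []. Qed.

Section Rational.
Variable B : set K.
Hypotheses (sB : divring_closed [in B]) (cW : coefs_in B E).

Definition rat (P : epoint) := points E B (pt P).

Lemma rat0 : rat 0. Proof. by []. Qed.
Lemma ratD P Q : rat P -> rat Q -> rat (P + Q).
Proof. by move=> rP rQ; apply: padd_rat => //; apply: curve_nz. Qed.
Lemma ratN P : rat P -> rat (- P).
Proof. exact: popp_rat. Qed.
Lemma ratB P Q : rat P -> rat Q -> rat (P - Q).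
Proof. by move=> rP rQ; apply/ratD/ratN. Qed.
Lemma ratMn P n : rat P -> rat (P *+ n).
Proof. by move=> rP; elim: n => [|n IH]; rewrite ?mulr0n // mulrS; apply: ratD. Qed.
Lemma ratsum I (r : seq I) (Q : pred I) (g : I -> epoint) :
  (forall i, Q i -> rat (g i)) -> rat (\sum_(i <- r | Q i) g i).
Proof. by move=> h; elim/big_ind: _ => //; apply: ratD. Qed.

End Rational.

Lemma rat_sub (B B' : set K) P : B `<=` B' -> rat B P -> rat B' P.
Proof. by rewrite /rat; move=> sub; case: (pt P) => [[x y] []|//]; split; auto. Qed.

Lemma rat_setT P : rat setT P. Proof. exact: ptP. Qed.

End EPoint.
Arguments ezero {K E}.

(* Meaningful only when [map_point f] sends [P] to a point of [E'] *)
Definition pmap (K K' : fieldType) (E : ecurve K) (E' : ecurve K') (f : K -> K')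
    (P : epoint E) : epoint E' :=
  if pselect (points E' setT (map_point f (pt P))) is left h then mkpt h else 0.

Section PMap.
Variables (K K' : fieldType) (E : ecurve K) (E' : ecurve K') (B : set K) (f : K -> K').
Hypotheses (sB : divring_closed [in B]) (fP : partial_hom B f) (cW : coefs_in B E).
Hypothesis EE' : map_curve f E = E'.

Lemma pt_pmap (P : epoint E) : rat B P -> pt (pmap E' f P) = map_point f (pt P).
Proof.
move=> rP; rewrite /pmap; case: pselect => // - []; rewrite -EE'.
exact: points_map rP.
Qed.

Lemma pmapD (P Q : epoint E) : rat B P -> rat B Q ->
  pmap E' f (P + Q) = pmap E' f P + pmap E' f Q.
Proof.
move=> rP rQ; have rPQ := ratD sB cW rP rQ; apply: pt_inj.
by rewrite ptD !pt_pmap // ptD -EE' (padd_map sB).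
Qed.

Lemma pmap0 : pmap E' f (0 : epoint E) = 0.
Proof. by apply: pt_inj; rewrite pt_pmap. Qed.

Lemma pmapN (P : epoint E) : rat B P -> pmap E' f (- P) = - pmap E' f P.
Proof.
move=> rP; apply: (@addrI _ (pmap E' f P)).
by rewrite -pmapD ?subrr ?pmap0 //; apply: ratN.
Qed.

Lemma pmapB (P Q : epoint E) : rat B P -> rat B Q ->
  pmap E' f (P - Q) = pmap E' f P - pmap E' f Q.
Proof. by move=> rP rQ; rewrite pmapD ?pmapN //; apply: ratN. Qed.

Lemma pmapMn (P : epoint E) n : rat B P -> pmap E' f (P *+ n) = pmap E' f P *+ n.
Proof.
move=> rP; elim: n => [|n IH]; first by rewrite !mulr0n pmap0.
by rewrite !mulrS pmapD ?IH //; apply: ratMn.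
Qed.

Lemma pmap_sum I (r : seq I) (Q : pred I) (g : I -> epoint E) :
  (forall i, Q i -> rat B (g i)) ->
  pmap E' f (\sum_(i <- r | Q i) g i) = \sum_(i <- r | Q i) pmap E' f (g i).
Proof.
move=> Bg; have [//] : rat B (\sum_(i <- r | Q i) g i) /\
  pmap E' f (\sum_(i <- r | Q i) g i) = \sum_(i <- r | Q i) pmap E' f (g i).
elim/big_rec2: _ => [|i x y Pi [By <-]]; first by rewrite pmap0.
by split; [apply: ratD; auto | rewrite pmapD //; auto].
Qed.

End PMap.

Section SubfieldType.
Variables (K : fieldType) (k : set K) (sk : divring_closed [in k]).
(** The argument ties the predicate to its closure proof, from which the canonical structure on
    [subf_pred sk] is built. *)
Definition subf_pred (h : divring_closed [in k]) : {pred K} := [in k].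
HB.instance Definition _ := GRing.isDivringClosed.Build K (subf_pred sk) sk.
Record subf_type := SubfType { subf_val : K; _ : subf_val \in subf_pred sk }.
HB.instance Definition _ := [isSub for subf_val].
HB.instance Definition _ := [Choice of subf_type by <:].
HB.instance Definition _ := [SubChoice_isSubComUnitRing of subf_type by <:].
HB.instance Definition _ := [SubComUnitRing_isSubIntegralDomain of subf_type by <:].
HB.instance Definition _ := [SubIntegralDomain_isSubField of subf_type by <:].
End SubfieldType.

(* Subfields are sets in [Defs]; polynomial arithmetic needs a [fieldType]. *)
Lemma subfield_type (K : fieldType) (k : set K) : divring_closed [in k] ->
  exists (S : fieldType) (io : {rmorphism S -> K}),
    forall x, k x <-> exists a, io a = x.
Proof.
move=> sk; exists (subf_type sk), (\val : {rmorphism subf_type sk -> K}) => x.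
split=> [kx|[[a ka] <-]]; last exact: set_mem ka.
by exists (SubfType (mem_set kx : x \in subf_pred sk)).
Qed.

(** * Algebraic closures of subfields *)

Section Algebraic.
Variables (K : fieldType).
Implicit Types (k : set K) (q : {poly K}).

Definition poly_in k q := forall i, k q`_i.

Definition algcl k : set K := [set x | exists q, [/\ q != 0, poly_in k q & root q x]].

Lemma poly_in_sub k k' q : k `<=` k' -> poly_in k q -> poly_in k' q.
Proof. by move=> s h i; apply/s/h. Qed.

Lemma algcl_sub k k' : k `<=` k' -> algcl k `<=` algcl k'.
Proof. by move=> s x [q [q0 h r]]; exists q; split=> //; apply: poly_in_sub h. Qed.

Variable k : set K.
Variables (S : fieldType) (io : {rmorphism S -> K}).
Hypothesis kE : forall x, k x <-> exists a, io a = x.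

Lemma incP (a : S) : k (io a).
Proof. by apply/kE; exists a. Qed.

Lemma incK x : k x -> exists a : S, io a = x.
Proof. by move/kE. Qed.

Lemma poly_in_map (p : {poly S}) : poly_in k (map_poly io p).
Proof. by move=> i; rewrite coef_map; apply: incP. Qed.

Lemma poly_in_lift q : poly_in k q -> exists p : {poly S}, map_poly io p = q.
Proof.
move=> h; have /choice[f fE] : forall i, exists a : S, io a = q`_i.
  by move=> i; apply/incK/h.
exists (\poly_(i < size q) f i); apply/polyP => i.
rewrite coef_map coef_poly; case: ltnP => le; first exact: fE.
by rewrite nth_default // raddf0.
Qed.

Lemma algclP x : algcl k x <-> algebraicOver io x.
Proof.
split=> [[q [q0 hq r]]|[p p0 r]].
  have [p e] := poly_in_lift hq; rewrite -{q hq}e in q0 r.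
  by exists p => //; rewrite map_poly_eq0 in q0.
exists (map_poly io p); split=> //; last exact: poly_in_map.
by rewrite map_poly_eq0.
Qed.

Lemma minpoly x : algcl k x -> exists m : {poly S},
  [/\ m \is monic, irreducible_poly m, root (map_poly io m) x &
      forall g : {poly S}, root (map_poly io g) x -> m %| g].
Proof.
move=> /algclP/integral_algebraic[p0 mon0 r0].
pose Q n := `[< exists m : {poly S}, [/\ m \is monic, root (map_poly io m) x & size m = n] >].
have exQ : exists n, Q n by exists (size p0); apply/asboolP; exists p0.
case: (ex_minnP exQ) => n /asboolP[m [mon r sz]] min.
have minm (g : {poly S}) : g != 0 -> root (map_poly io g) x -> (size m <= size g)%N.
  move=> g0 rg; rewrite sz; apply: min; apply/asboolP; exists ((lead_coef g)^-1 *: g).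
  have l0 : lead_coef g != 0 by rewrite lead_coef_eq0.
  split; first by rewrite monicE lead_coefZ mulVf.
    by rewrite map_polyZ rootZ ?fmorph_eq0 // invr_eq0.
  by rewrite size_scale // invr_eq0.
have dv (g : {poly S}) : root (map_poly io g) x -> m %| g.
  move=> rg; rewrite /dvdp; apply/negPn/negP => g0.
  have := minm _ g0; rewrite leqNgt ltn_modp monic_neq0 // => /(_ _)/notF; apply.
  have -> : g %% m = g - g %/ m * m by rewrite {2}(divp_eq g m) addrC addKr.
  rewrite rmorphB rmorphM /= rootE hornerD hornerN hornerM.
  by rewrite (rootP rg) (rootP r) mulr0 subr0.
exists m; split=> //; split.
  rewrite ltnNge; apply/negP => le1.
  have : size m = 1%N.
    by apply/eqP; rewrite eqn_leq le1 size_poly_gt0 monic_neq0.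
  move=> /eqP/size_poly1P[c c0 em]; move: r.
  by rewrite em map_polyC rootC fmorph_eq0 (negPf c0).
move=> d d1 /dvdpP[c ec]; apply/andP; split; first by rewrite ec dvdp_mull.
have m0 := monic_neq0 mon.
have [c0 d0] : c != 0 /\ d != 0 by apply/andP; rewrite -negb_or -mulf_eq0 -ec.
move: r; rewrite ec rmorphM /= rootM => /orP[rc|rd]; last by rewrite -ec; apply: dv.
have := minm _ c0 rc; rewrite ec size_mul // => le.
have : (size d <= 1)%N.
  rewrite -(leq_add2l (size c)); apply: leq_trans (leqSpred _) _.
  by rewrite addn1 ltnS.
by rewrite leq_eqVlt (negPf d1) ltnS leqn0 size_poly_eq0 (negPf d0).
Qed.

End Algebraic.

Section AlgebraicClosure.
Variables (K : fieldType) (k : set K).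
Hypothesis sk : divring_closed [in k].
Implicit Type q : {poly K}.

Lemma poly_in1 : poly_in k 1.
Proof. by move=> i; rewrite coef1; case: eqP => _; [apply: sub1 | apply: sub0]. Qed.
Lemma poly_inC c : k c -> poly_in k c%:P.
Proof. by move=> kc i; rewrite coefC; case: eqP => _ //; apply: sub0. Qed.
Lemma poly_inX : poly_in k 'X.
Proof. by move=> i; rewrite coefX; case: eqP => _; [apply: sub1 | apply: sub0]. Qed.
Lemma poly_inB p q : poly_in k p -> poly_in k q -> poly_in k (p - q).
Proof. by move=> hp hq i; rewrite coefB; apply: subB. Qed.
Lemma poly_inM p q : poly_in k p -> poly_in k q -> poly_in k (p * q).
Proof. by move=> hp hq i; rewrite coefM; apply: subsum => // j _; apply: subM. Qed.
Lemma poly_in_XsubC x : k x -> poly_in k ('X - x%:P).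
Proof. by move=> kx; apply: poly_inB; [apply: poly_inX | apply: poly_inC]. Qed.
Lemma poly_in_prod I (r : seq I) (P : pred I) (f : I -> {poly K}) :
  (forall i, P i -> poly_in k (f i)) -> poly_in k (\prod_(i <- r | P i) f i).
Proof. by move=> h; elim/big_ind: _ => //; [apply: poly_in1 | apply: poly_inM]. Qed.
Lemma poly_in_horner q x : poly_in k q -> k x -> k q.[x].
Proof.
move=> hq kx; rewrite horner_coef; apply: subsum => // i _.
by apply: subM => //; apply: subX.
Qed.

Lemma sub_algcl : k `<=` algcl k.
Proof.
move=> x kx; have [S [io kE]] := subfield_type sk.
by apply/(algclP kE); have [a <-] := incK kE kx; apply: algebraic_id.
Qed.

Lemma algcl_subfield : divring_closed [in algcl k].
Proof.
have [S [io kE]] := subfield_type sk; split.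
- by apply/mem_set/(algclP kE)/algebraic1.
- move=> x y /set_mem/(algclP kE) ax /set_mem/(algclP kE) ay.
  by apply/mem_set/(algclP kE)/algebraic_sub.
- move=> x y /set_mem/(algclP kE) ax /set_mem/(algclP kE) ay.
  by apply/mem_set/(algclP kE)/algebraic_div.
Qed.

Lemma algcl_root q x : q != 0 -> poly_in (algcl k) q -> root q x -> algcl k x.
Proof.
have [S [io kE]] := subfield_type sk => q0 h r.
apply/(algclP kE)/integral_algebraic; apply: (integral_root q0 r).
by move=> z /(nthP 0)[i _ <-]; apply/integral_algebraic/(algclP kE)/h.
Qed.

Lemma algcl_trans k' : k' `<=` algcl k -> algcl k' `<=` algcl k.
Proof. by move=> s x [q [q0 hq r]]; apply: (algcl_root q0 _ r) => i; apply/s/hq. Qed.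

(* k[x], a field when x is algebraic over k *)
Definition adjoin x : set K := [set z | exists2 g, poly_in k g & z = g.[x]].

Lemma adjoin_gen x : adjoin x x.
Proof. by exists 'X; [apply: poly_inX | rewrite hornerX]. Qed.

Lemma sub_adjoin x : k `<=` adjoin x.
Proof. by move=> a ka; exists a%:P; [apply: poly_inC | rewrite hornerC]. Qed.

Lemma adjoin_subfield x : algcl k x -> divring_closed [in adjoin x].
Proof.
move=> ax; have [S [io kE]] := subfield_type sk; have [m [_ irr r dv]] := minpoly kE ax.
have clM y z : adjoin x y -> adjoin x z -> adjoin x (y * z).
  move=> [g hg ->] [h hh ->]; exists (g * h); last by rewrite hornerM.
  exact: poly_inM.
split.
- by apply/mem_set; apply: sub_adjoin; apply: sub1.
- move=> _ _ /set_mem[g hg ->] /set_mem[h hh ->]; apply/mem_set.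
  by exists (g - h); [apply: poly_inB | rewrite hornerD hornerN].
- move=> y _ /set_mem Ay /set_mem[h hh ->]; apply/mem_set; apply: clM => //.
  have [->|h0] := eqVneq h.[x] 0; first by rewrite invr0; apply: sub_adjoin; apply: sub0.
  have [p ep] := poly_in_lift kE hh.
  have /Bezout_eq1_coprimepP[[u v] /= euv] : coprimep m p.
    apply/negPn/negP => sz; have eg := irr.2 _ sz (dvdp_gcdl _ _).
    have := eqp_dvdl p eg; rewrite dvdp_gcdr => /esym/dvdpP[c ec].
    by case/eqP: h0; rewrite -ep ec rmorphM /= hornerM (rootP r) mulr0.
  exists (map_poly io v); first exact: (poly_in_map kE).
  apply: (mulIf h0); rewrite mulVf // -ep -hornerM -rmorphM /=.
  have -> : v * p = 1 - u * m by rewrite -euv addrC addKr.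
  by rewrite rmorphB rmorphM /= rmorph1 hornerD hornerN hornerM (rootP r) mulr0 subr0 hornerE.
Qed.

Lemma adjoin_algcl x : algcl k x -> adjoin x `<=` algcl k.
Proof.
move=> ax _ [g hg ->]; have sA := algcl_subfield.
rewrite horner_coef; apply: (subsum sA) => i _.
by apply: (subM sA); [apply/sub_algcl/hg | apply: (subX sA)].
Qed.

End AlgebraicClosure.

(** * Points over purely inseparable extensions *)

Section InvariantDifferential.
Variables (K : fieldType) (E : ecurve K) (B : set K) (d : K -> K).
Hypotheses (sB : divring_closed [in B]) (cW : coefs_in B E).
Hypothesis dD : forall x y, B x -> B y -> d (x + y) = d x + d y.
Hypothesis dM : forall x y, B x -> B y -> d (x * y) = x * d y + y * d x.
Hypotheses (d1 : d (a1 E) = 0) (d2 : d (a2 E) = 0) (d3 : d (a3 E) = 0)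
  (d4 : d (a4 E) = 0).

Let B1 : B (a1 E). Proof. by case: cW. Qed.
Let B2 : B (a2 E). Proof. by case: cW. Qed.
Let B3 : B (a3 E). Proof. by case: cW. Qed.
Let B4 : B (a4 E). Proof. by case: cW. Qed.

Lemma der0 : d 0 = 0.
Proof. by apply: (@addrI _ (d 0)); rewrite -dD ?addr0 //; apply: (sub0 sB). Qed.
Lemma derN x : B x -> d (- x) = - d x.
Proof.
move=> Bx; apply: (@addrI _ (d x)).
by rewrite -dD ?subrr ?der0 //; apply: (subN sB).
Qed.

(* The value [c] of the invariant differential dx / weq_y = - dy / weq_x along
   the derivation [d] at [P]. *)
Definition omega (P : epoint E) (c : K) :=
  if pt P is Some (x, y) then d x = c * weq_y E x y /\ d y = - c * weq_x E x y
  else c = 0.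

(** At a smooth point weq_x or weq_y is nonzero, so the value of the differential is determined. *)
Lemma omega_eq c1 c2 P Q : omega P c1 -> omega Q c2 -> P = Q -> c1 = c2.
Proof.
move=> + + e; rewrite -{}e /omega; case: (pt P) (ptP P) => [[x y] [_ _ w]|_ -> -> //].
move=> [ex ey] [ex' ey'].
have [wy|wy] := eqVneq (weq_y E x y) 0; last first.
  by apply: (mulIf wy); rewrite -ex -ex'.
have wx : weq_x E x y != 0.
  apply/eqP => wx; have := curve_nz E; by rewrite (singular_disc w wx wy) eqxx.
by apply: (mulIf wx); apply: oppr_inj; rewrite -!mulNr -ey -ey'.
Qed.

Lemma omegaN P c : rat B P -> omega P c -> omega (- P) (- c).
Proof.
rewrite /rat /omega /=; case: (pt P) => [[x y] [Bx By _]|_ ->]; last by rewrite oppr0.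
move=> [ex ey] /=; split; first by rewrite ex /weq_y; ring.
rewrite dD ?derN ?dD ?derN ?dM ?d1 ?d3 ?ex ?ey; try by subf sB.
by rewrite /weq_x /weq_y; ring.
Qed.

(** Additivity expresses the translation invariance of the differential. Differentiating the line y
    = m x + c at P and Q yields d m and d c, hence the differential at the third point. *)
Lemma omegaD P Q c1 c2 : rat B P -> rat B Q ->
  omega P c1 -> omega Q c2 -> omega (P + Q) (c1 + c2).
Proof.
move=> rP rQ oP oQ; rewrite /omega ptD.
case: (paddP (curve_nz E) (ptP P) (ptP Q)) => [eP|eQ|eQ|m c x1 x2 x3 eP eQ col nQ].
- by move: oP; rewrite /omega eP => ->; rewrite add0r.
- by move: oQ; rewrite /omega eQ => ->; rewrite addr0.
- have e : Q = - P by apply: pt_inj; rewrite eQ.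
  by rewrite (omega_eq oQ (omegaN rP oP) e) subrr.
have [e2 e4 e6] := collinear_coefs col.
have tg : x1 = x2 -> m * weq_y E x1 (m * x1 + c) = - weq_x E x1 (m * x1 + c).
  by move=> e; rewrite /weq_x /weq_y e4 e2 -e; ring.
have [Bx1 By1] : B x1 /\ B (m * x1 + c) by move: rP; rewrite /rat eP => -[].
have [Bx2 By2] : B x2 /\ B (m * x2 + c) by move: rQ; rewrite /rat eQ => -[].
have wy1 : x1 = x2 -> weq_y E x1 (m * x1 + c) != 0.
  move=> e; apply/eqP => wy; apply: nQ; rewrite eP eQ /= -e; congr (Some (_, _)).
  by apply: (linear_comb1 wy); rewrite /weq_y; ring.
have Bm : B m.
  have [e|ne] := eqVneq x1 x2.
    have -> : m = - weq_x E x1 (m * x1 + c) / weq_y E x1 (m * x1 + c).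
      by rewrite -tg // mulfK // wy1.
    have wx := weqx_rat sB cW Bx1 By1; have wy := weqy_rat sB cW Bx1 By1.
    by subf sB.
  have -> : m = ((m * x1 + c) - (m * x2 + c)) / (x1 - x2).
    by apply: (mulIf (_ : x1 - x2 != 0)); rewrite ?divfK ?subr_eq0 //; ring.
  by move: By1 By2; move: (m * x1 + c) (m * x2 + c) => y1 y2 *; subf sB.
have Bc : B c.
  by have -> : c = (m * x1 + c) - m * x1 by [ring]; move: By1; move: (m * x1 + c) => *; subf sB.
have E3 : x3 = m * m + a1 E * m - a2 E - x1 - x2 by rewrite e2; ring.
have B3' : B x3 by rewrite E3; subf sB.
have ec : x1 = x2 -> c1 = c2.
  by move=> e; apply: (omega_eq oP oQ); apply: pt_inj; rewrite eP eQ e.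
move: oP oQ; rewrite /omega eP eQ => -[dx1 dy1] [dx2 dy2].
have {}dy1 : m * d x1 + x1 * d m + d c = - c1 * weq_x E x1 (m * x1 + c).
  by rewrite -dy1 dD ?dM //; subf sB.
have {}dy2 : m * d x2 + x2 * d m + d c = - c2 * weq_x E x2 (m * x2 + c).
  by rewrite -dy2 dD ?dM //; subf sB.
have dx3 : d x3 = (m + m + a1 E) * d m - d x1 - d x2.
  rewrite E3; do ![rewrite dD ?derN ?dM ?d1 ?d2; try by subf sB].
  by ring.
(* For distinct abscissas, subtract [dy1] and [dy2] and divide by x1 - x2. In the tangent case this
   gives nothing, and the second Vieta relation with x1 = x2 is differentiated instead. *)
have dm : d m = c1 * (x1 - x3) + c2 * (x2 - x3).
  have [e|ne] := eqVneq x1 x2; last first.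
    have n0 : x1 - x2 != 0 by rewrite subr_eq0.
    apply: (mulIf n0).
    apply: (linear_comb1 (congr2 (fun a b => a - b) dy1 dy2)).
    by rewrite dx1 dx2 /weq_x /weq_y e4 e2; ring.
  have {}ec := ec e; have {}tg := tg e; have {}wy1 := wy1 e; subst x2 c2.
  have dc : d c = - x1 * d m.
    have t : c1 * (m * weq_y E x1 (m * x1 + c)) = c1 * - weq_x E x1 (m * x1 + c).
      by rewrite tg.
    by apply: (linear_comb1 (congr2 (fun a b => a - b) dy1 t)); rewrite dx1; ring.
  have H : x1 * x1 + (x1 * x3 + x1 * x3) =
      a4 E - (m * c + m * c) - a1 E * c - a3 E * m by rewrite e4; ring.
  have {}H := congr1 d H; apply: (mulIf wy1); move: H.
  do ![rewrite dD ?derN ?dM ?d1 ?d2 ?d3 ?d4; try by subf sB].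
  rewrite dx3 dc dx1 /weq_y => H.
  by apply: (linear_comb1 H); ring.
have dc : d c = c1 * (x1 - x2) * (x1 - x3) - x1 * d m.
  by apply: (linear_comb1 dy1); rewrite dx1 /weq_x /weq_y e4 e2; ring.
split.
  by rewrite dx3 dx1 dx2 dm /weq_y; ring.
do ![rewrite dD ?derN ?dM ?d1 ?d3; try by subf sB].
by rewrite dx3 dc dx1 dx2 dm /weq_x /weq_y e4 e2; ring.
Qed.

Lemma omegaMn P c n : rat B P -> omega P c -> omega (P *+ n) (c *+ n).
Proof.
move=> rP oP; elim: n => [//|n IH]; rewrite !mulrS.
by apply: omegaD => //; apply: ratMn.
Qed.

End InvariantDifferential.

(** When n + 1 is invertible, this coefficient recovers x from the power. *)
Lemma coef_exp_XsubC (K : fieldType) (x : K) n :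
  (('X - x%:P) ^+ n.+1)`_n = - (x *+ n.+1).
Proof.
have := @coefPn_prod_XsubC _ (nseq n.+1 x); rewrite size_nseq !big_nseq.
by rewrite iter_mulr_1 iter_addr_0 => ->.
Qed.

Section PurelyInseparable.
Variables (K : fieldType) (p : nat) (k : set K).
Hypotheses (pK : p \in [pchar K]) (sk : divring_closed [in k]).

Definition kroot s : set K := [set x | k (x ^+ (p ^ s)%N)].

Lemma expr_pchar n x y : (x + y : K) ^+ (p ^ n)%N = x ^+ (p ^ n)%N + y ^+ (p ^ n)%N.
Proof.
apply: exprDn_pchar; rewrite (eq_pnat _ (pcharf_eq pK)) pnatX pnat_id ?orbT //.
exact: pcharf_prime pK.
Qed.

Lemma exprN_pchar n x : (- x : K) ^+ (p ^ n)%N = - x ^+ (p ^ n)%N.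
Proof.
apply: (@addrI _ (x ^+ (p ^ n)%N)); rewrite -expr_pchar !subrr expr0n.
by rewrite expn_eq0 eqn0Ngt prime_gt0 ?(pcharf_prime pK).
Qed.

Lemma kroot_subfield s : divring_closed [in kroot s].
Proof.
split.
- by apply/mem_set; rewrite /kroot /= expr1n; apply: (sub1 sk).
- move=> x y /set_mem kx /set_mem ky; apply/mem_set; rewrite /kroot /=.
  by rewrite expr_pchar exprN_pchar; apply: subB.
- move=> x y /set_mem kx /set_mem ky; apply/mem_set; rewrite /kroot /=.
  by rewrite exprMn exprVn; apply: subdiv.
Qed.

Lemma sub_kroot s : k `<=` kroot s.
Proof. by move=> x kx; apply: subX. Qed.

Lemma exp_XsubC_pchar (x : K) : ('X - x%:P) ^+ p = 'X^p - (x ^+ p)%:P.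
Proof.
have pKX : p \in [pchar {poly K}] by rewrite pchar_poly.
rewrite -(pFrobenius_autE pKX ('X - _)) pFrobenius_autB_comm; last exact: mulrC.
by rewrite !pFrobenius_autE polyC_exp.
Qed.

(** If p does not divide n, the coefficient -n x puts x in k. Otherwise (X - x)^n is (X - x^p)^(n/p)
    with X^p substituted for X, and the induction applies to x^p. *)
Lemma exp_XsubC_in (x : K) n : (0 < n)%N -> poly_in k (('X - x%:P) ^+ n) ->
  exists s, kroot s x.
Proof.
elim/ltn_ind: n x => n IH x n0 h.
have p0 : (0 < p)%N by rewrite prime_gt0 ?(pcharf_prime pK).
have [/dvdnP[m em]|np] := boolP (p %| n)%N; last first.
  exists 0; rewrite /kroot /= expn0 expr1.
  have := h n.-1; rewrite -{1}(prednK n0) coef_exp_XsubC prednK // => kx.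
  have n1 : n%:R != 0 :> K by rewrite -(dvdn_pcharf pK).
  rewrite -[x](mulfK n1) mulr_natr -[_ *+ _]opprK.
  by apply: (subdiv sk); [apply: subN | apply: subMn => //; apply: sub1].
have e : ('X - x%:P) ^+ n = (('X - (x ^+ p)%:P) ^+ m) \Po 'X^p.
  have -> : ('X - x%:P) ^+ n = ('X^p - (x ^+ p)%:P) ^+ m.
    by rewrite em mulnC exprM exp_XsubC_pchar.
  elim: (m) => [|i IHi]; first by rewrite !expr0 comp_polyC.
  by rewrite !exprS comp_polyM -IHi comp_polyB comp_polyX comp_polyC.
have m0 : (0 < m)%N by move: n0; rewrite em; case: (m).
have [||s ks] := IH m _ (x ^+ p) m0.
- by rewrite em ltn_Pmulr // prime_gt1 ?(pcharf_prime pK).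
- move=> i; have := h (p * i)%N; rewrite e coef_comp_poly_Xn // dvdn_mulr //.
  by rewrite mulKn.
by exists s.+1; rewrite /kroot /= expnS exprM.
Qed.

End PurelyInseparable.

Section MulP.
Variables (K : fieldType) (p : nat) (k : set K) (E : ecurve K).
Hypotheses (pK : p \in [pchar K]) (sk : divring_closed [in k]) (cE : coefs_in k E).

Let p_prime : prime p. Proof. exact: pcharf_prime pK. Qed.

(** Over B, y is purely inseparable but also a root of a separable quadratic, so it lies in B. For p
    = 2 the Weierstrass equation is linear in y once y^2 is known; for p odd, z = weq_y has z^2 and
    z^p in B, hence z. *)
Lemma pinsep_y (B : set K) x y : divring_closed [in B] -> k `<=` B -> B x ->
  B (y ^+ p) -> weq E x y = 0 -> weq_y E x y != 0 -> B y.
Proof.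
move=> sB kB Bx Byp w wy.
have [B1 B2 B3 B4 B6] : coefs_in B E by case: cE => *; split; apply: kB.
have [p2|podd] := eqVneq p 2.
  move: Byp wy; rewrite /weq_y p2 => Byp.
  have e2 := pcharf0 pK; rewrite p2 in e2.
  rewrite e2 mul0r add0r => wy.
  have -> : y = (x ^+ 3 + a2 E * x ^+ 2 + a4 E * x + a6 E - y ^+ 2) / (a1 E * x + a3 E).
    apply: (mulIf wy); rewrite divfK //; apply: (linear_comb1 w); rewrite /weq; ring.
  by subf sB.
have n2 : 2%:R != 0 :> K.
  rewrite -(dvdn_pcharf pK); apply/negP => dv.
  by move: dv podd; rewrite (dvdn_prime2 p_prime) // => ->.
set z := weq_y E x y.
have Bz2 : B (z ^+ 2).
  have -> : z ^+ 2 = 4%:R * (x ^+ 3 + a2 E * x ^+ 2 + a4 E * x + a6 E) + (a1 E * x + a3 E) ^+ 2.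
    apply: (linear_comb1 (etrans (congr1 (fun a => 4%:R * a) w) (mulr0 _))).
    by rewrite /z /weq_y /weq; ring.
  by subf sB.
have Bzp : B (z ^+ p).
  have -> : z ^+ p = 2%:R ^+ p * y ^+ p + (a1 E * x + a3 E) ^+ p.
    by have := expr_pchar pK 1 (2%:R * y) (a1 E * x + a3 E); rewrite expn1 exprMn addrA.
  by move: (y ^+ p) Byp => yp Byp; subf sB.
have Bz : B z.
  have op : p = (p./2 * 2).+1.
    by have [pp|op] := even_prime p_prime; [rewrite pp eqxx in podd | rewrite muln2 -[LHS]odd_double_half op].
  have -> : z = z ^+ p / (z ^+ 2) ^+ p./2.
    by rewrite {1}op exprS mulnC exprM mulfK // !expf_neq0.
  by move: (z ^+ 2) (z ^+ p) Bz2 Bzp => *; subf sB.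
have -> : y = (z - a1 E * x - a3 E) / 2%:R.
  by apply: (mulIf n2); rewrite divfK // /z /weq_y; ring.
by clearbody z; subf sB.
Qed.

(** X^p - x^p is the minimal polynomial of x and has derivative 0, so d/dX descends to k[x]. A
    representative of degree less than p has derivative 0 only if it is constant, so the kernel is
    k. *)
Lemma pinsep_derivation x : ~ k x -> k (x ^+ p) -> exists d : K -> K,
  [/\ forall y z, adjoin k x y -> adjoin k x z -> d (y + z) = d y + d z,
      forall y z, adjoin k x y -> adjoin k x z -> d (y * z) = y * d z + z * d y,
      forall y, k y -> d y = 0 &
      forall y, adjoin k x y -> d y = 0 -> k y].
Proof.
move=> nkx kxp; have [S [io kE]] := subfield_type sk.
have p0 : (0 < p)%N := prime_gt0 p_prime.
have pmK := esym (exp_XsubC_pchar pK x).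
have hq : poly_in k ('X^p - (x ^+ p)%:P).
  apply: poly_inB => //; last exact: poly_inC.
  by move=> i; rewrite coefXn; case: eqP => _; [apply: sub1 | apply: sub0].
have rx : root ('X^p - (x ^+ p)%:P) x.
  by rewrite pmK -(prednK p0) root_exp_XsubC.
have ax : algcl k x.
  exists ('X^p - (x ^+ p)%:P); split=> //.
  by rewrite pmK expf_eq0 polyXsubC_eq0 andbF.
have [m [mon irr r dv]] := minpoly kE ax.
have em : map_poly io m = 'X^p - (x ^+ p)%:P.
  have [q eq] := poly_in_lift kE hq.
  (* The minimal polynomial is (X - x)^i with 0 < i <= p; for i < p its coefficient -i x would put x
     in k. *)
  have : map_poly io m %| ('X - x%:P) ^+ p by rewrite -pmK -eq dvdp_map dv // eq.
  case/dvdp_exp_XsubCP => i ip.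
  rewrite eqp_monic ?monic_map ?monic_exp ?monicXsubC // => /eqP ei.
  have [e|ni] := eqVneq i p; first by rewrite ei e -pmK.
  have i0 : (0 < i)%N.
    by case: (i) ei => // e0; move: r; rewrite e0 expr0 rootC oner_eq0.
  case: nkx; have := poly_in_map kE m i.-1; rewrite ei -{1}(prednK i0) coef_exp_XsubC prednK // => kx.
  have n1 : i%:R != 0 :> K.
    by rewrite -(dvdn_pcharf pK) gtnNdvd // ltn_neqAle ni.
  rewrite -[x](mulfK n1) mulr_natr -[_ *+ _]opprK.
  by apply: (subdiv sk); [apply: subN | apply: subMn => //; apply: sub1].
have dm : (map_poly io m)^`() = 0.
  by rewrite em derivB derivC subr0 derivXn -mulr_natr -polyC_natr (pcharf0 pK) mulr0.
have lift y : adjoin k x y -> exists g : {poly S}, (map_poly io g).[x] = y.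
  by move=> [g /(poly_in_lift kE)[h <-] ->]; exists h.
(* A chosen representative of y is differentiated, with value 0 outside k[x]; [dE] shows that the
   choice does not matter. *)
pose d y := if pselect (exists g : {poly S}, (map_poly io g).[x] = y) is left h
  then (map_poly io (sval (cid h))^`()).[x] else 0.
have dE (g : {poly S}) : d (map_poly io g).[x] = (map_poly io g^`()).[x].
  rewrite /d; case: pselect => [h|[]]; last by exists g.
  case: cid => h' /= e; apply/eqP; rewrite -subr_eq0 -hornerN -hornerD -rmorphB -derivB /=.
  have /dvdpP[q eq] : m %| h' - g.
    by apply: dv; rewrite rmorphB /= rootE hornerD hornerN e subrr.
  rewrite -deriv_map eq rmorphM derivM dm mulr0 addr0 hornerM (rootP r).
  by rewrite mulr0.
exists d; split.
- move=> _ _ /lift[g <-] /lift[h <-].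
  by rewrite -hornerD -rmorphD /= !dE derivD rmorphD /= hornerD.
- move=> _ _ /lift[g <-] /lift[h <-].
  rewrite -hornerM -rmorphM /= !dE derivM rmorphD !rmorphM /= hornerD !hornerM.
  by rewrite addrC [X in _ + X]mulrC.
- move=> y /(incK kE)[a <-].
  by have := dE a%:P; rewrite map_polyC hornerC derivC rmorph0 horner0.
move=> _ /lift[g <-]; rewrite dE => dg0.
have sm : size m = p.+1 by rewrite -(size_map_poly io) em size_XnsubC.
set g1 := g %% m.
have eg : (map_poly io g).[x] = (map_poly io g1).[x].
  rewrite {1}(divp_eq g m) rmorphD rmorphM /= hornerD hornerM (rootP r).
  by rewrite mulr0 add0r.
have m0 := monic_neq0 mon.
have dg1 : g1^`() = 0.
  have /dv dv1 : root (map_poly io g1^`()) x by rewrite rootE -dE -eg dE dg0.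
  have [g10|g10] := eqVneq g1 0; first by rewrite g10 deriv0.
  apply/eqP; apply: contraTT dv1 => dn0; apply/negP => /(dvdp_leq dn0).
  rewrite leqNgt => /negP; apply; apply: leq_trans (lt_size_deriv g10) _.
  by rewrite ltnW // ltn_modp.
rewrite eg (_ : g1 = (g1`_0)%:P); first by rewrite map_polyC hornerC; apply: incP.
apply/polyP => -[|i]; rewrite coefC //=.
have [lt|ge] := ltnP i.+1 p; last first.
  by rewrite nth_default // (leq_trans _ ge) // -ltnS -sm ltn_modp.
have /eqP := congr1 (fun q : {poly S} => io q`_i) dg1.
rewrite coef_deriv coef0 raddfMn raddf0 -mulr_natr mulf_eq0 => /orP[|].
  by rewrite fmorph_eq0 => /eqP.
by rewrite -(dvdn_pcharf pK) gtnNdvd.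
Qed.

(** Along a derivation with kernel k, the invariant differential at p P is p times that at P, hence
    0, so the coordinates of p P have derivative 0. A point with weq_y = 0 escapes this argument but
    is killed by 2. *)
Lemma pinsep_mulp (P : epoint E) :
  rat [set z | k (z ^+ p)] P -> rat k (P *+ p) \/ P *+ 2 = 0.
Proof.
move eP : (pt P) => [[x y]|]; last first.
  by left; have -> : P = 0 by [apply: pt_inj]; rewrite mul0rn.
move=> rP; have [wy|wy] := eqVneq (weq_y E x y) 0.
  right; rewrite mulr2n -{2}[P]opprK; apply/eqP; rewrite subr_eq0; apply/eqP.
  apply: pt_inj; rewrite ptN eP /=; congr (Some (_, _)).
  by apply: (linear_comb1 wy); rewrite /weq_y; ring.
left; move: rP; rewrite /rat eP => -[kxp kyp w].
have [kx|nkx] := pselect (k x).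
  by apply: ratMn => //; rewrite /rat eP; split=> //; apply: pinsep_y w wy.
have ax : algcl k x.
  exists ('X^p - (x ^+ p)%:P); split.
  - by rewrite -(exp_XsubC_pchar pK) expf_eq0 polyXsubC_eq0 andbF.
  - have [S [io kE]] := subfield_type sk; apply: poly_inB; rewrite //; last exact: poly_inC.
    by move=> i; rewrite coefXn; case: eqP => _; [apply: sub1 | apply: sub0].
  - by rewrite -(exp_XsubC_pchar pK) -(prednK (prime_gt0 p_prime)) root_exp_XsubC.
have sA := adjoin_subfield sk ax.
have kA : k `<=` adjoin k x by apply: sub_adjoin.
have rP : rat (adjoin k x) P.
  rewrite /rat eP; split=> //; first exact: adjoin_gen.
  by apply: (pinsep_y sA _ _ _ w wy) => //; [apply: adjoin_gen | apply: kA].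
have cA : coefs_in (adjoin k x) E by case: cE => *; split; apply: kA.
have [d [dD dM d0 dk]] := pinsep_derivation nkx kxp.
have [k1 k2 k3 k4 k6] := cE.
have oP : omega d P (d x / weq_y E x y).
  rewrite /omega eP divfK //; split=> //; apply: (mulIf wy); rewrite mulrAC mulNr divfK //.
  have By : adjoin k x y by move: rP; rewrite /rat eP => -[].
  have Bx : adjoin k x x := adjoin_gen sk x.
  have [B1 B2 B3 B4 B6] := cA.
  have H : y * y + a1 E * (x * y) + a3 E * y =
     x * (x * x) + a2 E * (x * x) + a4 E * x + a6 E.
    by apply: (linear_comb1 w); rewrite /weq; ring.
  have {H} := congr1 d H.
  do ![rewrite dD ?dM; try by subf sA].
  rewrite !(d0 _ k1, d0 _ k2, d0 _ k3, d0 _ k4, d0 _ k6) => H.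
  by apply: (linear_comb1 H); rewrite /weq_x /weq_y; ring.
have := omegaMn sA cA dD dM (d0 _ k1) (d0 _ k2) (d0 _ k3) (d0 _ k4) p rP oP.
rewrite -mulr_natr (pcharf0 pK) mulr0 /omega /rat.
have : rat (adjoin k x) (P *+ p) by apply: ratMn.
rewrite /rat; case: (pt _) => [[x' y'] [Bx' By' w'] [dx' dy']|//].
by split=> //; apply: dk; rewrite // ?dx' ?dy' ?oppr0 mul0r.
Qed.

End MulP.

(* As [p] is purely inseparable times an isogeny defined over [k], passing to
   the perfect closure of [k] only enlarges the group of points by p-power
   torsion classes. *)
Lemma kroot_mulp (K : fieldType) (p : nat) (k : set K) (E : ecurve K) s (P : epoint E) :
  p \in [pchar K] -> divring_closed [in k] -> coefs_in k E -> rat (kroot p k s) P ->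
  exists i, rat k (P *+ (p ^ i)) \/ P *+ (p ^ i) *+ 2 = 0.
Proof.
move=> pK sk cE.
elim: s => [|s IH] in P *.
  move=> rP; exists 0; left; rewrite expn0 mulr1n; apply: rat_sub rP => x.
  by rewrite /kroot /= expn0 expr1.
move=> rP; have sR := kroot_subfield pK sk s.
have kR := sub_kroot p sk s.
have : rat [set z | kroot p k s (z ^+ p)] P.
  by apply: rat_sub rP => z; rewrite /kroot /= -exprM -expnS.
have cR : coefs_in (kroot p k s) E by case: cE => *; split; apply: kR.
move=> /(pinsep_mulp pK sR cR)[/IH[i Pi]|P2]; last by exists 0; right; rewrite expn0 mulr1n.
by exists i.+1; rewrite expnS mulrnA.
Qed.

(** * Galois theory of an algebraic closure *)

Section IsomorphismExtension.
Variable K : fieldType.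
Implicit Type R : set (K * K).

(** The graph of an isomorphism between subfields; the last clause with differences makes it
    single-valued. Graphs, unlike functions, can be joined along chains for Zorn's lemma. *)
Definition iso_graph R :=
  [/\ R (1, 1),
      forall a b, R a -> R b -> R (a.1 - b.1, a.2 - b.2),
      forall a b, R a -> R b -> R (a.1 * b.1, a.2 * b.2),
      forall a, R a -> R (a.1^-1, a.2^-1) &
      forall a, R a -> a.1 = 0 -> a.2 = 0].

(** The extension sends g(z) to g(z'). It is well defined because a polynomial vanishing at a root
    of the irreducible m is divisible by m. *)
Lemma iso_graph_step (S : fieldType) (io1 io2 : {rmorphism S -> K}) (m : {poly S}) z z' :
  irreducible_poly m -> root (map_poly io1 m) z -> root (map_poly io2 m) z' ->
  iso_graph [set a | exists g : {poly S}, a = ((map_poly io1 g).[z], (map_poly io2 g).[z'])].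
Proof.
move=> irr r r'.
have dv (io : {rmorphism S -> K}) y (g : {poly S}) :
    root (map_poly io m) y -> (map_poly io g).[y] = 0 -> m %| g.
  move=> ry gy; apply/negPn/negP => ndv.
  have /Bezout_eq1_coprimepP[[u v] /= euv] : coprimep m g.
    apply/negPn/negP => sz; have eg := irr.2 _ sz (dvdp_gcdl _ _).
    by have := eqp_dvdl g eg; rewrite dvdp_gcdr (negPf ndv).
  have /eqP := congr1 (fun q => (map_poly io q).[y]) euv.
  rewrite rmorphD !rmorphM /= hornerD !hornerM (rootP ry) gy !mulr0 addr0.
  by rewrite rmorph1 hornerC eq_sym oner_eq0.
(* A Bezout coefficient of g modulo m does not depend on the embedding, so it inverts g(z) and g(z')
   together. *)
have inv (g : {poly S}) : exists h : {poly S},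
    (map_poly io1 h).[z] = ((map_poly io1 g).[z])^-1 /\
    (map_poly io2 h).[z'] = ((map_poly io2 g).[z'])^-1.
  have [dvg|ndv] := boolP (m %| g).
    exists 0; rewrite !rmorph0 !horner0; move: dvg => /dvdpP[c ->].
    by rewrite !rmorphM /= !hornerM (rootP r) (rootP r') !mulr0 invr0.
  have /Bezout_eq1_coprimepP[[u v] /= euv] : coprimep m g.
    apply/negPn/negP => sz; have eg := irr.2 _ sz (dvdp_gcdl _ _).
    by have := eqp_dvdl g eg; rewrite dvdp_gcdr (negPf ndv).
  have key (io : {rmorphism S -> K}) y : root (map_poly io m) y ->
      (map_poly io v).[y] = ((map_poly io g).[y])^-1.
    move=> ry; have := congr1 (fun q => (map_poly io q).[y]) euv.
    rewrite rmorphD !rmorphM /= hornerD !hornerM (rootP ry) mulr0 add0r.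
    rewrite rmorph1 hornerC => e.
    have g0 : (map_poly io g).[y] != 0.
      by apply/eqP => g0; move/eqP: e; rewrite g0 mulr0 eq_sym oner_eq0.
    by apply: (mulIf g0); rewrite mulVf.
  by exists v; split; apply: key.
split.
- by exists 1; rewrite !rmorph1 !hornerC.
- by move=> _ _ [g ->] [h ->] /=; exists (g - h); rewrite !rmorphB /= !hornerD !hornerN.
- by move=> _ _ [g ->] [h ->] /=; exists (g * h); rewrite !rmorphM /= !hornerM.
- by move=> _ [g ->] /=; have [h [<- <-]] := inv g; exists h.
- move=> _ [g ->] /= /(dv _ _ _ r)/dvdpP[c ->].
  by rewrite rmorphM /= hornerM (rootP r') mulr0.
Qed.

Lemma iso_graph_bigcup (F : set (set (K * K))) : F !=set0 ->
  F `<=` iso_graph -> total_on F subset -> iso_graph (\bigcup_(X in F) X).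
Proof.
move=> [X0 FX0] Fi tot.
have two a b : (\bigcup_(X in F) X) a -> (\bigcup_(X in F) X) b ->
    exists X, [/\ F X, X a & X b].
  move=> [X FX Xa] [Y FY Yb]; have [XY|YX] := tot _ _ FX FY.
    by exists Y; split=> //; apply: XY.
  by exists X; split=> //; apply: YX.
split.
- by exists X0 => //; case: (Fi _ FX0).
- move=> a b Ra Rb; have [X [FX Xa Xb]] := two _ _ Ra Rb.
  by exists X => //; case: (Fi _ FX) => _ h _ _ _; apply: h.
- move=> a b Ra Rb; have [X [FX Xa Xb]] := two _ _ Ra Rb.
  by exists X => //; case: (Fi _ FX) => _ _ h _ _; apply: h.
- by move=> a [X FX Xa]; exists X => //; case: (Fi _ FX) => _ _ _ h _; apply: h.
- by move=> a [X FX Xa]; case: (Fi _ FX) => _ _ _ _ h; apply: h.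
Qed.

Hypothesis closedK : forall q : {poly K}, size q != 1%N -> exists x, root q x.

Lemma iso_graph_extend (k : set K) R0 : divring_closed [in k] -> iso_graph R0 ->
  (forall x, k x -> R0 (x, x)) -> R0 `<=` [set a | algcl k a.1 /\ algcl k a.2] ->
  exists R, [/\ iso_graph R, R0 `<=` R, R `<=` [set a | algcl k a.1 /\ algcl k a.2]
    & forall x, algcl k x -> exists y, R (x, y)].
Proof.
move=> sk iR0 R0k R0B.
pose good := [set R | [/\ iso_graph R, R0 `<=` R &
  R `<=` [set a | algcl k a.1 /\ algcl k a.2]]].
pose P := [set R | R = set0 \/ good R].
have [F FP tot|A [PA Amax]] := @Zorn_bigcup _ P.
  have [[X [FX [a Xa]]]|no] := pselect (exists X, F X /\ X !=set0); last first.
    left; rewrite -subset0 => a [X FX Xa]; case: no; exists X; split=> //; by exists a.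
  right; pose F' := [set X | F X /\ X !=set0].
  have F'g : F' `<=` good.
    by move=> Y [/FP[-> [b []]|]].
  have -> : \bigcup_(X in F) X = \bigcup_(X in F') X.
    rewrite eqEsubset; split=> b [Y FY Yb]; exists Y => //; last by case: FY.
    by split=> //; exists b.
  have F'X : F' X by split=> //; exists a.
  split.
  - apply: iso_graph_bigcup; first by exists X.
      by move=> Y /F'g[].
    by move=> Y Z [FY _] [FZ _]; apply: tot.
  - by move=> b R0b; exists X => //; have [_ h _] := F'g _ F'X; apply: h.
  - by move=> b [Y /F'g[_ _ h]]; apply: h.
have gR0 : good R0 by split.
have gA : good A.
  case: PA => // A0; case: (Amax R0); last by right.
  rewrite A0; split=> // h; have [R1 _ _ _ _] := iR0; exact: (h _ R1).
have [iA A0 AB] := gA; exists A; split=> // z Bz.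
apply: contrapT => noz.
have [A1 AmB AM AV Az] := iA.
have sgl x y y' : A (x, y) -> A (x, y') -> y = y'.
  move=> h h'; apply/eqP; rewrite -subr_eq0; apply/eqP.
  by have := Az _ (AmB _ _ h h'); rewrite /= subrr => ->.
pose D := [set x | exists y, A (x, y)].
have sD : divring_closed [in D].
  split.
  - by apply/mem_set; exists 1.
  - move=> x y /set_mem[x' h] /set_mem[y' h']; apply/mem_set.
    by exists (x' - y'); exact: AmB _ _ h h'.
  - move=> x y /set_mem[x' h] /set_mem[y' h']; apply/mem_set.
    by exists (x' / y'); exact: AM _ _ h (AV _ h').
have [S [io ioE]] := subfield_type sD.
have /choice[f fE] : forall a : S, exists y, A (io a, y).
  by move=> a; apply/ioE; exists a.
have fB : zmod_morphism f.
  by move=> a b; apply: (sgl (io (a - b))); [|rewrite rmorphB; apply: (AmB (io a, f a) (io b, f b))].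
have fM : monoid_morphism f.
  split; first by apply: (sgl (io 1)); [|rewrite rmorph1].
  by move=> a b; apply: (sgl (io (a * b))); [|rewrite rmorphM; apply: (AM (io a, f a) (io b, f b))].
have [io2 io2E] : exists io2 : {rmorphism S -> K}, forall a, A (io a, io2 a).
  pose g : {rmorphism S -> K} := HB.pack f (GRing.isZmodMorphism.Build _ _ f fB)
    (GRing.isMonoidMorphism.Build _ _ f fM).
  by exists g.
clear f fE fB fM.
have kD : k `<=` D by move=> x kx; exists x; apply/A0/R0k.
have DB : D `<=` algcl k by move=> x [y /AB[]].
have BD : algcl k z -> algcl D z := @algcl_sub _ _ _ kD z.
have [m [mon irr rm _]] := minpoly ioE (BD Bz).
(* If z is missing from the domain of the maximal graph, a root z' of the transported minimal
   polynomial of z extends the graph. *)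
have [|z' rz'] := closedK (q := map_poly io2 m).
  by rewrite size_map_poly; case: irr => sm _; rewrite neq_ltn sm orbT.
have ioin a : algcl k (io2 a) by have [] := AB _ (io2E a).
have Bz' : algcl k z'.
  apply: (algcl_root sk _ _ rz'); first by rewrite map_poly_eq0 monic_neq0.
  by move=> i; rewrite coef_map; apply: ioin.
pose A' := [set a | exists g : {poly S}, a = ((map_poly io g).[z], (map_poly io2 g).[z'])].
have AA' : A `<=` A'.
  move=> [x y] Axy; have [a ea] : exists a, io a = x by apply/ioE; exists y.
  exists a%:P; rewrite !map_polyC !hornerC; congr (_, _); first exact: esym ea.
  by apply: (sgl x) => //; rewrite -{1}ea; apply: io2E.
apply: (Amax A').
  split=> // A'A; apply: noz; exists z'; apply: A'A.
  by exists 'X; rewrite !map_polyX !hornerX.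
right; split.
- exact: iso_graph_step irr rm rz'.
- exact: subset_trans AA'.
- move=> _ [g ->] /=; have sB := algcl_subfield sk; split.
    by apply: (poly_in_horner sB) => // i; rewrite coef_map; apply/DB/ioE; exists g`_i.
  by apply: (poly_in_horner sB) => // i; rewrite coef_map; apply: ioin.
Qed.

End IsomorphismExtension.

Lemma phom_horner (K K' : fieldType) (B : set K) (f : K -> K') (q : {poly K})
    (q' : {poly K'}) x : divring_closed [in B] -> partial_hom B f ->
  poly_in B q -> (forall i, f q`_i = q'`_i) -> B x -> f q.[x] = q'.[f x].
Proof.
move=> sB fP hq qq' Bx.
have le : (size q' <= size q)%N.
  by apply/leq_sizeP => j lej; rewrite -qq' nth_default // (phom0 sB fP).
rewrite horner_coef (horner_coef_wide _ le) (phom_sum sB fP) => [|i _].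
  by apply: eq_bigr => i _; rewrite (phomM fP) ?(phomX sB fP) ?qq' //; apply: (subX sB).
by apply: (subM sB) => //; apply: (subX sB).
Qed.

Lemma phom_horner_fix (K : fieldType) (B k : set K) (f : K -> K) q x :
  divring_closed [in B] -> partial_hom B f -> k `<=` B -> (forall x, k x -> f x = x) ->
  poly_in k q -> B x -> f q.[x] = q.[f x].
Proof.
move=> sB fP kB fk hq Bx; apply: (phom_horner sB fP) => // i; first exact: kB.
exact: fk.
Qed.

Definition alg_closed (K : fieldType) :=
  forall q : {poly K}, size q != 1%N -> exists x, root q x.

Lemma poly_splits (K : fieldType) (q : {poly K}) : alg_closed K -> q != 0 ->
  exists rs, q = lead_coef q *: \prod_(x <- rs) ('X - x%:P).
Proof.
move=> cl; move sz : (size q) => n; elim: n q sz => [|n IH] q sz q0.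
  by move/eqP: sz; rewrite size_poly_eq0 (negPf q0).
have [n0|n0] := posnP n.
  exists [::]; rewrite big_nil; have /eqP/size_poly1P[c c0 ->] : size q = 1%N by rewrite sz n0.
  by rewrite lead_coefC alg_polyC.
have [|x rx] := cl q; first by rewrite sz; case: (n) n0.
have [q' eq] := factor_theorem _ _ rx.
have q'0 : q' != 0 by apply: contraNneq q0 => e; rewrite eq e mul0r.
have sz' : size q' = n.
  by apply: succn_inj; rewrite -sz eq size_Mmonic ?monicXsubC // size_XsubC addn2.
have [rs ers] := IH _ sz' q'0; exists (x :: rs).
have -> : lead_coef q = lead_coef q' by rewrite eq lead_coefM lead_coefXsubC mulr1.
by rewrite big_cons mulrC scalerAl -ers -eq.
Qed.

Section Galois.
Variables (K : fieldType) (k : set K).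
Hypotheses (sk : divring_closed [in k]) (closedK : alg_closed K).
Notation B := (algcl k).
Notation G := (galois_group (algcl k) k).

Let sB : divring_closed [in B] := algcl_subfield sk.
Let kB : k `<=` B := sub_algcl sk.

Lemma gal_phom s : G s -> partial_hom B s.
Proof.
case=> _ h fx _; split; first by move=> x y Bx By; case: (h x y Bx By).
  by move=> x y Bx By; case: (h x y Bx By).
by apply: fx; apply: (sub1 sk).
Qed.

Lemma gal_in s x : G s -> B x -> B (s x).
Proof. by case=> -[h _ _] _ _ _ /h. Qed.

Lemma gal_fix s x : G s -> k x -> s x = x.
Proof. by case=> _ _ h _ /h. Qed.

Lemma gal_out s x : G s -> ~ B x -> s x = x.
Proof. by case=> _ _ _ h /h. Qed.

Lemma gal_inj s x y : G s -> s x = s y -> x = y.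
Proof.
move=> Gs; have [[sf si _] _ _ out] := Gs; have inB z : B z -> B (s z) by apply: gal_in.
have [Bx|nBx] := pselect (B x); have [By|nBy] := pselect (B y).
- by apply: si; apply/mem_set.
- by rewrite (out _ nBy) => e; case: nBy; rewrite -e; apply: inB.
- by rewrite (out _ nBx) => e; case: nBx; rewrite e; apply: inB.
- by rewrite !out.
Qed.

Lemma gal_horner s q x : G s -> poly_in k q -> B x -> s q.[x] = q.[s x].
Proof.
move=> Gs; apply: (phom_horner_fix sB (gal_phom Gs) kB) => z; exact: gal_fix.
Qed.

Lemma gal_root s q x : G s -> poly_in k q -> B x -> root q x -> root q (s x).
Proof.
move=> Gs hq Bx /rootP r; apply/rootP; rewrite -gal_horner // r.
exact: (phom0 sB (gal_phom Gs)).
Qed.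

Lemma finite_roots q : q != 0 -> exists rs : seq K, forall x, root q x <-> x \in rs.
Proof.
move=> q0; have [rs ->] := poly_splits closedK q0; exists rs => x.
by rewrite rootZ ?lead_coef_eq0 // root_prod_XsubC.
Qed.

(** An endomorphism over k is automatically onto: it maps the finite root set of a polynomial over k
    injectively into itself. *)
Lemma gal_mk (f : K -> K) : (forall x, B x -> B (f x)) -> partial_hom B f ->
  (forall x, k x -> f x = x) -> G (fun x => if `[< B x >] then f x else x).
Proof.
move=> fB fP fk.
have yes x : B x -> `[< B x >] = true by move=> Bx; apply/asboolP.
split.
- split.
  + by move=> x Bx; rewrite yes //; apply: fB.
  + move=> x y /set_mem Bx /set_mem By; rewrite !yes //.
    exact: (phom_inj sB fP).
  + move=> y By; have [q [q0 hq ry]] := By.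
    have [rs ers] := finite_roots q0.
    have rB x : root q x -> B x by move=> rx; exists q.
    have sub : {subset [seq f x | x <- undup rs] <= undup rs}.
      move=> _ /mapP[x + ->]; rewrite !mem_undup => /ers rx; apply/ers/rootP.
      rewrite -(phom_horner_fix sB fP kB fk hq (rB _ rx)) (rootP rx).
      exact: (phom0 sB fP).
    have uf : uniq [seq f x | x <- undup rs].
      rewrite map_inj_in_uniq ?undup_uniq // => x z; rewrite !mem_undup => /ers rx /ers rz.
      by apply: (phom_inj sB fP); apply: rB.
    have [_ eqm] := uniq_min_size uf sub (eq_leq (esym (size_map _ _))).
    have : y \in undup rs by rewrite mem_undup; apply/ers.
    rewrite -eqm => /mapP[x]; rewrite mem_undup => /ers/rB Bx ->.
    by exists x; rewrite // yes.
- move=> x y Bx By; rewrite !yes ?(phomD fP) ?(phomM fP) //.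
    exact: (subM sB).
  exact: (subD sB).
- by move=> x kx; rewrite yes ?fk //; apply: kB.
- by move=> x nB; case: asboolP.
Qed.

Lemma gal_id : G id.
Proof. by split=> //; split=> // x Bx; exists x. Qed.

Lemma gal_comp s t : G s -> G t -> G (s \o t).
Proof.
move=> Gs Gt; split.
- split.
  + by move=> x Bx /=; apply: gal_in => //; apply: gal_in.
  + by move=> x y _ _ /= /(gal_inj Gs)/(gal_inj Gt).
  + move=> y By; have [[_ _ /(_ _ By)[z Bz <-]] _ _ _] := Gs.
    by have [[_ _ /(_ _ Bz)[x Bx <-]] _ _ _] := Gt; exists x.
- move=> x y Bx By /=; have [_ hs _ _] := Gs; have [_ ht _ _] := Gt.
  have [-> ->] := ht _ _ Bx By.
  by apply: hs; apply: gal_in.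
- by move=> x kx /=; rewrite (gal_fix Gt kx) gal_fix.
- by move=> x nB /=; rewrite (gal_out Gt nB) gal_out.
Qed.

Lemma gal_inv s : G s -> exists t, [/\ G t, s \o t = id & t \o s = id].
Proof.
move=> Gs; have [[_ _ surj] _ _ _] := Gs.
have /choice[t tE] : forall y, exists x, s x = y.
  move=> y; have [/surj[x _ <-]|nB] := pselect (B y); first by exists x.
  by exists y; rewrite gal_out.
have ts : t \o s = id by apply/funext => x /=; apply: (gal_inj Gs).
have tB x : B x -> B (t x).
  move=> Bx; apply: contrapT => nB; have := tE x.
  by rewrite gal_out // => e; apply: nB; rewrite e.
exists t; split=> //; last by apply/funext => x /=.
split.
- split=> //.
  + by move=> x y _ _ e; rewrite -(tE x) e tE.
  + by move=> x Bx; exists (s x); [exact: (gal_in Gs Bx) | apply: (congr1 (fun f => f x) ts)].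
- move=> x y Bx By; split; apply: (gal_inj Gs); rewrite tE.
    by rewrite (phomD (gal_phom Gs)) ?tE //; apply: tB.
  by rewrite (phomM (gal_phom Gs)) ?tE //; apply: tB.
- by move=> x kx; apply: (gal_inj Gs); rewrite tE gal_fix.
- by move=> x nB; apply: (gal_inj Gs); rewrite tE gal_out.
Qed.

Lemma gal_conj (S : fieldType) (io : {rmorphism S -> K}) (m : {poly S}) x y :
  (forall z, k z <-> exists a, io a = z) -> irreducible_poly m ->
  root (map_poly io m) x -> root (map_poly io m) y -> exists2 s, G s & s x = y.
Proof.
move=> ioE irr rx ry.
pose R0 := [set a : K * K | exists g : {poly S},
  a = ((map_poly io g).[x], (map_poly io g).[y])].
have inB z : root (map_poly io m) z -> B z.
  move=> rz; exists (map_poly io m); split=> //; last exact: poly_in_map.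
  by rewrite map_poly_eq0 irredp_neq0.
have R0B : R0 `<=` [set a | B a.1 /\ B a.2].
  move=> _ [g ->]; split; apply: (poly_in_horner sB); try exact: inB;
    by move=> i; apply/kB/(poly_in_map ioE).
have R0k z : k z -> R0 (z, z).
  by move=> /ioE[a <-]; exists a%:P; rewrite map_polyC !hornerC.
have [R [[R1 RB RM RV Rz] R0R RBB tot]] :=
  iso_graph_extend closedK sk (iso_graph_step irr rx ry) R0k R0B.
have sgl a b c : R (a, b) -> R (a, c) -> b = c.
  move=> h h'; apply/eqP; rewrite -subr_eq0; apply/eqP.
  by have := Rz _ (RB _ _ h h'); rewrite /= subrr => ->.
have /choice[f fE] : forall a, exists b, B a -> R (a, b).
  by move=> a; have [/tot[b]|nB] := pselect (B a); [exists b | exists 0].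
have RD a b : R a -> R b -> R (a.1 + b.1, a.2 + b.2).
  move=> Ra Rb; have R00 := RB _ _ R1 R1; have := RB _ _ Ra (RB _ _ R00 Rb).
  by rewrite /= !subrr !sub0r !opprK.
have Gf : G (fun x => if `[< B x >] then f x else x).
  apply: gal_mk.
  - by move=> a /fE/RBB[].
  - split.
    + move=> a b Ba Bb; apply: (sgl (a + b)); first by apply/fE/(subD sB).
      exact: RD _ _ (fE _ Ba) (fE _ Bb).
    + move=> a b Ba Bb; apply: (sgl (a * b)); first by apply/fE/(subM sB).
      exact: RM _ _ (fE _ Ba) (fE _ Bb).
    + by apply: (sgl 1) => //; apply/fE/(sub1 sB).
  - by move=> a ka; apply: (sgl a); [apply/fE/kB | apply/R0R/R0k].
exists (fun x => if `[< B x >] then f x else x) => //.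
rewrite (asboolT (inB _ rx)); apply: (sgl x); first exact/fE/inB.
by apply: R0R; exists 'X; rewrite !map_polyX !hornerX.
Qed.

(** All roots of the minimal polynomial are conjugate to x, hence equal to x; the polynomial is a
    power of X - x with coefficients in k. *)
Lemma gal_fixed p x : p \in [pchar K] -> B x -> (forall s, G s -> s x = x) ->
  exists s, kroot p k s x.
Proof.
move=> pK Bx fx; have [S [io ioE]] := subfield_type sk.
have [m [mon irr rm _]] := minpoly ioE Bx.
have [|rs ers] := @poly_splits _ (map_poly io m) closedK.
  by rewrite map_poly_eq0 monic_neq0.
have ers' : map_poly io m = \prod_(x <- rs) ('X - x%:P).
  by rewrite ers (monicP _) ?scale1r // monic_map.
have allx y : y \in rs -> y = x.
  move=> yrs; have ry : root (map_poly io m) y by rewrite ers' root_prod_XsubC.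
  by have [s Gs <-] := gal_conj ioE irr rm ry; rewrite fx.
have em : map_poly io m = ('X - x%:P) ^+ size rs.
  rewrite ers' big_tnth (eq_bigr (fun=> 'X - x%:P)) ?prodr_const ?card_ord // => i _.
  by rewrite (allx (tnth _ i)) // mem_tnth.
apply: (exp_XsubC_in pK sk (n := size rs)).
  by case: (size rs) em => // e; move: rm; rewrite e expr0 rootC oner_eq0.
by rewrite -em; apply: poly_in_map.
Qed.

End Galois.

Lemma ultra_mem (T : Type) (K : eqType) (U : set_system T) (g : T -> K) (rs : seq K) :
  UltraFilter U -> U [set s | g s \in rs] -> exists y, U [set s | g s = y].
Proof.
move=> UU; elim: rs => [|y rs IH] h.
  by case: (filter_not_empty U); apply: filterS h => s /=; rewrite in_nil.
have [h'|h'] := in_ultra_setVsetC [set s | g s = y] UU; first by exists y.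
apply: IH; apply: filterS (filterI h h') => s /= []; rewrite inE => /orP[/eqP|//].
by [].
Qed.

Section Compactness.
Variables (K : fieldType) (k : set K).
Hypotheses (sk : divring_closed [in k]) (closedK : alg_closed K).
Notation B := (algcl k).
Notation G := (galois_group (algcl k) k).

Lemma gal_roots x : B x -> exists rs : seq K,
  (forall s, G s -> s x \in rs) /\ (forall y, y \in rs -> B y).
Proof.
move=> Bx; have [q [q0 hq r]] := Bx; have [rs ers] := finite_roots closedK q0.
exists rs; split=> [s Gs|y /ers ry]; last by exists q.
exact/ers/(gal_root sk Gs hq Bx).
Qed.

(* The Galois group is compact: a limit of automorphisms along an ultrafilter
   exists because every orbit is finite. *)
Lemma gal_uniform (T : Type) (c : (K -> K) -> T) : locally_constant G c ->
  exists s : seq K, (forall x, x \in s -> B x) /\ forall f g, G f -> G g ->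
    (forall x, x \in s -> f x = g x) -> c f = c g.
Proof.
move=> lc; suff [s sP] : exists s : seq K, forall f g, G f -> G g ->
    (forall x, x \in s -> f x = g x) -> c f = c g.
  exists [seq x <- s | `[< B x >]]; split.
    by move=> x; rewrite mem_filter => /andP[/asboolP].
  move=> f g Gf Gg e; apply: sP => // x xs; have [Bx|nB] := pselect (B x).
    by apply: e; rewrite mem_filter xs andbT; apply/asboolP.
  by rewrite (gal_out Gf) // (gal_out Gg).
apply: contrapT => no.
have /choice[P PP] : forall s : seq K, exists fg : (K -> K) * (K -> K),
    [/\ G fg.1, G fg.2, forall x, x \in s -> fg.1 x = fg.2 x & c fg.1 <> c fg.2].
  move=> s; apply: contrapT => h; apply: no; exists s => f g Gf Gg e.
  by apply: contrapT => ne; apply: h; exists (f, g).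
(* Along an ultrafilter refining the filter of large finite lists, the automorphisms (P s).1 are
   eventually constant at each x, as orbits are finite; f is their limit. *)
pose F := [set A : set (seq K) | exists s0 : seq K, forall s : seq K, {subset s0 <= s} -> A s].
have FF : ProperFilter F.
  split; first by move=> [s0 /(_ s0 (fun x h => h))].
  split.
  - by exists [::].
  - move=> A A' [s hs] [s' hs']; exists (s ++ s') => t sub; split.
      by apply: hs => x xs; apply: sub; rewrite mem_cat xs.
    by apply: hs' => x xs; apply: sub; rewrite mem_cat xs orbT.
  - by move=> A A' AA' [s hs]; exists s => t /hs/AA'.
have [U [UU FU]] := ultraFilterLemma FF.
have /choice[f fE] : forall x, exists y, U [set s | (P s).1 x = y].
  move=> x; have [/gal_roots[rs [h _]]|nB] := pselect (B x).
    by apply: (@ultra_mem _ _ _ _ rs UU); apply: filterS filterT => s _; apply: h; case: (PP s).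
  exists x; apply: filterS filterT => s _ /=; have [Gs _ _ _] := PP s.
  exact: (gal_out Gs).
have Gf : G f.
  have -> : f = fun x => if `[< B x >] then f x else x.
    apply/funext => x; case: asboolP => // nB.
    have [s /= <-] := filter_ex (fE x); have [Gs _ _ _] := PP s.
    exact: (gal_out Gs).
  apply: gal_mk => //.
  - move=> x Bx; have [s /= <-] := filter_ex (fE x); have [Gs _ _ _] := PP s.
    exact: gal_in.
  - split.
    + move=> x y Bx By.
      have [s /= [[<- <-] <-]] := filter_ex (filterI (filterI (fE (x + y)) (fE x)) (fE y)).
      by have [Gs _ _ _] := PP s; rewrite (phomD (gal_phom sk Gs)).
    + move=> x y Bx By.
      have [s /= [[<- <-] <-]] := filter_ex (filterI (filterI (fE (x * y)) (fE x)) (fE y)).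
      by have [Gs _ _ _] := PP s; rewrite (phomM (gal_phom sk Gs)).
    + have [s /= <-] := filter_ex (fE 1); have [Gs _ _ _] := PP s.
      exact: phom1 (gal_phom sk Gs).
  - move=> x kx; have [s /= <-] := filter_ex (fE x); have [Gs _ _ _] := PP s.
    exact: (gal_fix Gs).
(* Local constancy at f: for some large s both members of the pair [P s] agree with f on s0, so c
   cannot separate them. *)
have [s0 hs0] := lc _ Gf.
have Us0 : U [set s | forall x, x \in s0 -> (P s).1 x = f x].
  elim: (s0) => [|y t IH]; first by apply: filterS filterT => s _ x.
  apply: filterS (filterI IH (fE y)) => s /= [h1 h2] x.
  by rewrite inE => /orP[/eqP ->|/h1].
have Us1 : U [set s : seq K | {subset s0 <= s}] by apply: FU; exists s0.
have [s /= [h1 h2]] := filter_ex (filterI Us0 Us1).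
have [G1 G2 e12 nc] := PP s; apply: nc; rewrite (hs0 _ G1) // (hs0 _ G2) // => x xs.
by rewrite -e12 ?h1 //; apply: h2.
Qed.

(** A finite union of orbits; on it G acts through a finite group of permutations. *)
Lemma gal_stable (s : seq K) : (forall x, x \in s -> B x) -> exists s',
  [/\ uniq s', {subset s <= s'}, forall f x, G f -> x \in s' -> f x \in s' &
      forall y, y \in s' -> exists f x, [/\ G f, x \in s & y = f x]].
Proof.
move=> sB.
have [s' hs'] : exists s' : seq K, forall y, y \in s' <-> exists f x, [/\ G f, x \in s & y = f x].
  elim: s sB => [|x s IH] sB; first by exists [::] => y; split=> // -[f [x []]].
  have [|s' es'] := IH; first by move=> y ys; apply: sB; rewrite inE ys orbT.
  have [|rs [rsP _]] := @gal_roots x; first by apply: sB; rewrite mem_head.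
  exists ([seq y <- rs | `[< exists2 f, G f & y = f x >]] ++ s') => y.
  rewrite mem_cat mem_filter; split.
    case/orP => [/andP[/asboolP[f Gf ->] _]|/es'[f [z [Gf zs ->]]]].
      by exists f, x; rewrite mem_head.
    by exists f, z; rewrite inE zs orbT.
  move=> [f [z [Gf + ->]]]; rewrite inE => /orP[/eqP ->|zs].
    by rewrite rsP // andbT; apply/orP; left; apply/asboolP; exists f.
  by apply/orP; right; apply/es'; exists f, z.
exists (undup s'); split; first exact: undup_uniq.
- by move=> x xs; rewrite mem_undup; apply/hs'; exists id, x; split=> //; apply: gal_id.
- move=> f y Gf; rewrite !mem_undup => /hs'[g [x [Gg xs ->]]].
  by apply/hs'; exists (f \o g), x; split=> //; apply: gal_comp.
- by move=> y; rewrite mem_undup => /hs'.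
Qed.

End Compactness.

Section CoefficientwiseImage.
Variables (K : fieldType) (B : set K) (f : K -> K).
Hypotheses (sB : divring_closed [in B]) (fP : partial_hom B f).

Lemma phom_prod_XsubC (rs : seq K) i : (forall r, r \in rs -> B r) ->
  f (\prod_(r <- rs) ('X - r%:P))`_i = (\prod_(r <- rs) ('X - (f r)%:P))`_i.
Proof.
have f0 := phom0 sB fP.
elim: rs i => [|r rs IH] i Brs.
  by rewrite !big_nil coef1; case: eqP; rewrite ?(phom1 fP).
have Br : B r by apply: Brs; rewrite mem_head.
have {}Brs z : z \in rs -> B z by move=> zs; apply: Brs; rewrite inE zs orbT.
have Bc j : B (\prod_(r <- rs) ('X - r%:P))`_j.
  rewrite big_seq; apply: (poly_in_prod sB) => z /Brs; exact: poly_in_XsubC.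
rewrite !big_cons !mulrBl !coefB !coefXM !coefCM.
rewrite (phomB sB fP) ?(phomM fP) ?IH //; last exact: (subM sB).
  by case: eqP; rewrite ?f0 ?IH.
by case: eqP => // _; apply: (sub0 sB).
Qed.

End CoefficientwiseImage.

Definition infinite_field (K : fieldType) (k : set K) :=
  forall rs : seq K, exists2 u, k u & u \notin rs.

Section Separation.
Variable K : fieldType.

Fixpoint words (R : seq K) n : seq (seq K) :=
  if n is n'.+1 then [seq x :: t | x <- R, t <- words R n'] else [:: [::]].

Lemma mem_words R n t : (t \in words R n) = (size t == n) && all (fun x => x \in R) t.
Proof.
elim: n t => [|n IH] [|x t] //=; first by apply/negbTE/negP => /allpairsP[[? ?] [_ _]].
rewrite eqSS; apply/allpairsP/idP => [[[y s] /= [yR]]|].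
  by rewrite IH => /andP[ss sR] [-> ->]; rewrite yR ss.
by move=> /and3P[st xR tR]; exists (x, t); rewrite /= IH st tR.
Qed.

Lemma poly_eq_size (s t : seq K) : size s = size t -> Poly s = Poly t -> s = t.
Proof.
move=> st e; apply: (@eq_from_nth _ 0) => // i _.
by have := congr1 (fun q : {poly K} => q`_i) e; rewrite !coef_Poly.
Qed.

(** Distinct words of length n have distinct polynomials, and the product psi of their differences
    has finitely many roots. Outside these roots, a tuple of elements is encoded by a single
    value. *)
Lemma separating_point (k : set K) R n : alg_closed K -> infinite_field k ->
  exists2 u, k u & {in words R n &, forall s t, (Poly s).[u] = (Poly t).[u] -> s = t}.
Proof.
move=> cl inf; pose AL := [seq (s, t) | s <- words R n, t <- words R n].
pose psi := \prod_(a <- AL | a.1 != a.2) (Poly a.1 - Poly a.2).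
have psi0 : psi != 0.
  rewrite /psi prodf_seq_neq0; apply/allP => -[s t] /allpairsP[[s' t'] /= [hs ht [-> ->]]].
  apply/implyP => ne; rewrite subr_eq0; apply: contraNneq ne => e; apply/eqP.
  apply: poly_eq_size e; move: hs ht; rewrite !mem_words => /andP[/eqP -> _].
  by move=> /andP[/eqP -> _].
have [rs ers] := finite_roots cl psi0; have [u ku un] := inf rs.
exists u => // s t hs ht e; apply/eqP/negPn/negP => ne; move/negP: un; apply.
apply/ers/rootP; rewrite /psi horner_prod; apply/eqP; rewrite prodf_seq_eq0.
apply/hasP; exists (s, t); first by apply/allpairsP; exists (s, t).
by rewrite /= ne hornerD hornerN e subrr eqxx.
Qed.

End Separation.

Lemma Poly_map_horner (K : fieldType) (B : set K) (f : K -> K) (t : seq K) u :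
  divring_closed [in B] -> partial_hom B f -> (forall x, x \in t -> B x) ->
  B u -> f u = u -> f (Poly t).[u] = (Poly (map f t)).[u].
Proof.
move=> sB fP Bt Bu fu; rewrite -{2}fu.
have Bn i : B t`_i.
  have [lt|ge] := ltnP i (size t); first by apply/Bt/mem_nth.
  by rewrite nth_default //; apply: (sub0 sB).
apply: (phom_horner sB fP) => // i; rewrite !coef_Poly //.
have [lt|ge] := ltnP i (size t); first by rewrite (nth_map 0).
by rewrite !nth_default ?size_map // (phom0 sB fP).
Qed.

Section RelativeGalois.
Variables (K : fieldType) (p : nat) (k1 k2 : set K).
Hypotheses (pK : p \in [pchar K]) (cl : alg_closed K).
Hypotheses (sk1 : divring_closed [in k1]) (sk2 : divring_closed [in k2]).
Hypotheses (k12 : k1 `<=` k2) (inf : infinite_field k1).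
Notation B1 := (algcl k1).
Notation B2 := (algcl k2).
Notation G1 := (galois_group (algcl k1) k1).
Notation G2 := (galois_group (algcl k2) k2).

Let sB1 : divring_closed [in B1] := algcl_subfield sk1.
Let sB2 : divring_closed [in B2] := algcl_subfield sk2.
Let B12 : B1 `<=` B2 := algcl_sub k12.

Lemma gal_restrict t : G2 t -> G1 (fun x => if `[< B1 x >] then t x else x).
Proof.
move=> Gt; apply: gal_mk => //.
- move=> x [q [q0 hq r]]; exists q; split=> //.
  by apply: (gal_root sk2 Gt _ _ r); [apply: poly_in_sub hq | apply: B12; exists q].
- have [hD hM h1] := gal_phom sk2 Gt.
  by split=> // x y Bx By; [apply: hD | apply: hM]; apply: B12.
- by move=> x kx; apply: (gal_fix Gt); apply: k12.
Qed.

(* Artin's argument: the conjugates of s0 under G2 are told apart by a single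
   value u in k1, and the coefficients of the polynomial having the resulting
   elements as roots generate, up to p-power roots, the fixed field of G2. *)
Lemma galois_extend (s0 : seq K) : (forall x, x \in s0 -> B1 x) -> exists s1 : seq K,
  (forall x, x \in s1 -> B1 x /\ k2 x) /\ forall s, G1 s ->
    (forall x, x \in s1 -> s x = x) -> exists2 t, G2 t & forall x, x \in s0 -> t x = s x.
Proof.
move=> Bs0; pose n := size s0.
have [s0' [us sub stab orb]] := gal_stable sk1 cl Bs0.
have Bs0' y : y \in s0' -> B1 y.
  by move=> /orb[f [x [Gf xs ->]]]; apply: (gal_in Gf); apply: Bs0.
have stab2 t x : G2 t -> x \in s0' -> t x \in s0'.
  move=> /gal_restrict Gt xs; have := stab _ _ Gt xs.
  by rewrite asboolT //; apply: Bs0'.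
have [u ku sep] := separating_point s0' n cl inf.
have Bu : B1 u := sub_algcl sk1 ku.
pose D := [seq t <- words s0' n | `[< exists2 f, G2 f & t = map f s0 >]].
have mapW (f : K -> K) : (forall x, x \in s0' -> f x \in s0') -> map f s0 \in words s0' n.
  move=> h; rewrite mem_words size_map eqxx /=; apply/allP => _ /mapP[x xs ->].
  exact/h/sub.
have memD t : (t \in D) <-> exists2 f, G2 f & t = map f s0.
  rewrite mem_filter; split; first by case/andP => /asboolP.
  move=> [f Gf e]; apply/andP; split; first by apply/asboolP; exists f.
  by rewrite e; apply: mapW => x; apply: stab2.
have BD t x : t \in D -> x \in t -> B1 x.
  rewrite mem_filter => /andP[_]; rewrite mem_words => /andP[_ /allP h] /h.
  exact: Bs0'.
pose th (t : seq K) := (Poly t).[u].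
have Bth t : t \in D -> B1 (th t).
  move=> tD; apply: (poly_in_horner sB1) => // i; rewrite coef_Poly.
  have [lt|ge] := ltnP i (size t); first by apply: (BD t) => //; apply: mem_nth.
  by rewrite nth_default //; apply: (sub0 sB1).
(* D lists the images of s0 under G2, and [th] encodes each of them as one element. G2 permutes the
   roots of F, so the coefficients of F are fixed by G2 and have p-powers in k2. *)
pose D' := undup D; pose F := \prod_(r <- map th D') ('X - r%:P).
have Bms r : r \in map th D' -> B1 r by move=> /mapP[t]; rewrite mem_undup => tD ->; apply: Bth.
have BF : poly_in B1 F.
  by rewrite /F big_seq; apply: (poly_in_prod sB1) => r /Bms; apply: poly_in_XsubC.
have fixF f i : G2 f -> f F`_i = F`_i.
  move=> Gf; rewrite (phom_prod_XsubC sB2 (gal_phom sk2 Gf)) => [|r /Bms/B12 //].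
  have -> : \prod_(r <- map th D') ('X - (f r)%:P) = \prod_(r <- map f (map th D')) ('X - r%:P).
    by rewrite [in RHS]big_map.
  suff pm : perm_eq (map f (map th D')) (map th D') by rewrite (perm_big _ pm).
  have injf : {in D' &, injective (map f)}.
    by move=> a b _ _; apply: inj_map => x y; apply: (gal_inj Gf).
  have -> : map f (map th D') = map th (map (map f) D').
    rewrite -!map_comp; apply/eq_in_map => t; rewrite mem_undup => tD /=.
    apply: (Poly_map_horner sB2 (gal_phom sk2 Gf)) => [x /(BD _ _ tD)/B12 //||].
      exact: B12.
    by apply: (gal_fix Gf); apply: k12.
  apply: perm_map; rewrite perm_sym; apply: uniq_perm.
  - exact: undup_uniq.
  - by rewrite map_inj_in_uniq // undup_uniq.
  have sub' : {subset map (map f) D' <= D'}.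
    move=> _ /mapP[t + ->]; rewrite !mem_undup => /memD[g Gg ->]; apply/memD.
    by exists (f \o g); [apply: gal_comp | rewrite map_comp].
  have um : uniq (map (map f) D') by rewrite map_inj_in_uniq // undup_uniq.
  have [_ e] := uniq_min_size um sub' (eq_leq (esym (size_map _ _))).
  by move=> t; rewrite e.
have /choice[e eE] : forall i, exists s, kroot p k2 s F`_i.
  move=> i; apply: (gal_fixed sk2 cl pK); first exact/B12/BF.
  by move=> f Gf; apply: fixF.
exists [seq F`_i ^+ (p ^ e i) | i <- iota 0 (size F)]; split.
  by move=> _ /mapP[i _ ->]; split; [apply: (subX sB1); apply: BF | apply: eE].
move=> s Gs hs; have sP := gal_phom sk1 Gs.
(* s fixes a p-power of this coefficient, and p-power roots are unique in characteristic p. *)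
have sF i : s F`_i = F`_i.
  have [lt|ge] := ltnP i (size F); last by rewrite nth_default // (phom0 sB1 sP).
  have := hs (F`_i ^+ (p ^ e i)) _; rewrite (phomX sB1 sP) // => h.
  have {}h : s F`_i ^+ (p ^ e i) = F`_i ^+ (p ^ e i).
    by apply: h; apply/mapP; exists i; rewrite // mem_iota.
  apply/eqP; rewrite -subr_eq0; have := expr_pchar pK (e i) (s F`_i) (- F`_i).
  by rewrite (exprN_pchar pK) h subrr => /eqP; rewrite expf_eq0 => /andP[].
have s0D : s0 \in D by apply/memD; exists id; rewrite ?map_id //; apply: gal_id.
have r0 : root F (th s0).
  by rewrite root_prod_XsubC; apply/mapP; exists s0; rewrite // mem_undup.
(* So s (th s0) = th t, where t is the image of s0 under some f in G2; as u separates words, s and f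
   agree on s0. *)
have : root F (s (th s0)).
  apply/rootP; rewrite -(phom_horner sB1 sP BF sF (Bth _ s0D)) (rootP r0).
  exact: (phom0 sB1 sP).
rewrite root_prod_XsubC => /mapP[t]; rewrite mem_undup => tD.
rewrite (Poly_map_horner sB1 sP) //; last exact: (gal_fix Gs).
have tW : t \in words s0' n by move: tD; rewrite mem_filter => /andP[].
have sW : map s s0 \in words s0' n by apply: mapW => x; apply: stab.
move=> /(sep _ _ sW tW) es; have /memD[f Gf ef] := tD.
by exists f => //; apply/eq_in_map; rewrite -ef -es.
Qed.

End RelativeGalois.

(** * Cocycles with values in the points *)

Section Action.
Variables (K : fieldType) (k : set K) (E : ecurve K).
Hypotheses (sk : divring_closed [in k]) (cl : alg_closed K) (cE : coefs_in k E).
Notation B := (algcl k).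
Notation G := (galois_group (algcl k) k).

Definition act (f : K -> K) : epoint E -> epoint E := pmap E f.

Let sB : divring_closed [in B] := algcl_subfield sk.

Lemma coefs_algcl : coefs_in B E.
Proof. by case: cE => *; split; apply: (sub_algcl sk). Qed.

Lemma map_curve_fix (f : K -> K) : (forall x, k x -> f x = x) -> map_curve f E = E.
Proof.
by case: cE; case: (E) => -[b1 b2 b3 b4 b6] /= _ *; rewrite /map_curve /=; congr Weierstrass; auto.
Qed.

Section Element.
Variable f : K -> K.
Hypothesis Gf : G f.
Let fP := gal_phom sk Gf.
Let fE : map_curve f E = E.
Proof. by apply: map_curve_fix => x; apply: gal_fix. Qed.

Lemma pt_act P : rat B P -> pt (act f P) = map_point f (pt P).
Proof. exact: (pt_pmap sB fP coefs_algcl fE). Qed.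
Lemma actD P Q : rat B P -> rat B Q -> act f (P + Q) = act f P + act f Q.
Proof. exact: (pmapD sB fP coefs_algcl fE). Qed.
Lemma actN P : rat B P -> act f (- P) = - act f P.
Proof. exact: (pmapN sB fP coefs_algcl fE). Qed.
Lemma actB P Q : rat B P -> rat B Q -> act f (P - Q) = act f P - act f Q.
Proof. exact: (pmapB sB fP coefs_algcl fE). Qed.
Lemma act0 : act f 0 = 0.
Proof. exact: (pmap0 sB fP coefs_algcl fE). Qed.
Lemma actMn P n : rat B P -> act f (P *+ n) = act f P *+ n.
Proof. exact: (pmapMn sB fP coefs_algcl fE). Qed.
Lemma act_sum I (r : seq I) (Q : pred I) (g : I -> epoint E) :
  (forall i, Q i -> rat B (g i)) ->
  act f (\sum_(i <- r | Q i) g i) = \sum_(i <- r | Q i) act f (g i).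
Proof. exact: (pmap_sum sB fP coefs_algcl fE). Qed.
Lemma rat_act P : rat B P -> rat B (act f P).
Proof.
move=> rP; have := ptP (act f P); rewrite /rat pt_act //; move: rP; rewrite /rat.
case: (pt P) => [[x y] [Bx By _] [_ _ w]|//]; split=> //; exact: (gal_in Gf).
Qed.

End Element.

Lemma act_id P : act id P = P.
Proof.
rewrite /act /pmap; case: pselect => [h|[]].
  by apply: pt_inj => /=; case: (pt P) => [[]|].
by have := ptP P; case: (pt P) => [[]|].
Qed.

Lemma act_comp f g P : G f -> G g -> rat B P -> act (f \o g) P = act f (act g P).
Proof.
move=> Gf Gg rP; have Gfg := gal_comp Gf Gg; have rg := rat_act Gg rP.
by apply: pt_inj; rewrite !pt_act //; case: (pt P) => [[]|].
Qed.

Definition coords (P : epoint E) : seq K :=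
  if pt P is Some (x, y) then [:: x; y] else [::].

Lemma act_coords f g P : {in coords P, f =1 g} -> act f P = act g P.
Proof.
move=> fg; rewrite /act /pmap.
have -> : map_point f (pt P) = map_point g (pt P).
  move: fg; rewrite /coords; case: (pt P) => [[x y]|//] fg /=.
  by rewrite !fg // !inE eqxx ?orbT.
by [].
Qed.

Lemma coords_rat (B' : set K) P x : rat B' P -> x \in coords P -> B' x.
Proof.
rewrite /rat /coords; case: (pt P) => [[a b] [Ba Bb _]|//].
by rewrite !inE => /orP[/eqP ->|/eqP ->].
Qed.

Definition Gcocycle (H : set (K -> K)) (c : (K -> K) -> epoint E) :=
  (forall f, H f -> rat B (c f)) /\
  (forall f g, H f -> H g -> c (f \o g) = c f + act f (c g)).

Definition depends_on (H : set (K -> K)) (T : Type) (s : seq K) (c : (K -> K) -> T) :=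
  forall f g, H f -> H g -> (forall x, x \in s -> f x = g x) -> c f = c g.

Lemma depends_locally_constant (H : set (K -> K)) T s (c : (K -> K) -> T) :
  depends_on H s c -> locally_constant H c.
Proof. by move=> dc f Hf; exists s => g Hg e; apply: dc. Qed.

Lemma cobound_cocycle Q : rat B Q -> Gcocycle G (fun f => act f Q - Q).
Proof.
move=> rQ; split; first by move=> f Gf; apply: ratB => //; [apply: coefs_algcl | apply: rat_act].
move=> f g Gf Gg; rewrite act_comp // actB //; last exact: rat_act.
by rewrite [RHS]addrC addrA subrK.
Qed.

Lemma Gcocycle1 c : Gcocycle G c -> c id = 0.
Proof.
move=> [rc hc]; have Gi := gal_id k; have := hc _ _ Gi Gi.
by rewrite act_id -[X in X = _]addr0 => /addrI.
Qed.

Section Restrictions.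
Variable s : seq K.
Hypotheses (stab : forall f x, G f -> x \in s -> f x \in s).
Let T : finType := seq_sub s.

Lemma restr_perm f : G f -> exists q : {perm T}, forall x, val (q x) = f (val x).
Proof.
move=> Gf; pose F (x : T) := SeqSub (stab Gf (valP x)).
have Fi : injective F by move=> x y /(congr1 val) /= /(gal_inj Gf)/val_inj.
by exists (perm Fi) => x; rewrite permE.
Qed.

(** The finite quotient of G acting on s. A product of permutations applies its left factor first,
    so f \o g corresponds to the permutation of g times that of f. *)
Definition Delta : {set {perm T}} :=
  [set q : {perm T} | `[< exists2 f, G f & forall x, val (q x) = f (val x) >]]%SET.

Lemma Delta_group : group_set Delta.
Proof.
apply/group_setP; split.
  by rewrite inE; apply/asboolP; exists id; [apply: gal_id | move=> x; rewrite perm1].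
move=> q r; rewrite !inE => -[f Gf hf] [g Gg hg]; exists (g \o f); first exact: gal_comp.
by move=> x; rewrite permM hg hf.
Qed.
Canonical Delta_grp := Group Delta_group.

(** By Cauchy's theorem a prime r dividing the order is the order of an element; a power of p kills
    that element, so r = p. *)
Lemma Delta_pgroup p : prime p ->
  (forall f x, G f -> x \in s -> exists N, iter (p ^ N) f x = x) ->
  exists e, #|Delta| = (p ^ e)%N.
Proof.
move=> pp h; suff /p_natP[e ->] : p.-nat #|Delta| by exists e.
apply/pnatP; first exact: (cardG_gt0 Delta_grp).
move=> r rp /(Cauchy rp)[q]; rewrite inE => /asboolP[f Gf hf] oq.
have hi n x : val ((q ^+ n)%g x) = iter n f (val x).
  by rewrite permX; elim: n => [//|n IH]; rewrite !iterS hf IH.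
have mono x N M : (N <= M)%N -> iter (p ^ N) f x = x -> iter (p ^ M) f x = x.
  move=> /subnKC <- e; rewrite expnD mulnC iterM.
  by elim: (p ^ _)%N => //= m IH; rewrite IH.
have [N hN] : exists N, forall x : T, iter (p ^ N) f (val x) = val x.
  have /choice[N hN] : forall x : T, exists N, iter (p ^ N) f (val x) = val x.
    by move=> x; apply: h => //; apply: valP.
  exists (\max_x N x) => x; apply: mono (hN x); exact: leq_bigmax.
have q1 : (q ^+ (p ^ N) = 1)%g by apply/permP => x; apply/val_inj; rewrite hi perm1 hN.
have : (r %| p ^ N)%N by rewrite -oq order_dvdn q1.
by rewrite Euclid_dvdX // => /andP[]; rewrite dvdn_prime2 // => /eqP ->; rewrite inE.
Qed.

Lemma Delta_reps : exists rep : {perm T} -> K -> K, forall q, q \in Delta ->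
  G (rep q) /\ forall x, val (q x) = rep q (val x).
Proof.
suff /choice[rep h] : forall q : {perm T}, exists f, q \in Delta ->
    G f /\ forall x, val (q x) = f (val x) by exists rep.
move=> q; have [|nq] := boolP (q \in Delta); last by exists id.
by rewrite inE => /asboolP[f Gf hf]; exists f.
Qed.

Lemma Delta_agree f g (q : {perm T}) : (forall x, val (q x) = f (val x)) ->
  (forall x, val (q x) = g (val x)) -> forall x, x \in s -> f x = g x.
Proof. by move=> hf hg x xs; have := hg (SeqSub xs); rewrite hf. Qed.

(* A cocycle factoring through a finite quotient of order h becomes a
   coboundary after multiplication by h. *)
Lemma average c : Gcocycle G c -> depends_on G s c -> exists S,
  [/\ rat B S, forall f, G f -> c f *+ #|Delta| = act f S - S &
    forall N : epoint E -> Prop, N 0 -> (forall P Q, N P -> N Q -> N (P + Q)) ->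
    (forall P, N P -> N (- P)) -> (forall f, G f -> N (c f)) -> N S].
Proof.
move=> [rc hc] dep; have [rep repP] := Delta_reps.
have rrep q : q \in Delta -> rat B (c (rep q)) by move=> /repP[/rc].
have cB := coefs_algcl.
(* Summing c (f \o g) = c f + f (c g) over representatives g gives |Delta| c f = S - f S, so the
   witness is -S; it lies in every subgroup containing the values of c. *)
pose S := \sum_(q in Delta) c (rep q).
have rS : rat B S by apply: ratsum.
exists (- S); split; first exact: ratN.
- move=> f Gf; have [r hr] := restr_perm Gf.
  have rD : r \in Delta by rewrite inE; apply/asboolP; exists f.
  rewrite actN // opprK addrC; apply/eqP; rewrite eq_sym subr_eq; apply/eqP.
  have eS : S = \sum_(q in Delta) c (rep (q * r)%g).
    rewrite /S (reindex_inj (mulIg r)); apply: eq_bigl => q.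
    by rewrite (groupMr (G := Delta_grp)).
  rewrite {1}eS.
  have -> : c f *+ #|Delta| = \sum_(q in Delta) c f by rewrite sumr_const.
  rewrite /S act_sum // -big_split /=; apply: eq_bigr => q qD.
  have [Gq hq] := repP _ qD; rewrite -hc //.
  have qrD : (q * r)%g \in Delta by apply: (groupM (G := Delta_grp)).
  have [Gqr hqr] := repP _ qrD.
  apply: dep => //; first exact: gal_comp.
  by apply: Delta_agree hqr _ => x; rewrite permM hr hq.
- move=> N N0 ND NN Nc; apply: NN; rewrite /S; elim/big_ind: _ => // q /repP[Gq _].
  exact: Nc.
Qed.

(* The corestriction of a cocycle from the kernel N of G -> Delta *)
Lemma corestriction (c : (K -> K) -> epoint E) (H : set (K -> K)) (t : epoint E -> Prop) s0 :
  let N := [set f | G f /\ forall x, x \in s -> f x = x] in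
  H `<=` N -> Gcocycle N c ->
  (forall f x, G f -> x \in s0 -> f x \in s0) -> depends_on N s0 c ->
  (forall P, t P -> rat B P) ->
  t 0 -> (forall P Q, t P -> t Q -> t (P + Q)) -> (forall f P, G f -> t P -> t (act f P)) ->
  (forall f, N f -> t (c f)) ->
  (forall g g', G g -> G g' -> g \o g' = id -> g' \o g = id ->
    exists2 Q, t Q & forall f, H f -> act g (c (g' \o f \o g)) = c f + (act f Q - Q)) ->
  exists C Q, [/\ Gcocycle G C, depends_on G (s ++ s0) C, forall f, G f -> t (C f), t Q &
    forall f, H f -> C f = c f *+ #|Delta| + (act f Q - Q)].
Proof.
move=> N HN [rc hc] stab0 dep tr t0 tD tact tc inv.
have [rep repP] := Delta_reps; have cB := coefs_algcl.
have /choice[rep' repP'] : forall q, exists g', q \in Delta ->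
    [/\ G g', rep q \o g' = id & g' \o rep q = id].
  move=> q; have [/repP[Gq _]|_] := boolP (q \in Delta); last by exists id.
  by have [g' h] := gal_inv sk Gq; exists g'.
have /choice[pm pmP] : forall f, exists r : {perm T}, G f -> forall x, val (r x) = f (val x).
  move=> f; have [/restr_perm[r hr]|nG] := pselect (G f); first by exists r.
  by exists 1%g.
have pmD f : G f -> pm f \in Delta.
  by move=> Gf; rewrite inE; apply/asboolP; exists f => //; apply: pmP.
have rK q x : q \in Delta -> rep q (rep' q x) = x.
  by move=> /repP'[_ e _]; apply: (congr1 (fun f => f x) e).
have rK' q x : q \in Delta -> rep' q (rep q x) = x.
  by move=> /repP'[_ _ e]; apply: (congr1 (fun f => f x) e).
(* This is the element n of N with f \o rep q = rep (q * pm f) \o n. *)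
pose el f q := rep' (q * pm f)%g \o f \o rep q.
have qD f q : G f -> q \in Delta -> (q * pm f)%g \in Delta.
  by move=> Gf hq; apply: (groupM (G := Delta_grp)) => //; apply: pmD.
have elN f q : G f -> q \in Delta -> N (el f q).
  move=> Gf hq; have [Gq eq] := repP _ hq; have [Gq' eq'] := repP _ (qD _ _ Gf hq).
  have [Gr _ _] := repP' _ (qD _ _ Gf hq); split.
    by apply: gal_comp => //; apply: gal_comp.
  move=> x xs; rewrite /el /= -[RHS](rK' _ _ (qD _ _ Gf hq)); congr (rep' _ _).
  by rewrite -(eq' (SeqSub xs)) permM (pmP _ Gf) eq.
(* The usual corestriction formula: the sum of g' c(n) over the decompositions f g = g' n with
   representatives g and g'. *)
pose C f := \sum_(q in Delta) act (rep (q * pm f)%g) (c (el f q)).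
have rterm f q : G f -> q \in Delta -> rat B (act (rep (q * pm f)%g) (c (el f q))).
  move=> Gf hq; have [Gq' _] := repP _ (qD _ _ Gf hq); apply: (rat_act Gq').
  exact/rc/elN.
have CC f g : G f -> G g -> C (f \o g) = C f + act f (C g).
  move=> Gf Gg; have Gfg := gal_comp Gf Gg.
  have pmc q : q \in Delta -> (q * pm (f \o g) = q * pm g * pm f)%g.
    move=> hq; apply/permP => x; apply: val_inj; rewrite !permM (pmP _ Gfg).
    by rewrite (pmP _ Gf) (pmP _ Gg).
  have -> : C f = \sum_(q in Delta) act (rep (q * pm g * pm f)%g) (c (el f (q * pm g)%g)).
    rewrite /C (reindex_inj (mulIg (pm g))); apply: eq_bigl => q.
    by rewrite (groupMr (G := Delta_grp)) //; apply: pmD.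
  rewrite /C act_sum // => [|q hq]; last exact: rterm.
  rewrite -big_split /=; apply: eq_bigr => q hq.
  have hq1 := qD _ _ Gg hq; have hq2 := qD _ _ Gf hq1.
  have -> : el (f \o g) q = el f (q * pm g)%g \o el g q.
    by apply/funext => x; rewrite /el /= pmc // rK.
  have [N1 N2] := (elN _ _ Gf hq1, elN _ _ Gg hq).
  have [Gq2 _] := repP _ hq2; have [Gq1 _] := repP _ hq1.
  have [r1 r0] := (rc _ N1, rc _ N2); have [G1 _] := N1.
  rewrite pmc // hc // (actD Gq2 r1 (rat_act G1 r0)); congr (_ + _).
  rewrite -(act_comp Gq2 G1 r0) -(act_comp Gf Gq1 r0).
  by congr (act _ _); apply/funext => x; rewrite /el /= rK.
have tterm f q : G f -> q \in Delta -> t (act (rep (q * pm f)%g) (c (el f q))).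
  move=> Gf hq; have [Gq' _] := repP _ (qD _ _ Gf hq); apply: (tact _ _ Gq').
  exact/tc/elN.
have /choice[Q0 Q0P] : forall q, exists Q, t Q /\ (q \in Delta ->
    forall f, H f -> act (rep q) (c (rep' q \o f \o rep q)) = c f + (act f Q - Q)).
  move=> q; have [qin|_] := boolP (q \in Delta); last by exists 0.
  have [Gq _] := repP _ qin; have [Gq' e1 e2] := repP' _ qin.
  by have [Q tQ hQ] := inv _ _ Gq Gq' e1 e2; exists Q.
exists C, (\sum_(q in Delta) Q0 q); split.
- split; last exact: CC.
  by move=> f Gf; apply: ratsum => // q hq; apply: rterm.
- move=> f g Gf Gg fg; apply: eq_bigr => q hq.
  have pfg : pm f = pm g.
    apply/permP => x; apply/val_inj; rewrite (pmP _ Gf) (pmP _ Gg).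
    by apply: fg; rewrite mem_cat (valP x).
  rewrite -pfg; congr (act _ _); apply: dep; [exact: elN | exact: elN |].
  move=> x xs0; rewrite /el /= pfg fg // mem_cat; apply/orP; right.
  by apply: stab0 => //; case: (repP _ hq).
- by move=> f Gf; rewrite /C; elim/big_ind: _ => // q hq; apply: tterm.
- by elim/big_ind: _ => // q _; case: (Q0P q).
(* An element f of H fixes s, so its permutation is trivial and each term is a conjugate of c f,
   which [inv] compares with c f. *)
move=> f Hf; have [Gf fixf] := HN _ Hf.
have pm1 : pm f = 1%g.
  apply/permP => x; apply/val_inj; rewrite (pmP _ Gf) perm1 fixf //; exact: valP.
have -> : c f *+ #|Delta| = \sum_(q in Delta) c f by rewrite sumr_const.
rewrite act_sum // => [|q _]; last by apply: tr; case: (Q0P q).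
rewrite -sumrB -big_split /=; apply: eq_bigr => q hq.
by rewrite /el pm1 mulg1; have [_ ->] := Q0P q.
Qed.

End Restrictions.
End Action.

Section PrimaryTorsion.
Variable A : zmodType.
Implicit Type P : A.

Lemma coprime_torsion a b P : coprime a b -> P *+ a = 0 -> P *+ b = 0 -> P = 0.
Proof.
move=> co Pa Pb; have [a0|a_gt0] := posnP a.
  by move: co Pb; rewrite a0 /coprime gcd0n => /eqP ->; rewrite mulr1n.
case: (egcdnP b a_gt0) => km kn e _; move: e; rewrite (eqP co) => e.
have := mulrnA P a km; rewrite Pa mul0rn mulnC e mulrnDr mulr1n mulnC mulrnA Pb.
by rewrite mul0rn add0r.
Qed.

(** The number a is an inverse of h modulo m; for h = 0, coprimality forces m = 1. *)
Lemma inverse_mod h m : coprime h m -> exists a, forall P, P *+ m = 0 -> P *+ h *+ a = P.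
Proof.
move=> co; have [h0|h_gt0] := posnP h.
  exists 0 => P Pm; move: co Pm; rewrite h0 /coprime gcd0n => /eqP -> /=.
  by rewrite mulr1n => ->; rewrite !mul0rn.
case: (egcdnP m h_gt0) => km kn; rewrite (eqP co) => e _; exists km => P Pm.
by rewrite -mulrnA mulnC e mulrnDr mulr1n mulnC mulrnA Pm mul0rn add0r.
Qed.

Variable l : nat.

Definition ltors P := exists n, P *+ (l ^ n)%N = 0.

Lemma ltors0 : ltors 0.
Proof. by exists 0; rewrite mul0rn. Qed.
Lemma ltorsN P : ltors P -> ltors (- P).
Proof. by case=> n e; exists n; rewrite mulNrn e oppr0. Qed.
Lemma ltorsD P Q : ltors P -> ltors Q -> ltors (P + Q).
Proof.
move=> [n e] [m e']; exists (n + m)%N.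
by rewrite mulrnDl expnD mulrnA e mul0rn mulnC mulrnA e' mul0rn addr0.
Qed.
Lemma ltorsMn P n : ltors P -> ltors (P *+ n).
Proof. by case=> m e; exists m; rewrite -mulrnA mulnC mulrnA e mul0rn. Qed.
Lemma ltors_mono P n m : (n <= m)%N -> P *+ (l ^ n)%N = 0 -> P *+ (l ^ m)%N = 0.
Proof. by move=> /subnKC <- e; rewrite expnD mulrnA e mul0rn. Qed.

End PrimaryTorsion.

Section FiniteImage.
Variables (K : fieldType) (k : set K).
Hypotheses (sk : divring_closed [in k]) (cl : alg_closed K).
Notation G := (galois_group (algcl k) k).

Lemma finite_image (T : eqType) s (c : (K -> K) -> T) :
  (forall f x, G f -> x \in s -> f x \in s) -> depends_on G s c ->
  exists vs : seq T, (forall f, G f -> c f \in vs) /\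
    forall v, v \in vs -> exists2 f, G f & v = c f.
Proof.
move=> stab dep; have [rep repP] := Delta_reps k s.
exists [seq c (rep q) | q <- enum (Delta k s)]; split.
  move=> f Gf; have [q hq] := restr_perm stab Gf.
  have qD : q \in Delta k s by rewrite inE; apply/asboolP; exists f.
  have [Gq hq'] := repP _ qD; apply/mapP; exists q; first by rewrite mem_enum.
  by apply: dep => //; apply: Delta_agree hq hq'.
by move=> v /mapP[q]; rewrite mem_enum => /repP[Gq _] ->; exists (rep q).
Qed.

Lemma uniform_torsion (A : zmodType) l s (c : (K -> K) -> A) :
  (forall f x, G f -> x \in s -> f x \in s) -> depends_on G s c ->
  (forall f, G f -> ltors l (c f)) -> exists j, forall f, G f -> c f *+ (l ^ j)%N = 0.
Proof.
move=> stab dep tc; have [vs [vsP vsc]] := finite_image stab dep.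
have [j hj] : exists j, forall v, v \in vs -> v *+ (l ^ j)%N = 0.
  have : forall v, v \in vs -> ltors l v by move=> v /vsc[f Gf ->]; apply: tc.
  elim: (vs) => [|v t IH] h; first by exists 0.
  have [|j hj] := IH; first by move=> x xt; apply: h; rewrite inE xt orbT.
  have [n hn] := h v (mem_head _ _); exists (j + n)%N => x.
  rewrite inE => /orP[/eqP ->|xt]; first by apply: ltors_mono hn; rewrite leq_addl.
  by apply: ltors_mono (hj _ xt); rewrite leq_addr.
by exists j => f Gf; apply/hj/vsP.
Qed.

End FiniteImage.

(** * Restriction of cohomology in a pro-p extension *)

Section InflationRestriction.
Variables (K : fieldType) (p l : nat) (k1 k2 : set K) (E : ecurve K).
Hypotheses (pK : p \in [pchar K]) (cl : alg_closed K).
Hypotheses (l_prime : prime l) (l_neq_p : l != p).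
Hypotheses (sk1 : divring_closed [in k1]) (sk2 : divring_closed [in k2]).
Hypotheses (k12 : k1 `<=` k2) (inf : infinite_field k1).
Hypotheses (cE : coefs_in k1 E) (alg : algcl k1 = setT).
Notation G1 := (galois_group (algcl k1) k1).
Notation G2 := (galois_group (algcl k2) k2).
Hypothesis k2stab : forall f x, G1 f -> k2 x -> k2 (f x).
Hypothesis k2pro_p : forall f x, G1 f -> k2 x -> exists N, iter (p ^ N)%N f x = x.

Let p_prime : prime p. Proof. exact: pcharf_prime pK. Qed.

Lemma algcl2 : algcl k2 = setT.
Proof. by rewrite -subTset -alg; apply: algcl_sub. Qed.

Lemma gal_sub : G2 `<=` G1.
Proof.
rewrite algcl2 alg => f [h1 h2 h3 h4]; split=> // x kx.
exact/h3/k12.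
Qed.

Lemma cE2 : coefs_in k2 E.
Proof. by case: cE => *; split; apply: k12. Qed.

Lemma coprime_pl e j : coprime (p ^ e) (l ^ j).
Proof. by rewrite coprimeXl // coprimeXr // prime_coprime // dvdn_prime2 // eq_sym. Qed.

Lemma rat1 P : rat (algcl k1) P (E := E).
Proof. by rewrite alg; apply: rat_setT. Qed.

Lemma stable_in_k2 (s : seq K) : (forall x, x \in s -> k2 x) -> exists s' : seq K,
  [/\ {subset s <= s'}, forall f x, G1 f -> x \in s' -> f x \in s' &
      forall x, x \in s' -> k2 x].
Proof.
move=> sk; have [|s' [_ sub st orb]] := gal_stable sk1 cl (s := s).
  by move=> x _; rewrite alg.
exists s'; split=> // x /orb[f [y [Gf ys ->]]]; apply: k2stab => //; exact: sk.
Qed.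

(** Vanishing on G2, the cocycle factors through a finite quotient of G1 acting on elements of k2.
    This quotient is a p-group, and its order is invertible on l-power torsion. *)
Lemma infres_inj c : Gcocycle k1 G1 c -> locally_constant G1 c ->
  (forall f, G1 f -> ltors l (c f)) -> (forall f, G2 f -> c f = 0) ->
  exists2 S : epoint E, ltors l S & forall f, G1 f -> c f = act f S - S.
Proof.
move=> cc lc tc c0; have [rc hc] := cc.
have [s [_ dep]] := gal_uniform sk1 cl lc.
have [|s0 [_ sub0 st0 _]] := gal_stable sk1 cl (s := s); first by move=> x _; rewrite alg.
have [|s1 [s1k ext]] := galois_extend pK cl sk1 sk2 k12 inf (s0 := s0).
  by move=> x _; rewrite alg.
have [|s2 [sub1 st2 s2k]] := stable_in_k2 (s := s1); first by move=> x /s1k[].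
(* If f and g agree on s2, then f^-1 g agrees on s0 with an element t of G2, and c t = 0. *)
have dep2 : depends_on G1 s2 c.
  move=> f g Gf Gg fg; have [f' [Gf' e e']] := gal_inv sk1 Gf.
  have Gh := gal_comp Gf' Gg.
  have [|t Gt ht] := ext _ Gh.
    move=> x /sub1 xs /=; rewrite -fg //; exact: (congr1 (fun h => h x) e').
  have -> : g = f \o (f' \o g).
    by apply/funext => x /=; rewrite -[LHS](congr1 (fun h => h (g x)) e).
  rewrite hc //; have -> : c (f' \o g) = c t.
    by apply: dep => //; [apply: gal_sub | move=> x /sub0 xs; rewrite ht].
  by rewrite (c0 _ Gt) (act0 sk1 cE Gf) addr0.
have [S [_ hS close]] := average sk1 cE st2 cc dep2.
have tS : ltors l S.
  by apply: close => //; [apply: ltors0 | apply: ltorsD | apply: ltorsN].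
have [e he] := Delta_pgroup p_prime (fun f x Gf xs => k2pro_p Gf (s2k _ xs)).
have [j hj] := tS; have [a ha] := inverse_mod (epoint E) (coprime_pl e j).
exists (S *+ a); first exact: ltorsMn.
move=> f Gf; rewrite (actMn sk1 cE Gf _ (rat1 S)) -mulrnBl -hS // he ha //.
(* The multiple of c f by l^j is killed by p^e, because S is killed by l^j, and also by a power of
   l. *)
have [n hn] := tc _ Gf; apply: (coprime_torsion (coprime_pl e n)).
  rewrite -mulrnA mulnC mulrnA -he hS // mulrnBl -(actMn sk1 cE Gf _ (rat1 S)) hj.
  by rewrite (act0 sk1 cE Gf) subr0.
by rewrite -mulrnA mulnC mulrnA hn mul0rn.
Qed.

Lemma gal_normal f g g' : G1 g -> G1 g' -> g \o g' = id -> g' \o g = id ->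
  G2 f -> G2 (g' \o f \o g).
Proof.
move=> Gg Gg' e e' Gf; have := gal_comp Gg' (gal_comp (gal_sub Gf) Gg).
rewrite alg algcl2 => -[h1 h2 _ h4]; split=> // x kx /=.
rewrite (gal_fix Gf); last exact: k2stab.
exact: (congr1 (fun h => h x) e').
Qed.

(** The cocycle extends to an open subgroup N of G1 containing G2, is corestricted to G1 and then
    multiplied by an inverse of the index p^e. *)
Lemma infres_surj c : Gcocycle k2 G2 c -> locally_constant G2 c ->
  (forall f, G2 f -> ltors l (c f)) ->
  (forall g g', G1 g -> G1 g' -> g \o g' = id -> g' \o g = id ->
    exists2 Q, ltors l Q &
      forall f, G2 f -> act g (c (g' \o f \o g)) = c f + (act f Q - Q)) ->
  exists C, [/\ Gcocycle k1 G1 C, locally_constant G1 C,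
    forall f, G1 f -> ltors l (C f) &
    exists2 Q : epoint E, ltors l Q & forall f, G2 f -> C f = c f + (act f Q - Q)].
Proof.
move=> [rc hc] lc tc inv.
have [s [_ dep]] := gal_uniform sk2 cl lc.
have [|sa [_ suba sta _]] := gal_stable sk1 cl (s := s); first by move=> x _; rewrite alg.
have depa : depends_on G2 sa c by move=> f g Gf Gg fg; apply: dep => // x /suba/fg.
have sta2 f x : G2 f -> x \in sa -> f x \in sa by move=> /gal_sub; apply: sta.
have [j hj] := uniform_torsion sta2 depa tc.
have [vs [vsP _]] := finite_image sta2 depa.
(* The coordinates of the values of c are included, so that agreement on s0 also gives equal actions
   on these values. *)
have [|s0 [_ sub0 st0 _]] := gal_stable sk1 cl (s := sa ++ flatten (map (@coords _ _) vs)).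
  by move=> x _; rewrite alg.
have sa0 x : x \in sa -> x \in s0 by move=> xs; apply: sub0; rewrite mem_cat xs.
have cs0 f x : G2 f -> x \in coords (c f) -> x \in s0.
  move=> Gf xc; apply: sub0; rewrite mem_cat; apply/orP; right.
  by apply/flattenP; exists (coords (c f)); rewrite // map_f // vsP.
have dep0 : depends_on G2 s0 c by move=> f g Gf Gg fg; apply: depa => // x /sa0/fg.
have [|s1 [s1k ext]] := galois_extend pK cl sk1 sk2 k12 inf (s0 := s0).
  by move=> x _; rewrite alg.
have [|s2 [sub1 st2 s2k]] := stable_in_k2 (s := s1); first by move=> x /s1k[].
(* An element f of N agrees on s0 with some t f in G2; setting c' f = c (t f) extends c to N. *)
pose N := [set f | G1 f /\ forall x, x \in s2 -> f x = x].
have /choice[t tP] : forall f, exists t, N f -> G2 t /\ forall x, x \in s0 -> t x = f x.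
  move=> f; have [[Gf fixf]|nN] := pselect (N f); last by exists id.
  have [|t Gt ht] := ext _ Gf; first by move=> x /sub1/fixf.
  by exists t.
pose c' f := c (t f).
have G2N : G2 `<=` N by move=> f Gf; split; [apply: gal_sub | move=> x /s2k; apply: (gal_fix Gf)].
have c'E f : G2 f -> c' f = c f.
  by move=> Gf; have [Gt ht] := tP _ (G2N _ Gf); apply: dep0.
have cc' : Gcocycle k1 N c'.
  split; first by move=> f _; apply: rat1.
  move=> f g Nf Ng; have Nfg : N (f \o g).
    case: Nf Ng => Gf ff [Gg fg]; split; first exact: gal_comp.
    by move=> x xs /=; rewrite fg // ff.
  have [Gtf htf] := tP _ Nf; have [Gtg htg] := tP _ Ng; have [Gt ht] := tP _ Nfg.
  have -> : c' (f \o g) = c (t f \o t g).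
    apply: dep0 => //; first exact: gal_comp.
    move=> x xs; rewrite ht //= htg // htf //; apply: st0 => //; by case: Ng.
  rewrite hc //; congr (_ + _); apply: act_coords => x xc.
  by apply/htf/(cs0 (t g)).
have depc' : depends_on N s0 c'.
  move=> f g Nf Ng fg; have [Gtf htf] := tP _ Nf; have [Gtg htg] := tP _ Ng.
  by apply: dep0 => // x xs; rewrite htf // htg // fg.
have [|||f P|f Nf|g g' Gg Gg' e e'|C [Q [CC depC tC tQ hC]]] :=
    corestriction sk1 cE st2 (t := ltors l) G2N cc' st0 depc'.
- by move=> P _; apply: rat1.
- exact: ltors0.
- exact: ltorsD.
- move=> Gf [n hn]; exists n; by rewrite -(actMn sk1 cE Gf _ (rat1 P)) hn (act0 sk1 cE Gf).
- by rewrite /c'; apply: tc; case: (tP _ Nf).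
- have [Q tQ hQ] := inv _ _ Gg Gg' e e'; exists Q => // f Gf.
  by rewrite !c'E ?hQ //; apply: gal_normal e e' Gf.
have [e he] := Delta_pgroup p_prime (fun f x Gf xs => k2pro_p Gf (s2k _ xs)).
have [a ha] := inverse_mod (epoint E) (coprime_pl e j).
exists (fun f => C f *+ a); split.
- case: CC => _ CC; split; first by move=> f _; apply: rat1.
  by move=> f g Gf Gg; rewrite CC // mulrnDl (actMn sk1 cE Gf _ (rat1 _)).
- apply: (@depends_locally_constant _ _ _ (s2 ++ s0)) => f g Gf Gg fg.
  by rewrite (depC f g).
- by move=> f Gf; apply/ltorsMn/tC.
exists (Q *+ a); first exact: ltorsMn.
move=> f Gf; have Gf1 := gal_sub Gf.
rewrite hC // c'E // he mulrnDl ha ?hj // mulrnBl.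
by rewrite (actMn sk1 cE Gf1 _ (rat1 Q)).
Qed.

End InflationRestriction.

(** * Valuation rings *)

Lemma fraction_div (R : idomainType) (c : {fraction R}) :
  exists n d : R, d != 0 /\ c = tofrac n / tofrac d.
Proof.
elim/generic_quotient.quotW: c => r; exists (fraction.frac r).1, (fraction.frac r).2.
split; first exact: fraction.denom_ratioP.
have d0 : tofrac (fraction.frac r).2 != 0 by rewrite tofrac_eq0 fraction.denom_ratioP.
apply: (mulIf d0); rewrite divfK // !generic_quotient.piE.
apply/generic_quotient.eqmodP; rewrite /= fraction.FracField.equivfE /fraction.FracField.mulf.
rewrite !fraction.numden_Ratio ?mulf_neq0 ?oner_eq0 ?fraction.denom_ratioP //.
by rewrite !mulr1 mulrC.
Qed.

Section Valuation.
Variables (K : fieldType) (V : set K).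
Hypothesis VP : is_place setT V.

Let sV : subring_closed [in V]. Proof. by case: VP. Qed.

Lemma val1 : V 1.
Proof. by case: sV => /set_mem. Qed.
Lemma valB x y : V x -> V y -> V (x - y).
Proof. by case: sV => _ h _ /mem_set Vx /mem_set Vy; apply/set_mem/h. Qed.
Lemma valM x y : V x -> V y -> V (x * y).
Proof. by case: sV => _ _ h /mem_set Vx /mem_set Vy; apply/set_mem/h. Qed.
Lemma val0 : V 0.
Proof. by rewrite -(subrr 1); apply: valB; apply: val1. Qed.
Lemma valN x : V x -> V (- x).
Proof. by rewrite -sub0r; apply: valB; apply: val0. Qed.
Lemma valD x y : V x -> V y -> V (x + y).
Proof. by move=> Vx Vy; rewrite -[y]opprK; apply/valB/valN. Qed.
Lemma valX x n : V x -> V (x ^+ n).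
Proof. by move=> Vx; elim: n => [|n IH]; [apply: val1 | rewrite exprS; apply: valM]. Qed.
Lemma val_nat n : V n%:R.
Proof. by elim: n => [|n IH]; [apply: val0 | rewrite -addn1 natrD; apply: valD => //; apply: val1]. Qed.
Lemma valsum I (r : seq I) (P : pred I) (f : I -> K) :
  (forall i, P i -> V (f i)) -> V (\sum_(i <- r | P i) f i).
Proof. by move=> h; elim/big_ind: _ => //; [apply: val0 | apply: valD]. Qed.
Lemma valprod I (r : seq I) (P : pred I) (f : I -> K) :
  (forall i, P i -> V (f i)) -> V (\prod_(i <- r | P i) f i).
Proof. by move=> h; elim/big_ind: _ => //; [apply: val1 | apply: valM]. Qed.
Lemma val_total x : V x \/ V x^-1.
Proof. by case: VP => _ _ h _; apply: h. Qed.

Notation m := (maximal_ideal V).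

Lemma mideal0 : m 0. Proof. by split; [apply: val0 | left]. Qed.
Lemma mideal_val x : m x -> V x. Proof. by case. Qed.
Lemma mideal_inv x : ~ V x -> m x^-1.
Proof.
move=> nVx; have [//|Vx] := val_total x; split=> //; right; by rewrite invrK.
Qed.
Lemma mideal1 : ~ m 1.
Proof. by case=> _ [/eqP|]; rewrite ?oner_eq0 // invr1 => h; apply: h; apply: val1. Qed.
Lemma midealM x y : m x -> V y -> m (x * y).
Proof.
move=> [Vx hx] Vy; split; first exact: valM.
have [->|x0] := eqVneq x 0; first by rewrite mul0r; left.
have [->|y0] := eqVneq y 0; first by rewrite mulr0; left.
right=> h; case: hx => [/eqP|]; first by rewrite (negPf x0).
apply; have -> : x^-1 = (x * y)^-1 * y by rewrite invfM mulfVK.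
exact: valM.
Qed.
Lemma midealD x y : m x -> m y -> m (x + y).
Proof.
move=> mx my; have [Vx hx] := mx; have [Vy hy] := my; split; first exact: valD.
have [->|xy0] := eqVneq (x + y) 0; [by left | right => h].
have e : (x + y)^-1 * x + (x + y)^-1 * y = 1 by rewrite -mulrDr mulVf.
have [x0|x0] := eqVneq x 0.
  by case: hy => [y0|]; [rewrite x0 y0 addr0 eqxx in xy0 | apply; move: h; rewrite x0 add0r].
case: (val_total (y / x)) => q.
  have := midealM mx (valM (valD val1 q) h).
  have -> : x * ((1 + y / x) * (x + y)^-1) = 1 by field; rewrite xy0 x0.
  exact: mideal1.
have y0 : y != 0.
  by apply/eqP => y0; case: hx => [|]; [apply/eqP | apply; move: h; rewrite y0 addr0].
rewrite invf_div in q.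
have := midealM my (valM (valD q val1) h).
have -> : y * ((x / y + 1) * (x + y)^-1) = 1 by field; rewrite xy0 y0.
exact: mideal1.
Qed.
Lemma mideal_sum I (r : seq I) (P : pred I) (f : I -> K) :
  (forall i, P i -> m (f i)) -> m (\sum_(i <- r | P i) f i).
Proof. by move=> h; elim/big_ind: _ => //; [apply: mideal0 | apply: midealD]. Qed.
Lemma mideal_unit x : m x -> V x^-1 -> x = 0.
Proof. by case=> _ [->|]. Qed.
Lemma midealN x : m x -> m (- x).
Proof. by move=> mx; rewrite -mulrN1; apply: midealM => //; apply/valN/val1. Qed.
Lemma nideal x : ~ m x -> V x^-1.
Proof.
move=> nm; have [//|Vx] := val_total x^-1; rewrite invrK in Vx.
by apply: contrapT => h; apply: nm; split=> //; right.
Qed.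

Lemma val_unit1 x : m x -> V (1 + x)^-1.
Proof.
move=> mx; apply: nideal => h; apply: mideal1.
by rewrite -[1](addrK x); apply: midealD => //; apply: midealN.
Qed.

Lemma val_root x n : (0 < n)%N -> V (x ^+ n) -> V x.
Proof.
move=> n0 Vxn; apply: contrapT => nV; have mi := mideal_inv nV.
have x0 : x != 0 by apply/eqP => x0; apply: nV; rewrite x0; apply: val0.
apply: mideal1; have -> : 1 = x^-1 * (x^-1 ^+ n.-1 * x ^+ n).
  by rewrite mulrA -exprS prednK // exprVn mulVf // expf_neq0.
apply: midealM => //; apply: valM => //; apply: valX; exact: mideal_val.
Qed.

Lemma val_integral (q : {poly K}) x : q \is monic -> poly_in V q -> root q x -> V x.
Proof.
move=> mon hq rx; apply: contrapT => nV; have mi := mideal_inv nV.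
have x0 : x != 0 by apply/eqP => x0; apply: nV; rewrite x0; apply: val0.
have q0 := monic_neq0 mon; apply: mideal1.
have sq : size q = (size q).-1.+1 by rewrite prednK // size_poly_gt0.
move/rootP: rx; rewrite horner_coef sq big_ord_recr /= => /eqP; rewrite addr_eq0 => /eqP e.
have aux n i c : (i < n)%N -> c * x ^+ i = x^-1 * (c * x^-1 ^+ (n.-1 - i)) * x ^+ n.
  case: n => // n lt; rewrite /= -{2}(subnK (lt : (i <= n)%N)) -addSn exprD exprS.
  move: (n - i)%N => a; rewrite exprVn; field; by rewrite x0 expf_neq0.
have -> : 1 = - \sum_(i < (size q).-1) x^-1 * (q`_i * x^-1 ^+ ((size q).-2 - i)).
  apply: (mulIf (expf_neq0 (size q).-1 x0)).
  rewrite mul1r mulNr mulr_suml -[LHS]mul1r -(monicP mon) lead_coefE -[LHS]opprK -e.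
  congr (- _); apply: eq_bigr => i _; exact: (aux _ _ _ (ltn_ord i)).
apply/midealN/mideal_sum => i _; apply: midealM => //; apply: valM; first exact: hq.
exact/valX/mideal_val.
Qed.

End Valuation.

(** The value group is archimedean: powers of a small element tend to 0. *)
Definition rank_one (K : fieldType) (V : set K) := forall a x : K, a != 0 ->
  maximal_ideal V x -> exists N, V (x ^+ N / a).

Section RankOne.
Variables (K : fieldType) (V : set K) (p : nat) (j : {rmorphism {poly 'F_p} -> K}).
Hypotheses (VP : is_place setT V) (j_inj : injective j).
Hypothesis alg : forall x, exists q : {poly K}, [/\ q != 0, root q x &
  forall i, exists n d, j d != 0 /\ q`_i = j n / j d].
Notation m := (maximal_ideal V).

Definition vunit (u : K) := [/\ u != 0, V u & V u^-1].

Lemma vunit1 : vunit 1.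
Proof. by split; rewrite ?oner_neq0 ?invr1 //; apply: (val1 VP). Qed.
Lemma vunitM u v : vunit u -> vunit v -> vunit (u * v).
Proof.
by move=> [? ? ?] [? ? ?]; split; [exact: mulf_neq0 | exact: (valM VP) | rewrite invfM; exact: (valM VP)].
Qed.
Lemma vunitV u : vunit u -> vunit u^-1.
Proof. by move=> [? ? ?]; split; rewrite ?invr_eq0 ?invrK. Qed.
Lemma vunitX u n : vunit u -> vunit (u ^+ n).
Proof.
by move=> h; elim: n => [|n IH]; [apply: vunit1 | rewrite exprS; apply: vunitM].
Qed.

Let p0 (h : {poly 'F_p}) : h != 0 -> j h != 0.
Proof. by move=> h0; rewrite -(rmorph0 j) (inj_eq j_inj). Qed.

Let jC (c : 'F_p) : V (j c%:P).
Proof.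
have -> : c = (nat_of_ord c)%:R by rewrite natr_Zp.
by rewrite polyC_natr rmorph_nat; apply: (val_nat VP).
Qed.

Let jCu (c : 'F_p) : c != 0 -> vunit (j c%:P).
Proof.
move=> c0; split=> //; first by rewrite p0 ?polyC_eq0.
have e : j c%:P * j (c^-1)%:P = 1 by rewrite -rmorphM -polyCM mulfV //= rmorph1.
suff -> : (j c%:P)^-1 = j (c^-1)%:P by [].
by apply: (mulfI (p0 _ : j c%:P != 0)); rewrite ?polyC_eq0 // e mulfV ?p0 ?polyC_eq0.
Qed.

(** Up to a unit x is pi^(b - a), that is, the valuation of x is an integral multiple of that of
    pi. *)
Let pi_like (pi : K) (x : K) := exists a b u, vunit u /\ x * pi ^+ a = pi ^+ b * u.

Lemma uniformizer : exists pi, [/\ pi != 0, m pi & forall h, h != 0 -> pi_like pi (j h)].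
Proof.
have jsum (h : {poly 'F_p}) : j h = \sum_(i < size h) j (h`_i)%:P * j 'X ^+ i.
  rewrite -{1}[h]coefK poly_def rmorph_sum; apply: eq_bigr => i _.
  by rewrite -mul_polyC rmorphM rmorphXn.
(* If [j 'X] is not integral, the place lies above infinity: its inverse is a uniformizer and the
   leading term of h dominates. *)
have [Vt|nVt] := pselect (V (j 'X)); last first.
  have mt := mideal_inv VP nVt; have t0 : j 'X != 0 by rewrite p0 ?polyX_eq0.
  have aux n i : (i <= n)%N -> j 'X ^+ i * (j 'X)^-1 ^+ n = (j 'X)^-1 ^+ (n - i).
    by move=> le; rewrite -{1}(subnKC le) exprD mulrA -exprMn mulfV // expr1n mul1r.
  exists (j 'X)^-1; split=> [|//|h h0]; first by rewrite invr_eq0.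
  have sh : size h = (size h).-1.+1 by rewrite prednK // size_poly_gt0.
  pose s := \sum_(i < (size h).-1) j (h`_i)%:P * (j 'X)^-1 ^+ ((size h).-1 - i).
  have ms : m s.
    apply: (mideal_sum VP) => i _; rewrite mulrC.
    have -> : ((size h).-1 - i = ((size h).-1 - i).-1.+1)%N by rewrite prednK // subn_gt0.
    rewrite exprS -mulrA; apply: (midealM VP) => //; apply: (valM VP) => //.
    by apply: (valX VP); apply: mideal_val mt.
  have lu : vunit (j (lead_coef h)%:P) by apply: jCu; rewrite lead_coef_eq0.
  exists (size h).-1, 0, (j (lead_coef h)%:P + s); split; last first.
    rewrite expr0 mul1r {1}jsum sh big_ord_recr /= mulrDl addrC; congr (_ + _).
      by rewrite -mulrA -exprMn mulfV // expr1n mulr1.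
    rewrite mulr_suml; apply: eq_bigr => i _; rewrite -mulrA; congr (_ * _).
    exact: aux (ltnW (ltn_ord i)).
  have -> : j (lead_coef h)%:P + s = j (lead_coef h)%:P * (1 + (j (lead_coef h)%:P)^-1 * s).
    by case: lu => u0 _ _; rewrite mulrDr mulr1 mulrA mulfV // mul1r.
  case: lu => u0 Vu Vui; apply: vunitM => //.
  have mu : m ((j (lead_coef h)%:P)^-1 * s) by rewrite mulrC; apply: (midealM VP).
  split; [|apply: (valD VP); [apply: (val1 VP) | apply: mideal_val mu] | exact: (val_unit1 VP)].
  apply/eqP => e; apply: (mideal1 VP); have -> : 1 = - ((j (lead_coef h)%:P)^-1 * s).
    by apply/eqP; rewrite -addr_eq0 e.
  exact: (midealN VP).
have Vj h : V (j h).
  by rewrite jsum; apply: (valsum VP) => i _; apply: (valM VP) => //; apply: (valX VP).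
(* If all nonzero polynomials were units, every x would be integral over V, and V would be the whole
   field. *)
have [g [g0 nVg]] : exists g, g != 0 /\ ~ V (j g)^-1.
  apply: contrapT => no.
  have ju h : h != 0 -> V (j h)^-1 by move=> h0; apply: contrapT => nV; apply: no; exists h.
  case: (VP) => _ _ _; apply; rewrite eqEsubset; split=> // x _.
  have [q [q0 rx hq]] := alg x.
  have qu i : V q`_i.
    have [n [d [d0 ->]]] := hq i; apply: (valM VP) => //; apply: ju.
    by apply: contraNneq d0 => ->; rewrite rmorph0.
  have lu : V (lead_coef q)^-1.
    have [n [d [d0 e]]] := hq (size q).-1; rewrite lead_coefE e invf_div; apply: (valM VP) => //.
    apply: ju; apply: contraNneq q0 => n0; rewrite -lead_coef_eq0 lead_coefE e n0.
    by rewrite rmorph0 mul0r.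
  apply: (val_integral VP (q := (lead_coef q)^-1 *: q)).
  - by rewrite monicE lead_coefZ mulVf // lead_coef_eq0.
  - by move=> i; rewrite coefZ; apply: (valM VP).
  - by rewrite rootZ // invr_eq0 lead_coef_eq0.
(* For a nonunit f of least degree, nonzero remainders modulo f are units, so dividing repeatedly by
   f yields the valuation. *)
pose Q n := `[< exists f : {poly 'F_p}, [/\ f != 0, ~ V (j f)^-1 & size f = n] >].
have exQ : exists n, Q n by exists (size g); apply/asboolP; exists g.
case: (ex_minnP exQ) => n /asboolP[f [f0 nVf sf]] min.
have mf : m (j f) by split=> //; right.
exists (j f); split=> //; first exact: p0.
move=> h; move sh : (size h) => N; elim/ltn_ind: N h sh => N IH h sh h0.
have sf1 : (1 < size f)%N.
  rewrite ltnNge; apply/negP => le1; apply: nVf.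
  have /size_poly1P[c c0 ->] : size f == 1%N by rewrite eqn_leq le1 size_poly_gt0.
  by case: (jCu c0).
have eh := divp_eq h f; have [r0|r0] := eqVneq (h %% f) 0.
  rewrite r0 addr0 in eh.
  have q0 : h %/ f != 0 by apply: contraNneq h0 => q0; rewrite eh q0 mul0r.
  have [|a [b [u [hu e]]]] := IH _ _ _ erefl q0.
    by rewrite -sh size_divp // ltn_subrL size_poly_gt0 h0 andbT -ltnS prednK // ltnW.
  exists a, b.+1, u; split=> //; rewrite eh rmorphM /= mulrAC e.
  by rewrite exprSr mulrAC.
exists 0, 0, (j h); split; last by rewrite !expr0 mulr1 mul1r.
have ru : V (j (h %% f))^-1.
  apply: contrapT => nV; have := min (size (h %% f)); rewrite -sf leqNgt ltn_modp f0.
  by move=> /(_ _)/notF; apply; apply/asboolP; exists (h %% f).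
split; [exact: p0 | exact: Vj |].
have -> : j h = j (h %% f) * (1 + j f * (j (h %/ f) * (j (h %% f))^-1)).
  by rewrite {1}eh rmorphD rmorphM /=; field; apply: p0.
rewrite invfM; apply: (valM VP) => //; apply: (val_unit1 VP).
by apply: (midealM VP) => //; apply: (valM VP).
Qed.

Let pi_like_div pi x y : pi != 0 -> y != 0 -> pi_like pi x -> pi_like pi y -> pi_like pi (x / y).
Proof.
move=> pi0 y0 [a [b [u [hu e]]]] [a' [b' [u' [hu' e']]]].
exists (a + b')%N, (b + a')%N, (u / u'); split; first by apply: vunitM => //; apply: vunitV.
have [[u0 _ _] [u'0 _ _]] := (hu, hu').
have pn0 n : pi ^+ n != 0 by apply: expf_neq0.
have -> : x = pi ^+ b * u / pi ^+ a by rewrite -e mulfK.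
have -> : y = pi ^+ b' * u' / pi ^+ a' by rewrite -e' mulfK.
rewrite !exprD; move: (pn0 a) (pn0 b) (pn0 a') (pn0 b').
move: (pi ^+ a) (pi ^+ b) (pi ^+ a') (pi ^+ b') => A B A' B' *.
by field; apply/and4P.
Qed.

(** In q.[x] = 0 the largest term cannot be alone, since otherwise 1 would be in the maximal ideal.
    Two terms of equal size make a positive power of x a quotient of coefficients, up to a unit. *)
Lemma pi_like_pow pi : pi != 0 -> (forall h, h != 0 -> pi_like pi (j h)) ->
  forall x, x != 0 -> exists2 n, (0 < n)%N & pi_like pi (x ^+ n).
Proof.
move=> pi0 hpi x x0; have [q [q0 rx hq]] := alg x.
have qpi i : q`_i != 0 -> pi_like pi q`_i.
  have [n [d [d0 e]]] := hq i; rewrite e mulf_eq0 invr_eq0 negb_or => /andP[n0 _].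
  apply: pi_like_div => //; apply: hpi.
    by apply: contraNneq n0 => ->; rewrite rmorph0.
  by apply: contraNneq d0 => ->; rewrite rmorph0.
pose T i := q`_i * x ^+ i.
have T0 i : (T i == 0) = (q`_i == 0) by rewrite mulf_eq0 expf_eq0 (negPf x0) andbF orbF.
have [i0 Ti0 dom] : exists2 i0, T i0 != 0 & forall i, V (T i / T i0).
  have [i0 Ti0 dom] : exists2 i0, T i0 != 0 & forall i, (i < size q)%N -> V (T i / T i0).
    have : exists i, (i < size q)%N && (T i != 0).
      exists (size q).-1; rewrite ltn_predL size_poly_gt0 q0 /= T0 -lead_coefE.
      by rewrite lead_coef_eq0.
    elim: (size q) => [|n IH] [i //]; rewrite ltnS leq_eqVlt.
    have [ex|no] := pselect (exists i, (i < n)%N && (T i != 0)).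
      move=> _; have [i0 Ti0 dom] := IH ex.
      have [h|h] := val_total VP (T n / T i0).
        by exists i0 => // i'; rewrite ltnS leq_eqVlt => /orP[/eqP ->|/dom].
      have Tn0 : T n / T i0 != 0 -> T n != 0 by apply: contraNneq => ->; rewrite mul0r.
      have [e|ne] := eqVneq (T n / T i0) 0.
        exists i0 => // i'; rewrite ltnS leq_eqVlt => /orP[/eqP ->|/dom //].
        by rewrite e; apply: (val0 VP).
      exists n; first exact: Tn0.
      move=> i'; rewrite ltnS leq_eqVlt => /orP[/eqP ->|/dom hi].
        by rewrite mulfV ?Tn0 //; apply: (val1 VP).
      have -> : T i' / T n = T i' / T i0 * (T n / T i0)^-1 by field; rewrite Ti0 Tn0.
      exact: (valM VP).
    move=> /andP[/orP[/eqP ei|lt] Ti]; last by case: no; exists i; rewrite lt.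
    exists i => // i'; rewrite ltnS leq_eqVlt => /orP[/eqP ->|lt].
      by rewrite -ei mulfV //; apply: (val1 VP).
    have -> : T i' = 0 by apply/eqP/negPn/negP => h; case: no; exists i'; rewrite lt.
    by rewrite mul0r; apply: (val0 VP).
  exists i0 => // i; have [/dom//|ge] := ltnP i (size q).
  by rewrite /T nth_default // !mul0r; apply: (val0 VP).
have [i [ni Ti hi]] : exists i, [/\ i != i0, T i != 0 & vunit (T i / T i0)].
  apply: contrapT => no; apply: (mideal1 VP).
  have lt0 : (i0 < size q)%N.
    by rewrite ltnNge; apply/negP => le; move: Ti0; rewrite T0 nth_default ?eqxx.
  have : \sum_(i < size q) T i = 0 by rewrite -horner_coef (rootP rx).
  rewrite (bigD1 (Ordinal lt0)) //= => /eqP; rewrite addr_eq0 => /eqP e.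
  have -> : 1 = - \sum_(i < size q | i != Ordinal lt0) T i / T i0.
    by apply: (mulIf Ti0); rewrite mul1r mulNr mulr_suml {1}e; congr (- _); apply: eq_bigr => i _; rewrite divfK.
  apply/(midealN VP)/(mideal_sum VP) => i ni; split=> //.
  have [->|Ti] := eqVneq (T i / T i0) 0; [by left | right => h].
  apply: no; exists (nat_of_ord i); split=> //.
    by apply: contraNneq Ti => ->; rewrite mul0r.
wlog lt : i i0 Ti0 ni Ti hi {dom} / (i0 < i)%N => [wl|].
  have := ni; rewrite neq_ltn => /orP[lt|lt]; last exact: (wl i i0).
  apply: (wl i0 i) => //; first by rewrite eq_sym.
  by rewrite -invf_div; apply: vunitV.
exists (i - i0)%N; first by rewrite subn_gt0.
have ex : x ^+ (i - i0) = T i / T i0 * (q`_i0 / q`_i).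
  have qi0 : q`_i0 != 0 by rewrite -T0.
  have qi : q`_i != 0 by rewrite -T0.
  have ei : x ^+ i = x ^+ (i - i0) * x ^+ i0 by rewrite -exprD subnK // ltnW.
  rewrite /T ei; have := expf_neq0 i0 x0; move: (x ^+ i0) (x ^+ (i - i0)) => A B A0.
  by field; rewrite qi qi0 A0.
have [a [b [u [hu e]]]] : pi_like pi (q`_i0 / q`_i).
  by apply: pi_like_div => //; rewrite -?T0 //; apply: qpi; rewrite -T0.
exists a, b, (T i / T i0 * u); split; first exact: vunitM.
by rewrite ex -[LHS]mulrA e mulrCA.
Qed.

(** For nonzero x and a in the maximal ideal, x^n and a^n' are pi^c and pi^c' up to units. So x^(n
    c') is a^(n' c) up to a unit, and this is divisible by a. *)
Lemma rank_one_place : rank_one V.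
Proof.
have [pi [pi0 mpi hpi]] := uniformizer.
have key x : x != 0 -> m x -> exists n c u, [/\ (0 < n)%N, (0 < c)%N, vunit u & x ^+ n = pi ^+ c * u].
  move=> x0 mx; have [n n0 [a [b [u [hu e]]]]] := pi_like_pow pi0 hpi x0.
  have [u0 Vu Vui] := hu; have mxn : m (x ^+ n).
    by rewrite -(prednK n0) exprS; apply: (midealM VP) => //; apply: (valX VP); apply: mideal_val mx.
  have [le|lt] := leqP b a; last first.
    exists n, (b - a)%N, u; rewrite subn_gt0; split=> //.
    by apply: (mulIf (expf_neq0 a pi0)); rewrite e mulrAC -exprD subnK // ltnW.
  case: (mideal1 VP); have -> : 1 = x ^+ n * (pi ^+ (a - b) * u^-1).
    apply: (mulIf u0); apply: (mulIf (expf_neq0 b pi0)).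
    rewrite mul1r mulrC -e mulrA -[RHS]mulrA [_ * pi ^+ b]mulrC -!mulrA.
    by rewrite [u^-1 * _]mulrCA mulVf // mulr1 -exprD subnK.
  apply: (midealM VP) => //; apply: (valM VP) => //; apply: (valX VP); exact: mideal_val mpi.
move=> a x a0 mx; have Vx := mideal_val mx.
have [Vai|nVai] := pselect (V a^-1); first by exists 0; rewrite expr0 mul1r.
have ma : m a by split; [case: (val_total VP a) | right].
have [x0|x0] := eqVneq x 0; first by exists 1; rewrite x0 expr1 mul0r; apply: (val0 VP).
have [n [c [u [n0 c0 hu e]]]] := key _ x0 mx.
have [n' [c' [u' [n0' c0' hu' e']]]] := key _ a0 ma.
exists (n * c')%N; have nc : (0 < n' * c)%N by rewrite muln_gt0 n0'.
have -> : x ^+ (n * c') / a = a ^+ (n' * c).-1 * (u ^+ c' * (u' ^+ c)^-1).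
  apply: (mulIf a0); rewrite divfK // [RHS]mulrAC -exprSr prednK //.
  rewrite exprM e exprM e' !exprMn -!exprM mulnC.
  have [u'0 _ _] := hu'; by field; apply: expf_neq0.
apply: (valM VP); first by apply: (valX VP); apply: mideal_val ma.
by have [_ ? _] := vunitM (vunitX c' hu) (vunitV (vunitX c hu')).
Qed.

End RankOne.

(** * Completions *)

Definition limit (K : fieldType) (V : set K) (r : nat -> K) (x : K) :=
  forall a, a != 0 -> exists N0, forall N, (N0 <= N)%N -> V ((r N - x) / a).

(** Control of consecutive terms is enough because the valuation is nonarchimedean. *)
Definition cauchy (K : fieldType) (V : set K) (r : nat -> K) :=
  forall a, a != 0 -> exists N0, forall N, (N0 <= N)%N -> V ((r N.+1 - r N) / a).

Section ValuationTopology.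
Variables (K : fieldType) (V : set K).
Hypothesis VP : is_place setT V.
Notation m := (maximal_ideal V).

Lemma not_val_inv t : t != 0 -> m t -> ~ V t^-1.
Proof. by move=> t0 mt /(mideal_unit mt)/eqP; rewrite (negPf t0). Qed.

Lemma val_trans (x a b : K) : b != 0 -> V (x / b) -> V (b / a) -> V (x / a).
Proof.
move=> b0 h1 h2; have -> : x / a = x / b * (b / a) by rewrite mulrA divfK.
exact: (valM VP).
Qed.

Lemma small_pow (t a : K) : rank_one V -> a != 0 -> m t ->
  exists N0, forall N, (N0 <= N)%N -> V (t ^+ N / a).
Proof.
move=> V1 a0 mt; have [N0 h] := V1 _ _ a0 mt; exists N0 => N le.
by rewrite -(subnK le) exprD -mulrA; apply: (valM VP) => //; apply: (valX VP); case: mt.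
Qed.

Lemma separated (t x : K) : t != 0 -> m t -> (forall a, a != 0 -> V (x / a)) -> x = 0.
Proof.
move=> t0 mt h; apply/eqP/negPn/negP => x0.
have := h _ (mulf_neq0 x0 t0); rewrite invfM mulrA mulfV // mul1r.
exact: not_val_inv.
Qed.

Lemma val_horner_diff (q : {poly K}) x y a : poly_in V q -> V x -> V y ->
  V ((x - y) / a) -> V ((q.[x] - q.[y]) / a).
Proof.
move=> hq Vx Vy h; rewrite !horner_coef -sumrB mulr_suml; apply: (valsum VP) => // i _.
rewrite -mulrBr subrXX -mulrA; apply: (valM VP) => //.
rewrite mulrAC; apply: (valM VP) => //; apply: (valsum VP) => // j _.
by apply: (valM VP) => //; apply: (valX VP).
Qed.

Lemma denominator (r : seq K) :
  exists b, [/\ b != 0, V b & forall z, z \in r -> V (b * z)].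
Proof.
elim: r => [|z r [b [b0 Vb hb]]]; first by exists 1; split; rewrite ?oner_neq0 //; apply: (val1 VP).
have [Vz|Vz] := val_total VP z.
  exists b; split=> // z'; rewrite inE => /orP[/eqP -> | /hb //]; exact: (valM VP).
have [z0|z0] := eqVneq z 0.
  exists b; split=> // z'; rewrite inE => /orP[/eqP -> | /hb //].
  by rewrite z0 mulr0; apply: (val0 VP).
exists (b * z^-1); split; [by rewrite mulf_neq0 ?invr_eq0 | exact: (valM VP)|].
move=> z'; rewrite inE => /orP[/eqP -> | /hb h]; first by rewrite mulfVK.
by rewrite mulrAC; apply: (valM VP).
Qed.

Lemma min_precision (c1 c2 : K) : c1 != 0 -> c2 != 0 ->
  exists c, [/\ c != 0, V (c / c1) & V (c / c2)].
Proof.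
move=> n1 n2; have [h|h] := val_total VP (c1 / c2).
  by exists c1; split=> //; rewrite mulfV //; apply: (val1 VP).
by exists c2; split=> //; [rewrite -invf_div | rewrite mulfV //; apply: (val1 VP)].
Qed.

End ValuationTopology.

Section Completion.
Variables (K0 : fieldType) (V0 : set K0) (K : completion V0).
Hypotheses (V0P : is_place setT V0) (V0r : rank_one V0) (cl0 : alg_closed K0).
Notation V := (@compl_ring _ _ K).
Notation em := (compl_emb K).
Notation m := (maximal_ideal (@compl_ring _ _ K)).

Let VP : is_place setT V := compl_ringP K.

Lemma compl_mideal x : m (em x) <-> maximal_ideal V0 x.
Proof.
have e y : V (em y) <-> V0 y := compl_embP K y.
split=> -[/e Vx h]; split=> //; case: h => [|nV].
- by move/eqP; rewrite fmorph_eq0 => /eqP h; left.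
- by right=> Vi; apply: nV; rewrite -fmorphV; apply/e.
- by move=> ->; rewrite rmorph0; left.
- by right; rewrite -fmorphV => /e.
Qed.

Lemma small_elt : exists2 t : K, t != 0 & m t.
Proof.
have [x nVx] : exists x, ~ V0 x.
  have [_ _ _ nT] := V0P; apply: contrapT => no; apply: nT.
  by rewrite eqEsubset; split=> // x _; apply: contrapT => nV; apply: no; exists x.
exists (em x^-1); last exact/compl_mideal/mideal_inv.
rewrite fmorph_eq0 invr_eq0; apply/eqP => x0; apply: nVx; rewrite x0; exact: val0.
Qed.

(** An approximation of a to within a t, with t small, has the same valuation as a. *)
Lemma dense_unit a : a != 0 -> exists y, [/\ em y != 0, V (a / em y) & V (em y / a)].
Proof.
move=> a0; have [t t0 mt] := small_elt.
have [y hy] := compl_dense a (mulf_neq0 a0 t0); exists y.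
set v := _ / (a * t) in hy; have mv : m (- (t * v)) by apply/midealN => //; apply: midealM.
have ey : em y = a * (1 - t * v) by rewrite /v; field; rewrite a0 t0.
have y0 : em y != 0.
  rewrite ey mulf_neq0 //; apply/eqP => e; apply: (mideal1 VP).
  have -> : 1 = - (- (t * v)) by apply/eqP; rewrite -subr_eq0 opprK e.
  exact: midealN.
split=> //; first by rewrite ey invfM mulrA mulfV // mul1r; apply: val_unit1.
by rewrite ey mulrAC mulfV // mul1r; apply: valB => //; [exact: val1 | apply: valM => //; case: mt].
Qed.

Lemma compl_rank_one : rank_one V.
Proof.
move=> a x a0 mx; have [x0|x0] := eqVneq x 0.
  by exists 1; rewrite x0 expr1 mul0r; apply: val0.
have [y [y0 ay ya]] := dense_unit a0; have [z [z0 xz zx]] := dense_unit x0.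
have mz : maximal_ideal V0 z.
  apply/compl_mideal; have -> : em z = x * (em z / x) by rewrite mulrCA mulfV // mulr1.
  exact: midealM.
have y00 : y != 0 by rewrite -(fmorph_eq0 em).
have [N hN] := V0r y00 mz; exists N.
have -> : x ^+ N / a = (x / em z) ^+ N * (em (z ^+ N / y)) * (em y / a).
  rewrite rmorphM fmorphV rmorphXn expr_div_n /=; move: (expf_neq0 N z0).
  by move: (x ^+ N) (em z ^+ N) => X Z Z0; field; rewrite a0 y0.
by apply: valM => //; apply: valM => //; [apply: valX | apply/compl_embP].
Qed.

Lemma cauchy_limit (r : nat -> K) : cauchy V r -> exists x, limit V r x.
Proof.
move=> cau; pose U := [set A : set K | exists N0, forall N, (N0 <= N)%N -> A (r N)].
have UF : ProperFilter U.
  split; first by move=> [N0 /(_ N0 (leqnn _))].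
  split.
  - by exists 0.
  - move=> A B [N hN] [M hM]; exists (maxn N M) => n; rewrite geq_max => /andP[h1 h2].
    by split; [apply: hN | apply: hM].
  - by move=> A B AB [N hN]; exists N => n /hN/AB.
have [|x hx] := @compl_complete _ _ K U UF.
  move=> a a0; have [N0 hN] := cau a a0; exists (r N0), N0 => N le /=.
  rewrite -(subnK le); elim: (N - N0)%N => [|n IH].
    by rewrite add0n subrr mul0r; apply: val0.
  rewrite addSn -[_ - _](subrKA (r (n + N0)%N)) mulrDl; apply: valD => //.
  by apply: hN; apply: leq_addl.
by exists x => a a0; have [N0 h] := hx a a0; exists N0.
Qed.

(** Continuity of roots: G is approximated modulo t^N by polynomials f N over K0, which split. As f
    N.+1 is small at a root of f N, one of its own roots is nearby; the roots so chosen converge to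
    a root of G. *)
Lemma monic_integral_root (G : {poly K}) : G \is monic -> size G != 1%N -> poly_in V G ->
  exists x, root G x.
Proof.
move=> mon sG hG; have [t t0 mt] := small_elt; have Vt := mideal_val mt.
pose n := (size G).-1.
have sGn : size G = n.+1 by rewrite prednK // size_poly_gt0 monic_neq0.
have n0 : (0 < n)%N by move: sG; rewrite sGn; case: (n).
have VtN N : V (t ^+ N) by apply: valX.
have app N : exists f : {poly K0}, [/\ f \is monic, size f = n.+1 &
    forall i, V ((G`_i - em f`_i) / t ^+ N)].
  have /choice[c hc] : forall i, exists y, V ((G`_i - em y) / t ^+ N).
    by move=> i; apply: compl_dense; apply: expf_neq0.
  pose g := \poly_(i < n) c i.
  have sg : (size g <= n)%N by apply: size_poly.
  have eX : 'X^n + g = 'X^n + g by [].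
  have sf : size ('X^n + g) = n.+1 by rewrite size_polyDl ?size_polyXn ?ltnS.
  exists ('X^n + g); split=> //.
    by rewrite monicE lead_coefE sf /= coefD coefXn eqxx nth_default // addr0.
  move=> i; rewrite coefD coefXn coef_poly; have [lt|ge] := ltnP i n.
    by rewrite ltn_eqF // add0r.
  rewrite addr0; have [->|ne] := eqVneq i n.
    have -> : G`_n = 1 by rewrite -(monicP mon) lead_coefE.
    by rewrite rmorph1 subrr mul0r; apply: val0.
  rewrite nth_default ?sGn; last by rewrite ltn_neqAle eq_sym ne.
  by rewrite rmorph0 subrr mul0r; apply: val0.
have {app}/choice[f fP] := app.
have fV N i : V (em (f N)`_i).
  have [_ _ /(_ i) h] := fP N.
  have -> : em (f N)`_i = G`_i - (G`_i - em (f N)`_i) / t ^+ N * t ^+ N.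
    by rewrite divfK ?expf_neq0 // opprB addrCA subrr addr0.
  by apply: valB => //; apply: valM.
have fVp N : poly_in V (map_poly em (f N)) by move=> i; rewrite coef_map; apply: fV.
have rV N y : root (f N) y -> V (em y).
  move=> ry; apply: (val_integral VP (q := map_poly em (f N))) => //.
    by rewrite map_monic; case: (fP N).
  by rewrite rmorph_root.
have step N y : exists y', root (f N) y ->
    root (f N.+1) y' /\ V ((em y' - em y) ^+ n / t ^+ N).
  have [ry|nr] := boolP (root (f N) y); last by exists 0.
  have [mon' s' h'] := fP N.+1; have [_ _ h] := fP N.
  have [rs ers] := poly_splits cl0 (monic_neq0 mon').
  rewrite (monicP mon') scale1r in ers.
  have srs : size rs = n by apply: succn_inj; rewrite -s' ers size_prod_XsubC.
  have Vy := rV _ _ ry.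
  have Vprod : V ((\prod_(s <- rs) (em y - em s)) / t ^+ N).
    have -> : \prod_(s <- rs) (em y - em s) = (map_poly em (f N.+1)).[em y].
      rewrite horner_map /= ers horner_prod rmorph_prod; apply: eq_bigr => s _.
      by rewrite hornerXsubC rmorphB.
    have -> : (map_poly em (f N.+1)).[em y] = (map_poly em (f N.+1) - map_poly em (f N)).[em y].
      by rewrite hornerD hornerN [X in _ - X]horner_map /= (rootP ry) rmorph0 subr0.
    rewrite horner_coef mulr_suml; apply: valsum => // i _.
    rewrite mulrAC; apply: valM => //; last exact: valX.
    rewrite coefB !coef_map /=.
    have -> : (em (f N.+1)`_i - em (f N)`_i) / t ^+ N =
        (G`_i - em (f N)`_i) / t ^+ N - (G`_i - em (f N.+1)`_i) / t ^+ N.+1 * t.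
      by rewrite exprSr; have := expf_neq0 N t0; move: (t ^+ N) => T T0; field; rewrite t0 T0.
    by apply: valB => //; apply: valM.
  suff [s srs' hs] : exists2 s, s \in rs & V ((em y - em s) ^+ n / t ^+ N).
    exists s => _; split; first by rewrite ers root_prod_XsubC.
    rewrite -opprB exprNn -mulrA; apply: (valM VP) => //; apply: (valX VP); apply: (valN VP).
    exact: (val1 VP).
  (* If no factor em y - em s had its n-th power in t^N V, the n-th power of their product could not
     lie in t^(N n) V. *)
  apply: contrapT => no.
  have ms s : s \in rs -> m (t ^+ N / (em y - em s) ^+ n).
    move=> hs; rewrite -invf_div; apply: mideal_inv => // h1; apply: no; by exists s.
  have ne0 s : s \in rs -> em y - em s != 0.
    move=> hs; apply/eqP => e; apply: no; exists s => //.
    by rewrite e expr0n eqn0Ngt n0 mul0r; apply: val0.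
  apply: (mideal1 VP).
  have -> : 1 = (\prod_(s <- rs) (t ^+ N / (em y - em s) ^+ n)) *
      ((\prod_(s <- rs) (em y - em s)) / t ^+ N) ^+ n.
    rewrite big_split /= prodfV.
    have -> : \prod_(s <- rs) (em y - em s) ^+ n = (\prod_(s <- rs) (em y - em s)) ^+ n.
      by rewrite prodrXl.
    have -> : \prod_(s <- rs) t ^+ N = (t ^+ N) ^+ n.
      by rewrite big_const_seq count_predT iter_mulr_1 srs.
    have p0 : \prod_(s <- rs) (em y - em s) != 0.
      by rewrite prodf_seq_neq0; apply/allP => s /ne0.
    have tn0 : t ^+ N != 0 by apply: expf_neq0.
    move: (t ^+ N) (\prod_(s <- rs) (em y - em s)) p0 tn0 => A B B0 A0.
    by rewrite expr_div_n; field; rewrite !expf_neq0.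
  apply: (midealM VP); last exact: valX.
  case: rs srs ms {ers Vprod ne0 no} => [|s rs] srs ms; first by rewrite -srs in n0.
  rewrite big_cons; apply: (midealM VP); first by apply: ms; rewrite mem_head.
  rewrite big_seq; apply: (valprod VP) => z hz; apply: mideal_val; apply: ms.
  by rewrite inE hz orbT.
have /choice[st hst] : forall Ny : nat * K0, exists y', root (f Ny.1) Ny.2 ->
    root (f Ny.1.+1) y' /\ V ((em y' - em Ny.2) ^+ n / t ^+ Ny.1).
  by move=> [N y]; apply: step.
have [y0 ry0] : exists y, root (f 0) y.
  by apply: cl0; have [_ -> _] := fP 0; rewrite eqSS -lt0n.
pose r := fix r N := if N is N'.+1 then st (N', r N') else y0.
have rr N : root (f N) (r N) by elim: N => //= N /(hst (N, _))[].
have rs N := (hst (N, r N) (rr N)).2.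
have [x hx] : exists x, limit V (fun N => em (r N)) x.
  apply: cauchy_limit => a a0; have [N0 hN] := small_pow VP compl_rank_one (expf_neq0 n a0) mt.
  exists N0 => N le; apply: (val_root VP n0); rewrite expr_div_n.
  by apply: (val_trans VP _ (rs N) (hN _ le)); apply: expf_neq0.
have Vr N : V (em (r N)) := rV _ _ (rr N).
have Vx : V x.
  have [N0 /(_ N0 (leqnn _))] := hx 1 (oner_neq0 _); rewrite divr1 => h.
  by rewrite -[x](subKr (em (r N0))); apply: (valB VP).
exists x; apply/rootP/(separated t0 mt) => a a0.
have [N1 h1] := hx a a0; have [N2 h2] := small_pow VP compl_rank_one a0 mt.
pose N := maxn N1 N2; have {}h1 := h1 N (leq_maxl _ _); have {}h2 := h2 N (leq_maxr _ _).
have -> : G.[x] = (G.[x] - G.[em (r N)]) + (G - map_poly em (f N)).[em (r N)].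
  rewrite hornerD hornerN [X in _ + (_ - X)]horner_map /= (rootP (rr N)) rmorph0.
  by rewrite subr0 subrK.
rewrite mulrDl; apply: (valD VP).
  by apply: (val_horner_diff VP) => //; rewrite -opprB mulNr; apply: (valN VP).
rewrite horner_coef mulr_suml; apply: (valsum VP) => i _; rewrite mulrAC.
apply: (valM VP); last exact: valX.
rewrite coefB coef_map; have [_ _ /(_ i) h] := fP N.
by apply: (val_trans VP _ h h2); apply: expf_neq0.
Qed.

Lemma compl_alg_closed : alg_closed K.
Proof.
move=> q sq; have [->|q0] := eqVneq q 0; first by exists 0; rewrite root0.
have lc0 : lead_coef q != 0 by rewrite lead_coef_eq0.
have sqn : size q = (size q).-1.+1 by rewrite prednK // size_poly_gt0.
have n0 : (0 < (size q).-1)%N by move: sq; rewrite sqn; case: _.-1.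
have [b [b0 Vb hb]] := denominator VP [seq z / lead_coef q | z <- q].
(* Multiplying the roots of q by b makes the monic polynomial integral; a root z of it gives the
   root z / b of q. *)
pose n := (size q).-1; pose g := \poly_(i < n) (q`_i / lead_coef q * b ^+ (n - i)).
have sg : size ('X^n + g) = n.+1 by rewrite size_polyDl ?size_polyXn // ltnS size_poly.
have [||| z rz] := @monic_integral_root ('X^n + g).
- by rewrite monicE lead_coefE sg /= coefD coefXn eqxx nth_default ?size_poly // addr0.
- by rewrite sg eqSS -lt0n.
- move=> i; rewrite coefD coefXn coef_poly; have [lt|ge] := ltnP i n.
    rewrite ltn_eqF // add0r -[(n - i)%N]prednK ?subn_gt0 // exprS mulrA [_ * b]mulrC.
    apply: (valM VP); last exact: (valX VP).
    apply: hb; apply: map_f; apply: mem_nth; rewrite sqn ltnS; exact: ltnW.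
  by rewrite addr0; exact: (val_nat VP).
exists (z / b); have nb : b ^+ n / lead_coef q != 0 by rewrite mulf_neq0 ?expf_neq0 ?invr_eq0.
apply/rootP; apply: (mulfI nb); rewrite mulr0 -(rootP rz) hornerD hornerXn horner_poly.
rewrite horner_coef sqn big_ord_recr /= -lead_coefE mulrDr addrC -/n; congr (_ + _).
  by rewrite expr_div_n; field; rewrite lc0 expf_neq0.
rewrite mulr_sumr; apply: eq_bigr => -[i /= lt] _.
rewrite -{1}(subnK (ltnW lt)) exprD expr_div_n.
by move: (expf_neq0 i b0) => bi0; field; rewrite lc0 bi0.
Qed.

End Completion.

Lemma eventually_all (P : nat -> nat -> Prop) n :
  (forall i, exists N0, forall N, (N0 <= N)%N -> P i N) ->
  exists N0, forall N, (N0 <= N)%N -> forall i, (i < n)%N -> P i N.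
Proof.
move=> h; elim: n => [|n [N0 IH]]; first by exists 0.
have [N1 h1] := h n; exists (maxn N0 N1) => N; rewrite geq_max => /andP[l0 l1] i.
by rewrite ltnS leq_eqVlt => /orP[/eqP -> | /IH]; [exact: h1 | apply].
Qed.

(** * Algebraic extensions of a closed subfield *)

Section ClosedSubfield.
Variables (K : fieldType) (V : set K).
Hypotheses (VP : is_place setT V) (V1 : rank_one V) (cl : alg_closed K).
Hypothesis complete : forall r, cauchy V r -> exists x, limit V r x.
Variables (k : set K) (t : K).
Hypotheses (sk : divring_closed [in k]) (t0 : t != 0) (mt : maximal_ideal V t) (kt : k t).
Hypothesis kc : forall r x, (forall N, k (r N)) -> limit V r x -> k x.
Notation m := (maximal_ideal V).
Notation G := (galois_group (algcl k) k).

Let tn0 n : t ^+ n != 0. Proof. exact: expf_neq0. Qed.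
Let ktn n : k (t ^+ n). Proof. exact: subX. Qed.
Let Vtn n : V (t ^+ n). Proof. by apply: (valX VP); case: mt. Qed.

Lemma limit_unique r x y : limit V r x -> limit V r y -> x = y.
Proof.
move=> hx hy; apply/eqP; rewrite -subr_eq0; apply/eqP/(separated t0 mt) => a a0.
have [N1 h1] := hx a a0; have [N2 h2] := hy a a0; pose N := maxn N1 N2.
have -> : (x - y) / a = (r N - y) / a - (r N - x) / a by field.
by apply: (valB VP); [apply: h2; apply: leq_maxr | apply: h1; apply: leq_maxl].
Qed.

Definition free_powers n x :=
  forall g, poly_in k g -> (size g <= n)%N -> g.[x] = 0 -> g = 0.

(** Continuity of the coordinates on the span of 1, ..., x^(n-1): divisibility by t^M of a value
    forces integral coefficients. *)
Definition bounded_coefs n x M :=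
  forall g, poly_in k g -> (size g <= n)%N -> V (g.[x] / t ^+ M) -> poly_in V g.

Lemma bounded_coefs_scale n x M g N : bounded_coefs n x M ->
  poly_in k g -> (size g <= n)%N -> V (g.[x] / t ^+ (M + N)) -> forall i, V (g`_i / t ^+ N).
Proof.
move=> bc kg sg h i; rewrite mulrC -coefZ; apply: bc.
- by move=> j; rewrite coefZ; apply: (subM sk) => //; apply: (subV sk).
- by rewrite (leq_trans (size_scale_leq _ _)).
- by rewrite hornerZ mulrC mulrA -invfM -exprD mulrC.
Qed.

(** Bounded coordinates of a Cauchy sequence are Cauchy, so the span of the powers is complete. *)
Lemma limit_horner n x M (g : nat -> {poly K}) : bounded_coefs n x M ->
  (forall N, poly_in k (g N) /\ (size (g N) <= n)%N) -> cauchy V (fun N => (g N).[x]) ->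
  exists h, [/\ poly_in k h, (size h <= n)%N & limit V (fun N => (g N).[x]) h.[x]].
Proof.
move=> bc hg cau.
have /choice[c hc] : forall i, exists y, limit V (fun N => (g N)`_i) y.
  move=> i; apply: complete => a a0.
  have [A hA] := small_pow VP V1 a0 mt; have [N0 h0] := cau _ (tn0 (M + A)).
  exists N0 => N le; apply: (val_trans VP (tn0 A)); last exact: hA.
  have [kg sg] := hg N; have [kg' sg'] := hg N.+1.
  rewrite -coefB; apply: (bounded_coefs_scale bc).
  - by move=> j; rewrite coefB; apply: (subB sk).
  - by rewrite (leq_trans (size_polyD _ _)) // geq_max size_polyN sg'.
  - by rewrite hornerD hornerN; apply: h0.
have kc' i : k (c i).
  by apply: kc (hc i) => N; have [] := hg N.
exists (\poly_(i < n) c i); split; last 2 first.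
- exact: size_poly.
- move=> a a0; have [b [b0 _ hb]] := denominator VP [seq x ^+ i | i <- iota 0 n].
  have ab0 : a * b != 0 by rewrite mulf_neq0.
  have [N0 h] := @eventually_all (fun i N => V (((g N)`_i - c i) / (a * b))) n
    (fun i => hc i _ ab0).
  exists N0 => N le; have [_ sg] := hg N.
  rewrite (horner_coef_wide _ sg) horner_poly -sumrB mulr_suml; apply: (valsum VP) => i _.
  have -> : ((g N)`_i * x ^+ i - c i * x ^+ i) / a = ((g N)`_i - c i) / (a * b) * (b * x ^+ i).
    by field; rewrite a0 b0.
  apply: (valM VP); first exact: h.
  by apply: hb; apply: map_f; rewrite mem_iota /=.
by move=> i; rewrite coef_poly; case: ifP => // _; apply: (sub0 sk).
Qed.

(** Equivalence of norms in finite dimension. The span of the lower powers is complete, so x^n, not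
    being in it, stays at a positive distance; this bounds the top coefficient, and the induction
    bounds the others. *)
Lemma free_powers_bounded n x : free_powers n x -> exists M, bounded_coefs n x M.
Proof.
elim: n => [|n IH] fr.
  exists 0 => g _; rewrite leqn0 size_poly_eq0 => /eqP -> _ i.
  by rewrite coef0; apply: (val0 VP).
have [|M bc] := IH; first by move=> g kg sg; apply: fr => //; rewrite leqW.
have [N0 far] : exists N0, forall h, poly_in k h -> (size h <= n)%N ->
    ~ V ((h.[x] + x ^+ n) / t ^+ N0).
  apply: contrapT => no.
  have /choice[g hg] : forall N, exists h, [/\ poly_in k h, (size h <= n)%N &
      V ((h.[x] + x ^+ n) / t ^+ N)].
    move=> N; apply: contrapT => no'; apply: no; exists N => h kh sh Vh.
    by apply: no'; exists h.
  have lim : limit V (fun N => (g N).[x]) (- x ^+ n).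
    move=> a a0; have [A hA] := small_pow VP V1 a0 mt; exists A => N le.
    rewrite opprK; have [_ _ h] := hg N; exact: val_trans h (hA _ le).
  have [||h [kh sh lim']] := limit_horner (g := g) bc.
  - by move=> N; have [] := hg N.
  - move=> a a0; have [A hA] := lim a a0; exists A => N le.
    have -> : ((g N.+1).[x] - (g N).[x]) / a =
      ((g N.+1).[x] - - x ^+ n) / a - ((g N).[x] - - x ^+ n) / a by field.
    by apply: (valB VP); apply: hA => //; rewrite leqW.
  have e := limit_unique lim' lim.
  have sz : size ('X^n + h) = n.+1 by rewrite size_polyDl ?size_polyXn ?ltnS.
  suff : 'X^n + h = 0 by move=> e0; move: sz; rewrite e0 size_poly0.
  apply: fr; rewrite ?sz //; last by rewrite hornerD hornerXn e subrr.
  move=> i; rewrite coefD coefXn; apply: (subD sk) => //.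
  by case: eqP => _; [apply: (sub1 sk) | apply: (sub0 sk)].
have [A hA] : exists A, V (t ^+ A * x ^+ n).
  have [b [b0 _ hb]] := denominator VP [:: x ^+ n].
  have [A h] := small_pow VP V1 b0 mt; exists A.
  have -> : t ^+ A * x ^+ n = t ^+ A / b * (b * x ^+ n) by field.
  by apply: (valM VP); [apply: h | apply: hb; rewrite mem_head].
(* N0 measures the distance of x^n from the lower powers, A makes t^A x^n integral, and M is the
   bound for the lower powers. *)
exists (M + A + N0)%N => g kg sg Vg.
pose a := g`_n; pose h := \poly_(i < n) g`_i.
have kh : poly_in k h by move=> i; rewrite coef_poly; case: ifP => // _; apply: (sub0 sk).
have sh : (size h <= n)%N by apply: size_poly.
have eg : g.[x] = h.[x] + a * x ^+ n.
  by rewrite (horner_coef_wide _ sg) big_ord_recr /= horner_poly.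
have Va : V (a / t ^+ (M + A)).
  apply: contrapT => nV; have a0 : a != 0.
    by apply/eqP => a0; apply: nV; rewrite a0 mul0r; apply: (val0 VP).
  apply: (far (a^-1 *: h)).
  - by move=> i; rewrite coefZ; apply: (subM sk) => //; apply: (subV sk); apply: kg.
  - by rewrite (leq_trans (size_scale_leq _ _)).
  have -> : ((a^-1 *: h).[x] + x ^+ n) / t ^+ N0 =
      g.[x] / t ^+ (M + A + N0) * (a / t ^+ (M + A))^-1.
    rewrite hornerZ eg exprD; move: (tn0 (M + A)) (tn0 N0) a0.
    by move: (t ^+ _) (t ^+ _) => T1 T2 T10 T20 a0; field; rewrite a0 T10 T20.
  by apply: (valM VP) => //; case: (mideal_inv VP nV).
have Vh : poly_in V h.
  apply: bc => //.
  have -> : h.[x] / t ^+ M = g.[x] / t ^+ (M + A + N0) * (t ^+ A * t ^+ N0)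
      - a / t ^+ (M + A) * (t ^+ A * x ^+ n).
    rewrite eg !exprD; move: (tn0 M) (tn0 A) (tn0 N0).
    move: (t ^+ M) (t ^+ A) (t ^+ N0) => T1 T2 T3 T10 T20 T30.
    by field; rewrite T10 T20 T30.
  by apply: (valB VP); apply: (valM VP) => //; apply: (valM VP).
move=> i; have [lt|ge] := ltnP i n; first by have := Vh i; rewrite coef_poly lt.
have [->|ne] := eqVneq i n; last first.
  by rewrite nth_default ?(leq_trans sg) ?ltn_neqAle 1?eq_sym ?ne //; apply: (val0 VP).
have -> : g`_n = a / t ^+ (M + A) * t ^+ (M + A) by rewrite divfK.
exact: (valM VP).
Qed.

Lemma power_basis x : algcl k x -> exists n, free_powers n x /\
  forall g, poly_in k g -> exists h, [/\ poly_in k h, (size h <= n)%N & g.[x] = h.[x]].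
Proof.
move=> ax; have [S [io ioE]] := subfield_type sk.
have [q [mon irr rq qd]] := minpoly ioE ax; have q0 := monic_neq0 mon.
have sq : size q = (size q).-1.+1 by rewrite prednK // size_poly_gt0.
exists (size q).-1; split.
  move=> _ /(poly_in_lift ioE)[g <-] sg /rootP/qd/dvdp_leq le.
  have [->|/le le'] := eqVneq g 0; first by rewrite map_poly0.
  by move: sg; rewrite size_map_poly => /(leq_trans le'); rewrite {1}sq ltnn.
move=> _ /(poly_in_lift ioE)[g <-]; exists (map_poly io (g %% q)); split.
- exact: poly_in_map.
- by rewrite size_map_poly -ltnS -sq ltn_modp.
- rewrite {1}(divp_eq g q) rmorphD rmorphM hornerD hornerM /= (rootP rq) mulr0 add0r //.
Qed.

Lemma adjoin_limit x r y : algcl k x -> (forall N, adjoin k x (r N)) -> limit V r y ->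
  adjoin k x y.
Proof.
move=> ax hr lim; have [n [fr red]] := power_basis ax.
have [M bc] := free_powers_bounded fr.
have /choice[g hg] : forall N, exists h, [/\ poly_in k h, (size h <= n)%N & r N = h.[x]].
  by move=> N; have [g kg ->] := hr N; apply: red.
have [||h [kh sh lim']] := limit_horner (g := g) bc.
- by move=> N; have [] := hg N.
- move=> a a0; have [A hA] := lim a a0; exists A => N le.
  have [_ _ <-] := hg N; have [_ _ <-] := hg N.+1.
  have -> : (r N.+1 - r N) / a = (r N.+1 - y) / a - (r N - y) / a by field.
  by apply: (valB VP); apply: hA => //; rewrite leqW.
exists h => //; apply: limit_unique lim' => a a0; have [A hA] := lim a a0; exists A => N le.
by have [_ _ <-] := hg N; apply: hA.
Qed.

(** In the power basis all x^e have coefficients bounded by t^-M, independently of e. Applying s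
    bounds every power of y = s x by t^-M y^n, which rank one forbids if y is not integral. *)
Lemma gal_val_imp s x : G s -> algcl k x -> V x -> V (s x).
Proof.
move=> Gs ax Vx; have [n [fr red]] := power_basis ax.
have [M bc] := free_powers_bounded fr; apply: contrapT => nV.
have mi := mideal_inv VP nV; set y := s x in nV mi.
have y0 : y != 0 by apply/eqP => y0; apply: nV; rewrite y0; apply: (val0 VP).
have aux i : (i <= n)%N -> y ^+ i / y ^+ n = y^-1 ^+ (n - i).
  move=> le; rewrite -{1}(subnK le) exprD exprVn.
  by move: (expf_neq0 i y0) (expf_neq0 (n - i)%N y0); move: (y ^+ i) (y ^+ (n - i)%N) => A A' A0 B0; field; rewrite A0 B0.
have key e : V (t ^+ M * y ^+ e / y ^+ n).
  have [|h [kh sh eh]] := red 'X^e.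
    by move=> i; rewrite coefXn; case: eqP => _; [apply: (sub1 sk) | apply: (sub0 sk)].
  have kh' : poly_in k (t ^+ M *: h) by move=> i; rewrite coefZ; apply: (subM sk).
  have sh' : (size (t ^+ M *: h)%R <= n)%N by rewrite (leq_trans (size_scale_leq _ _)).
  have Vh : poly_in V (t ^+ M *: h).
    by apply: bc => //; rewrite hornerZ -eh hornerXn mulrAC mulfV // mul1r; apply: (valX VP).
  have -> : t ^+ M * y ^+ e = (t ^+ M *: h).[y].
    rewrite hornerZ -(gal_horner sk Gs kh ax) -eh hornerXn.
    by rewrite (phomX (algcl_subfield sk) (gal_phom sk Gs)).
  rewrite (horner_coef_wide _ sh') mulr_suml; apply: (valsum VP) => i _.
  rewrite -mulrA; apply: (valM VP) => //.
  rewrite (aux _ (ltnW (ltn_ord i))).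
  by apply: (valX VP); case: mi.
have [e he] := V1 (mulf_neq0 (tn0 M) t0) mi.
apply: (not_val_inv t0 mt).
have -> : t^-1 = y^-1 ^+ e / (t ^+ M * t) * (t ^+ M * y ^+ (e + n) / y ^+ n).
  rewrite exprD exprVn; move: (expf_neq0 e y0) (expf_neq0 n y0) (tn0 M).
  move: (y ^+ e) (y ^+ n) (t ^+ M) => A B C A0 B0 C0; field.
  by rewrite A0 B0 C0 t0.
exact: (valM VP).
Qed.

Lemma gal_val s x : G s -> algcl k x -> V (s x) <-> V x.
Proof.
move=> Gs ax; split; last exact: gal_val_imp.
have [u [Gu _ us]] := gal_inv sk Gs => h.
by rewrite -[x]/(id x) -us /=; apply: gal_val_imp => //; apply: gal_in.
Qed.

Lemma gal_mideal s x : G s -> algcl k x -> m (s x) <-> m x.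
Proof.
move=> Gs ax; have sB := algcl_subfield sk; have fP := gal_phom sk Gs.
have e : V (s x)^-1 <-> V x^-1.
  by rewrite -(phomV sB fP ax); apply: gal_val => //; apply: (subV sB).
split=> -[/(gal_val Gs ax) Vx h]; split=> //; case: h => h.
- by left; apply/eqP; rewrite -(phom_eq0 sB fP ax) h.
- by right=> /e.
- by left; rewrite h (phom0 sB fP).
- by right=> /e.
Qed.

(** Let y be closer to x than any other root of q. An automorphism fixing y preserves V, so it moves
    x by less than the distance to the other roots. *)
Lemma krasner (M : set K) x : algcl k x -> M `<=` algcl k ->
  (forall a, a != 0 -> exists2 y, M y & V ((x - y) / a)) ->
  exists2 y, M y & forall s, G s -> s y = y -> s x = x.
Proof.
move=> ax Mk app; have [q [q0 hq rx]] := ax; have [rs hrs] := finite_roots cl q0.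
(* b bounds the inverses of the differences r - x; the root x itself contributes the inverse of 0,
   which is 0. *)
have [b [b0 _ hb]] := denominator VP [seq (r - x)^-1 | r <- rs].
have [N hN] := V1 (mulf_neq0 b0 t0) mt.
have [y My hy] := app _ (tn0 N); exists y => // s Gs sy.
have sB := algcl_subfield sk; have fP := gal_phom sk Gs; have ay := Mk _ My.
have axy := subB sB ax ay.
have hs : V ((s x - x) / t ^+ N).
  have -> : (s x - x) / t ^+ N = s ((x - y) / t ^+ N) - (x - y) / t ^+ N.
    rewrite (phomdiv sB fP axy (sub_algcl sk (ktn N))) (phomB sB fP ax ay) sy.
    by rewrite (gal_fix Gs (ktn N)); field.
  apply: (valB VP) => //; apply/gal_val => //; apply: (subdiv sB) => //.
  exact: (sub_algcl sk).
apply/eqP; rewrite -subr_eq0; apply/negPn/negP => ne.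
apply: (not_val_inv t0 mt).
have -> : t^-1 = (s x - x) / t ^+ N * (t ^+ N / (b * t)) * (b / (s x - x)).
  by move: (tn0 N); move: (t ^+ N) (s x - x) ne => T d d0 T0; field; rewrite d0 t0 b0 T0.
apply: (valM VP); first exact: (valM VP).
apply: hb; apply: (map_f (fun r => (r - x)^-1)); apply/hrs; exact: (gal_root sk Gs hq ax rx).
Qed.

End ClosedSubfield.

Section ClosureInCompletion.
Variables (K0 : fieldType) (V0 : set K0) (K : completion V0).
Hypotheses (V0P : is_place setT V0).
Notation V := (@compl_ring _ _ K).
Notation em := (compl_emb K).
Notation m := (maximal_ideal (@compl_ring _ _ K)).
Let VP : is_place setT V := compl_ringP K.

Variable L : set K0.
Hypothesis sL : divring_closed [in L].

(* [local_field] of an arbitrary completion *)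
Definition closure_of : set K :=
  [set x | forall a, a != 0 -> exists2 y, L y & V ((x - em y) / a)].

Lemma closure_emb y : L y -> closure_of (em y).
Proof. by move=> Ly a a0; exists y => //; rewrite subrr mul0r; apply: (val0 VP). Qed.

Lemma closure_limit r x : (forall N, closure_of (r N)) -> limit V r x -> closure_of x.
Proof.
move=> hr lim a a0; have [N h] := lim a a0; have [y Ly hy] := hr N a a0; exists y => //.
have -> : (x - em y) / a = (r N - em y) / a - (r N - x) / a by field.
by apply: (valB VP) => //; apply: h.
Qed.

Lemma closure_subfield : divring_closed [in closure_of].
Proof.
have mulc x y : closure_of x -> closure_of y -> closure_of (x * y).
  move=> hx hy a a0; have [b [b0 Vb hb]] := denominator VP [:: x; y].
  have ab0 : a * b != 0 by rewrite mulf_neq0.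
  have [x' Lx' hx'] := hx _ (mulf_neq0 a0 b0).
  have [c [c0 ca c1]] := min_precision VP ab0 (oner_neq0 K).
  have [y' Ly' hy'] := hy _ c0.
  exists (x' * y'); first exact: (subM sL).
  have Vby : V (b * em y').
    rewrite -[em y'](subKr y) mulrBr; apply: (valB VP).
      by apply: hb; rewrite !inE eqxx orbT.
    apply: (valM VP) => //; rewrite -[_ - _](divfK c0); apply: (valM VP) => //.
    by rewrite -[c]divr1.
  have -> : (x * y - em (x' * y')) / a =
      (x - em x') / (a * b) * (b * em y') + (b * x) * ((y - em y') / (a * b)).
    by rewrite rmorphM; field; rewrite a0 b0.
  apply: (valD VP); apply: (valM VP) => //; first by apply: hb; rewrite mem_head.
  exact: (val_trans VP c0).
have invc x : closure_of x -> closure_of x^-1.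
  have [->|x0] := eqVneq x 0; [by rewrite invr0 | move=> hx a a0].
  have [t tn mt] := small_elt K V0P.
  have xx : a * x ^+ 2 != 0 by rewrite mulf_neq0 ?expf_neq0.
  have [c [c0 c1 c2]] := min_precision VP xx (mulf_neq0 x0 tn).
  have [y Ly hy] := hx _ c0; exists y^-1; first exact: (subV sL).
  pose u := (x - em y) / x.
  have mu : m (- u).
    apply: (midealN VP); have -> : u = t * ((x - em y) / c * (c / (x * t))).
      by rewrite /u; field; rewrite x0 c0 tn.
    by apply: (midealM VP) => //; apply: (valM VP).
  have ey : em y = x * (1 + - u) by rewrite /u; field.
  have u0 : 1 + - u != 0.
    apply/eqP => e; apply: (mideal1 VP); have -> : 1 = - - u by apply/eqP; rewrite -addr_eq0 e.
    exact: (midealN VP).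
  have -> : (x^-1 - em y^-1) / a =
      - ((x - em y) / c) * (c / (a * x ^+ 2)) * (1 + - u)^-1.
    have e' : x - em y = x * u by rewrite /u mulrCA mulfV // mulr1.
    rewrite fmorphV e' ey; field; rewrite a0 c0 x0 -[1 - u]/(1 + - u) u0 //.
  apply: (valM VP); last exact: (val_unit1 VP).
  by apply: (valM VP) => //; apply: (valN VP).
split.
- by apply/mem_set; rewrite -(rmorph1 em); apply: closure_emb; apply: (sub1 sL).
- move=> x y /set_mem hx /set_mem hy; apply/mem_set => a a0.
  have [x' Lx' hx'] := hx a a0; have [y' Ly' hy'] := hy a a0.
  exists (x' - y'); first exact: (subB sL).
  have -> : (x - y - em (x' - y')) / a = (x - em x') / a - (y - em y') / a.
    by rewrite rmorphB; field.
  exact: (valB VP).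
- by move=> x y /set_mem hx /set_mem hy; apply/mem_set; apply: mulc => //; apply: invc.
Qed.

Lemma closure_small : (exists2 y, L y & y != 0 /\ maximal_ideal V0 y) ->
  exists2 t, closure_of t & t != 0 /\ m t.
Proof.
move=> [y Ly [y0 my]]; exists (em y); first exact: closure_emb.
by rewrite fmorph_eq0; split=> //; apply/compl_mideal.
Qed.

End ClosureInCompletion.

(** * Points near the origin *)

Section ChordTangent.
Variables (K : fieldType) (c1 c2 c3 c4 c6 : K).

(* The curve in the coordinates z = x/y, w = 1/y at infinity *)
Definition zw_eq (z w : K) := w + c1 * z * w + c3 * w ^+ 2
  - (z ^+ 3 + c2 * z ^+ 2 * w + c4 * z * w ^+ 2 + c6 * w ^+ 3).
(** The cofactor of w in the equation written as w u = z^3. Near the origin it is a unit, so w has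
    the size of z^3. *)
Definition zw_unit (z w : K) := 1 + (c1 * z + c3 * w - c2 * z ^+ 2 - c4 * z * w - c6 * w ^+ 2).
(** Subtracting the equations of two points gives (w1 - w2) slope_den = (z1 - z2) slope_num. As
    slope_den is a unit near the origin, one formula covers chords and tangents. *)
Definition slope_num (z1 w1 z2 w2 : K) := z1 ^+ 2 + z1 * z2 + z2 ^+ 2
  - c1 * w1 + c2 * w1 * (z1 + z2) + c4 * w1 ^+ 2.
Definition slope_den (z1 w1 z2 w2 : K) := 1 + (c1 * z2 + c3 * (w1 + w2) - c2 * z2 ^+ 2
  - c4 * z2 * (w1 + w2) - c6 * (w1 ^+ 2 + w1 * w2 + w2 ^+ 2)).
(* The chord through two points, or the tangent if they coincide *)
Definition slope z1 w1 z2 w2 := slope_num z1 w1 z2 w2 / slope_den z1 w1 z2 w2.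
(** On w = lam z + nu the equation is a cubic in z with leading coefficient -lead lam and
    coefficient quad lam nu of z^2, so its roots add up to quad / lead. *)
Definition lead (lam : K) := 1 + (c2 * lam + c4 * lam ^+ 2 + c6 * lam ^+ 3).
Definition quad (lam nu : K) := c1 * lam + c3 * lam ^+ 2 - c2 * nu
  - 2%:R * c4 * lam * nu - 3%:R * c6 * lam ^+ 2 * nu.
Definition third_z z1 w1 z2 w2 := let lam := slope z1 w1 z2 w2 in
  quad lam (w1 - lam * z1) / lead lam - z1 - z2.
Definition third_w z1 w1 z2 w2 := let lam := slope z1 w1 z2 w2 in
  lam * third_z z1 w1 z2 w2 + (w1 - lam * z1).
(** The opposite of (z, w) is (-z, -w) divided by this unit. *)
Definition opp_unit (z w : K) := 1 + (c1 * z + c3 * w).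
Definition sum_z z1 w1 z2 w2 := - third_z z1 w1 z2 w2 /
  opp_unit (third_z z1 w1 z2 w2) (third_w z1 w1 z2 w2).
Definition sum_w z1 w1 z2 w2 := - third_w z1 w1 z2 w2 /
  opp_unit (third_z z1 w1 z2 w2) (third_w z1 w1 z2 w2).

Lemma zw_unitE z w : zw_eq z w = 0 -> w * zw_unit z w = z ^+ 3.
Proof. by move=> e; apply: (linear_comb1 e); rewrite /zw_eq /zw_unit; ring. Qed.

Lemma vieta z1 w1 z2 w2 : zw_eq z1 w1 = 0 -> zw_eq z2 w2 = 0 ->
  slope_den z1 w1 z2 w2 != 0 -> lead (slope z1 w1 z2 w2) != 0 ->
  let lam := slope z1 w1 z2 w2 in let nu := w1 - lam * z1 in
  let z3 := third_z z1 w1 z2 w2 in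
  [/\ w2 = lam * z2 + nu,
      quad lam nu = lead lam * (z1 + z2 + z3),
      lam + c1 * nu + 2%:R * c3 * lam * nu - c4 * nu ^+ 2 - 3%:R * c6 * lam * nu ^+ 2
        = - lead lam * (z1 * z2 + z1 * z3 + z2 * z3) &
      nu + c3 * nu ^+ 2 - c6 * nu ^+ 3 = lead lam * (z1 * z2 * z3)].
Proof.
move=> e1 e2 B0 D0 lam nu z3.
have eA : lam * slope_den z1 w1 z2 w2 = slope_num z1 w1 z2 w2 by rewrite divfK.
have e3 : quad lam nu = lead lam * (z1 + z2 + z3).
  by rewrite /z3 /third_z -/lam -/nu; field.
have ew : w2 = lam * z2 + nu.
  apply/eqP; rewrite -subr_eq0; apply/eqP/(mulIf B0); rewrite mul0r.
  have : zw_eq z1 w1 - zw_eq z2 w2 = 0 by rewrite e1 e2 subrr.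
  move=> h; apply: (linear_comb1 (A := - (zw_eq z1 w1 - zw_eq z2 w2) +
    (z1 - z2) * (lam * slope_den z1 w1 z2 w2)) (B := 0 + (z1 - z2) * slope_num z1 w1 z2 w2)).
    by rewrite h eA oppr0.
  by rewrite /nu /zw_eq /slope_den /slope_num; ring.
have ew1 : w1 = lam * z1 + nu by rewrite /nu addrC subrK.
have e4 : lam + c1 * nu + 2%:R * c3 * lam * nu - c4 * nu ^+ 2 - 3%:R * c6 * lam * nu ^+ 2
    = - lead lam * (z1 * z2 + z1 * z3 + z2 * z3).
  apply: (linear_comb1 (A := lam * slope_den z1 w1 z2 w2 - (z1 + z2) * quad lam nu)
    (B := slope_num z1 w1 z2 w2 - (z1 + z2) * (lead lam * (z1 + z2 + z3)))).
    by rewrite eA e3.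
  rewrite {1}/quad /slope_den /slope_num ew1 ew /lead; ring.
split=> //.
apply: (linear_comb1 (A := zw_eq z1 w1 - z1 ^+ 2 * quad lam nu - z1 *
   (lam + c1 * nu + 2%:R * c3 * lam * nu - c4 * nu ^+ 2 - 3%:R * c6 * lam * nu ^+ 2))
  (B := 0 - z1 ^+ 2 * (lead lam * (z1 + z2 + z3)) + z1 * (lead lam * (z1 * z2 + z1 * z3 + z2 * z3)))).
  by rewrite e1 e3 e4; ring.
by rewrite /zw_eq ew1 /quad /lead; ring.
Qed.

(** This evaluates the cubic at the zero z = -nu / lam of w, cleared of denominators. It shows that
    the third w is nonzero when nu is. *)
Lemma third_w_neq0 lam nu z1 z2 z3 :
  quad lam nu = lead lam * (z1 + z2 + z3) ->
  lam + c1 * nu + 2%:R * c3 * lam * nu - c4 * nu ^+ 2 - 3%:R * c6 * lam * nu ^+ 2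
    = - lead lam * (z1 * z2 + z1 * z3 + z2 * z3) ->
  nu + c3 * nu ^+ 2 - c6 * nu ^+ 3 = lead lam * (z1 * z2 * z3) ->
  lead lam * ((lam * z1 + nu) * (lam * z2 + nu) * (lam * z3 + nu)) = nu ^+ 3.
Proof.
move=> r1 r2 r3; apply: (linear_comb1 (A := - lam * nu ^+ 2 * quad lam nu + lam ^+ 2 * nu *
    (lam + c1 * nu + 2%:R * c3 * lam * nu - c4 * nu ^+ 2 - 3%:R * c6 * lam * nu ^+ 2)
    - lam ^+ 3 * (nu + c3 * nu ^+ 2 - c6 * nu ^+ 3))
  (B := - lam * nu ^+ 2 * (lead lam * (z1 + z2 + z3))
    - lam ^+ 2 * nu * (lead lam * (z1 * z2 + z1 * z3 + z2 * z3))
    - lam ^+ 3 * (lead lam * (z1 * z2 * z3)))).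
  by rewrite r1 r2 r3; ring.
by rewrite /quad /lead; ring.
Qed.

(** With x = z/w and y = 1/w the line w = lam z + nu reads 1 = lam x + nu y, whence the slope
    -lam/nu and the constant 1/nu. *)
Lemma vieta_affine lam nu z1 z2 z3 : nu != 0 -> lead lam != 0 ->
  lam * z1 + nu != 0 -> lam * z2 + nu != 0 -> lam * z3 + nu != 0 ->
  quad lam nu = lead lam * (z1 + z2 + z3) ->
  lam + c1 * nu + 2%:R * c3 * lam * nu - c4 * nu ^+ 2 - 3%:R * c6 * lam * nu ^+ 2
    = - lead lam * (z1 * z2 + z1 * z3 + z2 * z3) ->
  nu + c3 * nu ^+ 2 - c6 * nu ^+ 3 = lead lam * (z1 * z2 * z3) ->
  let m := - lam / nu in let c := nu^-1 in let x1 := z1 / (lam * z1 + nu) in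
  let x2 := z2 / (lam * z2 + nu) in let x3 := z3 / (lam * z3 + nu) in
  [/\ x1 + x2 + x3 = m ^+ 2 + c1 * m - c2,
      x1 * x2 + x1 * x3 + x2 * x3 = c4 - 2%:R * m * c - c1 * c - c3 * m &
      x1 * x2 * x3 = c ^+ 2 + c3 * c - c6].
Proof.
move=> n0 D0 w1 w2 w3 r1 r2 r3.
have eD : lead lam = nu ^+ 3 / ((lam * z1 + nu) * (lam * z2 + nu) * (lam * z3 + nu)).
  by apply: canRL (mulfK _) (third_w_neq0 r1 r2 r3); rewrite !mulf_neq0.
rewrite /= in r1 r2 r3; move: (lead lam) r1 r2 r3 D0 eD => D r1 r2 r3 D0 eD.
have e6 : c6 = (nu + c3 * nu ^+ 2 - D * (z1 * z2 * z3)) / nu ^+ 3 by rewrite -r3; field.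
have e4 : c4 = (lam + c1 * nu + 2%:R * c3 * lam * nu - 3%:R * c6 * lam * nu ^+ 2
    + D * (z1 * z2 + z1 * z3 + z2 * z3)) / nu ^+ 2.
  by apply: (mulIf (expf_neq0 2 n0)); rewrite divfK ?expf_neq0 //; apply: (linear_comb1 (esym r2)); ring.
have e2 : c2 = (c1 * lam + c3 * lam ^+ 2 - 2%:R * c4 * lam * nu - 3%:R * c6 * lam ^+ 2 * nu
    - D * (z1 + z2 + z3)) / nu.
  by apply: (mulIf n0); rewrite divfK //; apply: (linear_comb1 (esym r1)); rewrite /quad; ring.
split; rewrite ?e2 ?e4 e6 eD; field; by rewrite ?n0 ?w1 ?w2 ?w3.
Qed.

(** Lines w = lam z through the origin are the vertical lines x = 1/lam, so their other two points
    are opposite. *)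
Lemma third_vertical lam D z z3 : lam != 0 -> c1 * lam + c3 * lam ^+ 2 = D * (z + z3) ->
  lam = - D * (z * z3) -> - z3 / opp_unit z3 (lam * z3) = z.
Proof.
move=> l0 r1 r2.
have [z0 z30] : z != 0 /\ z3 != 0.
  by split; apply: contraNneq l0 => h; rewrite r2 h ?(mul0r, mulr0).
have eD : D = - lam / (z * z3) by rewrite r2; field; rewrite z0 z30.
have e1 : c1 = - (z + z3) / (z * z3) - c3 * lam.
  apply: (mulIf l0); apply: (linear_comb1 r1); rewrite eD; field; by rewrite z0 z30.
have -> : opp_unit z3 (lam * z3) = - z3 / z by rewrite /opp_unit e1; field; rewrite ?z30 ?z0.
by rewrite invf_div mulrC divfK ?oppr_eq0.
Qed.

End ChordTangent.

Section NearOrigin.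
Variables (K : fieldType) (V : set K) (E : ecurve K) (s : K).
Hypotheses (VP : is_place setT V) (s0 : s != 0).
Notation m := (maximal_ideal V).
Notation al1 := (s * a1 E).
Notation al2 := (s ^+ 2 * a2 E).
Notation al3 := (s ^+ 3 * a3 E).
Notation al4 := (s ^+ 4 * a4 E).
Notation al6 := (s ^+ 6 * a6 E).
Notation eqn := (zw_eq al1 al2 al3 al4 al6).
Hypotheses (V1 : V al1) (V2 : V al2) (V3 : V al3) (V4 : V al4) (V6 : V al6).

(** Scaling by s replaces the coefficients a_i by s^i a_i, which are integral, and the affine
    coordinates by s^2 x and s^3 y. *)
Definition zc (P : epoint E) : K := if pt P is Some (x, y) then x / (s * y) else 0.
Definition wc (P : epoint E) : K := if pt P is Some (x, y) then (s ^+ 3 * y)^-1 else 0.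

(** The kernel of reduction of this integral model, which need not be minimal. The clause on y
    matters: division by 0 yields 0, which would count as small. *)
Definition near (P : epoint E) :=
  [/\ if pt P is Some (x, y) then y != 0 else true, m (zc P) & m (wc P)].

Lemma near0 : near 0.
Proof. by split=> //; apply: (mideal0 VP). Qed.

Lemma affine_zw x y : weq E x y = 0 -> y != 0 -> eqn (x / (s * y)) (s ^+ 3 * y)^-1 = 0.
Proof.
move=> e y0; apply: (mulfI (expf_neq0 3 y0)); apply: (mulfI (expf_neq0 3 s0)).
by rewrite !mulr0 -e /zw_eq /weq; field; rewrite s0 y0.
Qed.

Lemma near_eqn P : near P -> eqn (zc P) (wc P) = 0.
Proof.
case=> + _ _; have := ptP P; rewrite /zc /wc; case: (pt P) => [[x y] [_ _ e] y0|_ _].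
  exact: affine_zw.
by rewrite /zw_eq; ring.
Qed.

Lemma midealX x n : (0 < n)%N -> m x -> m (x ^+ n).
Proof.
by case: n => // n _ mx; rewrite exprS; apply: (midealM VP) => //; apply: (valX VP); case: mx.
Qed.

Lemma midealMr x y : V x -> m y -> m (x * y).
Proof. by move=> Vx my; rewrite mulrC; apply: (midealM VP). Qed.

Ltac vl := first [assumption | exact: (val1 VP) | exact: (val0 VP) | exact: (val_nat VP)
  | by apply: mideal_val | apply: (valN VP); vl | apply: (valD VP); vl | apply: (valM VP); vl
  | apply: (valX VP); vl].
Ltac mi := first [assumption | apply: (midealN VP); mi | apply: (midealD VP); mi
  | apply: midealX; [done | mi] | solve [apply: (midealM VP); [mi | vl]]
  | solve [apply: midealMr; [vl | mi]]].

Lemma unit_1D x : m x -> [/\ 1 + x != 0, V (1 + x) & V (1 + x)^-1].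
Proof.
move=> mx; split; [|by vl|exact: (val_unit1 VP)].
apply/eqP => e; apply: (mideal1 VP); have -> : 1 = - x by apply/eqP; rewrite -addr_eq0 e.
by mi.
Qed.

Lemma near_unit z w : m z -> m w -> let u := zw_unit al1 al2 al3 al4 al6 z w in
  [/\ u != 0, V u & V u^-1].
Proof. by move=> mz mw; apply: unit_1D; mi. Qed.

Lemma near_inj P Q : near P -> near Q -> zc P = zc Q -> wc P = wc Q -> P = Q.
Proof.
move=> [+ _ _] [+ _ _]; rewrite /zc /wc => hP hQ hz hw; apply: pt_inj; move: hP hQ hz hw.
case: (pt P) => [[x y]|]; case: (pt Q) => [[x' y']|] //= y0.
- move=> y0' hz /invr_inj/(mulfI (expf_neq0 3 s0)) ey; rewrite ey in y0 hz *.
  by move/(mulIf (invr_neq0 (mulf_neq0 s0 y0))): hz => ->.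
- by move=> _ _ /eqP; rewrite invr_eq0 mulf_eq0 expf_eq0 /= (negPf s0) (negPf y0).
- by move=> y0' _ /esym/eqP; rewrite invr_eq0 mulf_eq0 expf_eq0 /= (negPf s0) (negPf y0').
Qed.

Lemma near_mk z w : m z -> m w -> eqn z w = 0 -> exists P, [/\ near P, zc P = z, wc P = w &
  forall k : set K, divring_closed [in k] -> k s -> k z -> k w -> rat k P].
Proof.
move=> mz mw e; have [u0 _ _] := near_unit mz mw; have eu := zw_unitE e.
have [w0|w0] := eqVneq w 0.
  exists 0; split=> //; first exact: near0.
  by apply/esym/eqP; have /eqP := eu; rewrite w0 mul0r eq_sym expf_eq0.
have h : points E setT (Some (z / (s ^+ 2 * w), (s ^+ 3 * w)^-1)).
  split=> //; apply: (mulfI (expf_neq0 3 w0)); apply: (mulfI (expf_neq0 6 s0)).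
  by rewrite !mulr0 -e /zw_eq /weq; field; rewrite s0 w0.
exists (mkpt h); have ez : zc (mkpt h) = z by rewrite /zc /=; field; rewrite s0 w0 oner_neq0.
have ew : wc (mkpt h) = w by rewrite /wc /=; field; rewrite ?s0 ?w0 ?oner_neq0.
split=> //; first by split; rewrite ?ez ?ew //= invr_eq0 mulf_neq0 ?expf_neq0.
by have [_ _ hw] := h; move=> k sk ks kz kw; split=> //; subf sk.
Qed.

Lemma opp_unitP z w : m z -> m w -> let u := opp_unit al1 al3 z w in [/\ u != 0, V u & V u^-1].
Proof. by move=> mz mw; apply: unit_1D; mi. Qed.

Lemma nearN_coords P : near P -> [/\ near (- P),
  zc (- P) = - zc P / opp_unit al1 al3 (zc P) (wc P) &
  wc (- P) = - wc P / opp_unit al1 al3 (zc P) (wc P)].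
Proof.
move=> nP; have [hy mz mw] := nP; have [u0 Vu Vui] := opp_unitP mz mw.
have [P0|P0] := eqVneq P 0.
  by rewrite P0 oppr0 /zc /wc /= oppr0 !mul0r; split=> //; apply: near0.
suff [hy' ez ew] : [/\ if pt (- P) is Some (x, y) then y != 0 else true,
    zc (- P) = - zc P / opp_unit al1 al3 (zc P) (wc P) &
    wc (- P) = - wc P / opp_unit al1 al3 (zc P) (wc P)].
  by split=> //; split=> //; rewrite ?ez ?ew; apply: (midealM VP) => //; apply: (midealN VP).
move: u0 P0 hy; rewrite -pt_eq0 /zc /wc ptN; case: (pt P) => [[x y]|] //=.
set u := opp_unit _ _ _ _ => u0 _ y0.
have -> : - y - a1 E * x - a3 E = - (y * u) by rewrite /u /opp_unit; field; rewrite s0 y0.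
by rewrite oppr_eq0 mulf_neq0 //; split=> //; field; rewrite s0 y0 u0 oppr_eq0 mulf_neq0.
Qed.

Lemma slope_den_unit z1 w1 z2 w2 : m z1 -> m w1 -> m z2 -> m w2 ->
  let u := slope_den al1 al2 al3 al4 al6 z1 w1 z2 w2 in [/\ u != 0, V u & V u^-1].
Proof. by move=> *; apply: unit_1D; mi. Qed.

Lemma lead_unit lam : m lam -> let u := lead al2 al4 al6 lam in [/\ u != 0, V u & V u^-1].
Proof. by move=> *; apply: unit_1D; mi. Qed.

Lemma chord_near z1 w1 z2 w2 : m z1 -> m w1 -> m z2 -> m w2 ->
  let lam := slope al1 al2 al3 al4 al6 z1 w1 z2 w2 in
  [/\ m lam, [/\ lead al2 al4 al6 lam != 0, V (lead al2 al4 al6 lam) & V (lead al2 al4 al6 lam)^-1],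
      m (third_z al1 al2 al3 al4 al6 z1 w1 z2 w2) & m (third_w al1 al2 al3 al4 al6 z1 w1 z2 w2)].
Proof.
move=> mz1 mw1 mz2 mw2 lam; have [B0 VB VBi] := slope_den_unit mz1 mw1 mz2 mw2.
have ml : m lam by apply: (midealM VP) => //; rewrite /slope_num; mi.
have [D0 VD VDi] := lead_unit ml.
have mnu : m (w1 - lam * z1) by mi.
have mz3 : m (third_z al1 al2 al3 al4 al6 z1 w1 z2 w2).
  by rewrite /third_z -/lam /quad /=; mi.
by split=> //; rewrite /third_w -/lam /=; mi.
Qed.

(** The affine formulas do not see the origin or vertical lines, so these cases come first;
    otherwise the line is carried back to affine coordinates for [collinear_padd]. *)
Lemma nearD_coords P Q : near P -> near Q -> [/\ near (P + Q),
  zc (P + Q) = sum_z al1 al2 al3 al4 al6 (zc P) (wc P) (zc Q) (wc Q) &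
  wc (P + Q) = sum_w al1 al2 al3 al4 al6 (zc P) (wc P) (zc Q) (wc Q)].
Proof.
move=> nP nQ; have [hP mz1 mw1] := nP; have [hQ mz2 mw2] := nQ.
have [B0 _ _] := slope_den_unit mz1 mw1 mz2 mw2.
have [ml [D0 _ _] mz3 mw3] := chord_near mz1 mw1 mz2 mw2.
have [u0 Vu Vui] := opp_unitP mz3 mw3.
have [] := vieta (near_eqn nP) (near_eqn nQ) B0 D0; move: D0 u0 Vui mz3 mw3.
rewrite /sum_w /sum_z /third_w /=.
set lam := slope _ _ _ _ _ _ _ _ _; set nu := wc P - lam * zc P.
set z3 := third_z _ _ _ _ _ _ _ _ _ => D0 u0 Vui mz3 mw3 ew2 r1 r2 r3.
suff [hy ez ew] : [/\ if pt (P + Q) is Some (x, y) then y != 0 else true,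
    zc (P + Q) = - z3 / opp_unit al1 al3 z3 (lam * z3 + nu) &
    wc (P + Q) = - (lam * z3 + nu) / opp_unit al1 al3 z3 (lam * z3 + nu)].
  by split=> //; split=> //; rewrite ?ez ?ew; apply: (midealM VP) => //; apply: (midealN VP).
(* This serves the sums in which one point is the origin: the line has nu = 0 and the sum is the
   other point. *)
have vert z1 : lam != 0 -> nu = 0 ->
    quad al1 al2 al3 al4 al6 lam nu = lead al2 al4 al6 lam * (z1 + z3) ->
    lam = - lead al2 al4 al6 lam * (z1 * z3) ->
    - z3 / opp_unit al1 al3 z3 (lam * z3 + nu) = z1 /\
    - (lam * z3 + nu) / opp_unit al1 al3 z3 (lam * z3 + nu) = lam * z1.
  move=> l0 n0 s1 s2; suff e : - z3 / opp_unit al1 al3 z3 (lam * z3 + nu) = z1.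
    by split=> //; rewrite -e n0 addr0 !mulNr mulrN mulrA.
  rewrite n0 addr0; apply: third_vertical l0 _ s2; apply: (linear_comb1 s1).
  by rewrite /quad n0; ring.
have [P0|P0] := eqVneq P 0.
  have [zP wP] : zc P = 0 /\ wc P = 0 by rewrite P0.
  have nu0 : nu = 0 by rewrite /nu zP wP mulr0 subrr.
  rewrite P0 add0r; have [Q0|Q0] := eqVneq Q 0.
    have l0 : lam = 0.
      rewrite /lam /slope; have [-> ->] : zc Q = 0 /\ wc Q = 0 by rewrite Q0.
      rewrite zP wP; have -> : slope_num al1 al2 al4 0 0 0 0 = 0 by rewrite /slope_num; ring.
      by rewrite mul0r.
    have z30 : z3 = 0.
      have [zQ _] : zc Q = 0 /\ wc Q = 0 by rewrite Q0.
      apply: (mulfI D0); rewrite mulr0; apply: (linear_comb1 (esym r1)).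
      by rewrite /quad l0 nu0 zP zQ; ring.
    by rewrite Q0 z30 l0 nu0 /zc /wc /= mul0r addr0 oppr0 mul0r.
  have wQ : wc Q != 0.
    move: Q0 hQ; rewrite -pt_eq0 /wc; case: (pt Q) => [[x y]|] //= _ y0.
    by rewrite invr_eq0 mulf_neq0 ?expf_neq0.
  have ewQ : wc Q = lam * zc Q by rewrite ew2 nu0 addr0.
  have l0 : lam != 0 by apply: contraNneq wQ => l0; rewrite ewQ l0 mul0r.
  have [||-> ->] := vert (zc Q) l0 nu0; rewrite ?ewQ //.
  - by rewrite r1 zP add0r.
  - by apply: (linear_comb1 r2); rewrite zP nu0; ring.
have wP : wc P != 0.
  move: P0 hP; rewrite -pt_eq0 /wc; case: (pt P) => [[x y]|] //= _ y0.
  by rewrite invr_eq0 mulf_neq0 ?expf_neq0.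
have ew1 : wc P = lam * zc P + nu by rewrite /nu addrC subrK.
have [Q0|Q0] := eqVneq Q 0.
  have [zQ wQ] : zc Q = 0 /\ wc Q = 0 by rewrite Q0.
  have nu0 : nu = 0 by move: ew2; rewrite zQ wQ mulr0 add0r.
  have ewP : wc P = lam * zc P by rewrite ew1 nu0 addr0.
  have l0 : lam != 0 by apply: contraNneq wP => l0; rewrite ewP l0 mul0r.
  rewrite Q0 addr0; have [||-> ->] := vert (zc P) l0 nu0; rewrite ?ewP //.
  - by rewrite r1 zQ addr0.
  - by apply: (linear_comb1 r2); rewrite zQ nu0; ring.
have wQ : wc Q != 0.
  move: Q0 hQ; rewrite -pt_eq0 /wc; case: (pt Q) => [[x y]|] //= _ y0.
  by rewrite invr_eq0 mulf_neq0 ?expf_neq0.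
have affine (R : epoint E) : wc R != 0 ->
    pt R = Some (zc R / wc R / s ^+ 2, (wc R)^-1 / s ^+ 3) .
  rewrite /zc /wc; case: (pt R) => [[x y]|]; last by rewrite eqxx.
  rewrite invr_eq0 mulf_eq0 negb_or => /andP[s30 y0].
  by congr (Some (_, _)); field; rewrite s0 y0 oner_neq0.
(* A line with nu = 0 passes through the origin, so z3 = 0 and P + Q = 0. *)
have [nu0|nu0] := eqVneq nu 0.
  have ewP : wc P = lam * zc P by rewrite ew1 nu0 addr0.
  have ewQ : wc Q = lam * zc Q by rewrite ew2 nu0 addr0.
  have l0 : lam != 0 by apply: contraNneq wP => l0; rewrite ewP l0 mul0r.
  have zP : zc P != 0 by apply: contraNneq wP => h; rewrite ewP h mulr0.
  have zQ : zc Q != 0 by apply: contraNneq wQ => h; rewrite ewQ h mulr0.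
  have z30 : z3 = 0.
    apply/eqP; have /eqP := r3; rewrite nu0 !expr0n /= !mulr0 addr0 subrr eq_sym.
    by rewrite !mulf_eq0 (negPf D0) (negPf zP) (negPf zQ).
  rewrite z30 nu0 mulr0 addr0 oppr0 mul0r.
  suff e : P + Q = 0 by rewrite e.
  apply: pt_inj; rewrite ptD (affine P wP) (affine Q wQ) ewP ewQ /=.
  have -> : zc P / (lam * zc P) / s ^+ 2 == zc Q / (lam * zc Q) / s ^+ 2.
    by apply/eqP; field; rewrite l0 zP zQ s0.
  rewrite ifT //=; apply/eqP.
  have eD : lead al2 al4 al6 lam = - lam / (zc P * zc Q).
    apply: (mulIf (mulf_neq0 zP zQ)); rewrite divfK ?mulf_neq0 //.
    by apply: (linear_comb1 r2); rewrite nu0 z30; ring.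
  have ea : a1 E = - (zc P + zc Q) / (zc P * zc Q) / s - s ^+ 2 * a3 E * lam.
    apply: (mulIf (mulf_neq0 l0 s0)); apply: (linear_comb1 r1).
    by rewrite eD /quad nu0 z30; field; rewrite zP zQ s0.
  by rewrite ea; field; rewrite l0 zP zQ s0.
have hw3 : lam * z3 + nu != 0.
  have := third_w_neq0 r1 r2 r3 => /eqP; apply: contraTneq => ->.
  by rewrite !mulr0 eq_sym expf_eq0.
rewrite ew1 in wP; rewrite ew2 in wQ.
have [s1 s2 s3] := vieta_affine nu0 D0 wP wQ hw3 r1 r2 r3.
pose mm := - lam / nu / s; pose cc := nu^-1 / s ^+ 3.
have col : collinear E mm cc (zc P / (lam * zc P + nu) / s ^+ 2)
    (zc Q / (lam * zc Q + nu) / s ^+ 2) (z3 / (lam * z3 + nu) / s ^+ 2).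
  split.
  - apply: (mulfI (expf_neq0 2 s0)); apply: (linear_comb1 s1); rewrite /mm.
    by field; rewrite s0 nu0 wP wQ hw3.
  - apply: (mulfI (expf_neq0 4 s0)); apply: (linear_comb1 s2); rewrite /mm /cc.
    by field; rewrite s0 nu0 wP wQ hw3.
  - apply: (mulfI (expf_neq0 6 s0)); apply: (linear_comb1 s3); rewrite /mm /cc.
    by field; rewrite s0 nu0 wP wQ hw3.
have ypt z : lam * z + nu != 0 -> (lam * z + nu)^-1 / s ^+ 3 = mm * (z / (lam * z + nu) / s ^+ 2) + cc.
  by move=> h; rewrite /mm /cc; field; rewrite s0 nu0 h.
have := collinear_padd (curve_nz E) col; rewrite -!ypt //.
rewrite -{1 2}ew1 -{1 2}ew2 -(affine P) ?ew1 // -(affine Q) ?ew2 // -ptD => epq.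
rewrite /zc /wc epq /third -ypt //.
have -> : - ((lam * z3 + nu)^-1 / s ^+ 3) - a1 E * (z3 / (lam * z3 + nu) / s ^+ 2) - a3 E =
    - (opp_unit al1 al3 z3 (lam * z3 + nu) / ((lam * z3 + nu) * s ^+ 3)).
  by rewrite /opp_unit; field; rewrite s0 hw3.
move: (opp_unit _ _ _ _) u0 => u u0.
rewrite oppr_eq0 !mulf_neq0 ?invr_eq0 ?mulf_neq0 ?expf_neq0 //.
by split=> //; field; rewrite u0 s0 hw3 oppr_eq0 ?mulf_neq0 ?invr_eq0 ?mulf_neq0 ?expf_neq0.
Qed.

End NearOrigin.

Section NearPoints.
Variables (K : fieldType) (V : set K) (E : ecurve K) (s : K).
Hypotheses (VP : is_place setT V) (s0 : s != 0).
Notation m := (maximal_ideal V).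
Notation al1 := (s * a1 E).
Notation al2 := (s ^+ 2 * a2 E).
Notation al3 := (s ^+ 3 * a3 E).
Notation al4 := (s ^+ 4 * a4 E).
Notation al6 := (s ^+ 6 * a6 E).
Notation eqn := (zw_eq al1 al2 al3 al4 al6).
Hypotheses (V1 : V al1) (V2 : V al2) (V3 : V al3) (V4 : V al4) (V6 : V al6).
Notation near := (near V s).
Notation zc := (zc s).
Notation wc := (wc s).
Implicit Types P Q R T : epoint E.

Ltac vl := first [assumption | exact: (val1 VP) | exact: (val0 VP) | exact: (val_nat VP)
  | by apply: mideal_val | apply: (valN VP); vl | apply: (valD VP); vl | apply: (valM VP); vl
  | apply: (valX VP); vl].
Ltac mi := first [assumption | apply: (midealN VP); mi | apply: (midealD VP); mi
  | apply: (midealX VP); [done | mi] | solve [apply: (midealM VP); [mi | vl]]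
  | solve [apply: (midealMr VP); [vl | mi]]].

Lemma nearD P Q : near P -> near Q -> near (P + Q).
Proof. by move=> hP hQ; case: (nearD_coords VP s0 V1 V2 V3 V4 V6 hP hQ). Qed.
Lemma nearN P : near P -> near (- P).
Proof. by move=> hP; case: (nearN_coords VP s0 V1 V3 hP). Qed.
Lemma nearB P Q : near P -> near Q -> near (P - Q).
Proof. by move=> hP hQ; apply: nearD => //; apply: nearN. Qed.
Lemma nearMn P n : near P -> near (P *+ n).
Proof.
by move=> hP; elim: n => [|n IH]; [rewrite mulr0n; apply: near0 | rewrite mulrS; apply: nearD].
Qed.

Section Congruence.
Variable q : K.

Definition cong (x y : K) := [/\ V x, V y & V ((x - y) / q)].

Lemma cong_refl x : V x -> cong x x.
Proof. by move=> Vx; split=> //; rewrite subrr mul0r; apply: (val0 VP). Qed.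
Lemma congD x y x' y' : cong x x' -> cong y y' -> cong (x + y) (x' + y').
Proof.
move=> [? ? h] [? ? h']; split; try exact: (valD VP).
have -> : (x + y - (x' + y')) / q = (x - x') / q + (y - y') / q by rewrite -mulrDl; congr (_ * _); ring.
exact: (valD VP).
Qed.
Lemma congN x x' : cong x x' -> cong (- x) (- x').
Proof.
move=> [? ? h]; split; try exact: (valN VP).
by rewrite -opprD mulNr; apply: (valN VP).
Qed.
Lemma congM x y x' y' : cong x x' -> cong y y' -> cong (x * y) (x' * y').
Proof.
move=> [? ? h] [? ? h']; split; try exact: (valM VP).
have -> : (x * y - x' * y') / q = (x - x') / q * y + x' * ((y - y') / q).
  by rewrite mulrAC mulrA -mulrDl; congr (_ * _); ring.
by apply: (valD VP); apply: (valM VP).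
Qed.
Lemma congX x x' n : cong x x' -> cong (x ^+ n) (x' ^+ n).
Proof.
move=> h; elim: n => [|n IH]; first by apply: cong_refl; apply: (val1 VP).
by rewrite !exprS; apply: congM.
Qed.
Lemma congV x x' : x != 0 -> x' != 0 -> V x^-1 -> V x'^-1 -> cong x x' -> cong x^-1 x'^-1.
Proof.
move=> x0 x0' Vx Vx' [? ? h]; split=> //.
have -> : (x^-1 - x'^-1) / q = - ((x - x') / q) * (x^-1 * x'^-1).
  rewrite -mulNr mulrAC; congr (_ * _); field; by rewrite x0 x0'.
by apply: (valM VP); [apply: (valN VP) | apply: (valM VP)].
Qed.

Ltac cg := first [assumption | apply: cong_refl; vl | apply: congN; cg | apply: congD; cg
  | apply: congM; cg | apply: congX; cg].

Definition near_cong P Q := cong (zc P) (zc Q) /\ cong (wc P) (wc Q).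

Lemma cong_eqn z w z' w' : cong z z' -> cong w w' -> cong (eqn z w) (eqn z' w').
Proof. by move=> *; rewrite /zw_eq; cg. Qed.

(** The addition formulas divide only by units, so they respect congruences. *)
Lemma near_congD P P' Q Q' : near P -> near P' -> near Q -> near Q' ->
  near_cong P P' -> near_cong Q Q' -> near_cong (P + Q) (P' + Q').
Proof.
move=> nP nP' nQ nQ' [cz1 cw1] [cz2 cw2].
have [_ mz1 mw1] := nP; have [_ mz2 mw2] := nQ.
have [_ mz1' mw1'] := nP'; have [_ mz2' mw2'] := nQ'.
have [_ ez ew] := nearD_coords VP s0 V1 V2 V3 V4 V6 nP nQ.
have [_ ez' ew'] := nearD_coords VP s0 V1 V2 V3 V4 V6 nP' nQ'.
have [B0 _ VBi] := slope_den_unit VP V1 V2 V3 V4 V6 mz1 mw1 mz2 mw2.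
have [B0' _ VBi'] := slope_den_unit VP V1 V2 V3 V4 V6 mz1' mw1' mz2' mw2'.
have [ml [D0 _ VDi] mz3 mw3] := chord_near VP V1 V2 V3 V4 V6 mz1 mw1 mz2 mw2.
have [ml' [D0' _ VDi'] mz3' mw3'] := chord_near VP V1 V2 V3 V4 V6 mz1' mw1' mz2' mw2'.
have [u0 _ Vui] := opp_unitP VP V1 V3 mz3 mw3.
have [u0' _ Vui'] := opp_unitP VP V1 V3 mz3' mw3'.
rewrite /near_cong ez ew ez' ew' /sum_z /sum_w.
have cl : cong (slope al1 al2 al3 al4 al6 (zc P) (wc P) (zc Q) (wc Q))
    (slope al1 al2 al3 al4 al6 (zc P') (wc P') (zc Q') (wc Q')).
  by apply: congM; [rewrite /slope_num; cg | apply: congV => //; rewrite /slope_den; cg].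
have c3 : cong (third_z al1 al2 al3 al4 al6 (zc P) (wc P) (zc Q) (wc Q))
    (third_z al1 al2 al3 al4 al6 (zc P') (wc P') (zc Q') (wc Q')).
  rewrite /third_z /=; apply: congD; last by cg.
  apply: congD; last by cg.
  by apply: congM; [rewrite /quad; cg | apply: congV => //; rewrite /lead; cg].
have c4 : cong (third_w al1 al2 al3 al4 al6 (zc P) (wc P) (zc Q) (wc Q))
    (third_w al1 al2 al3 al4 al6 (zc P') (wc P') (zc Q') (wc Q')).
  by rewrite /third_w /=; cg.
by split; apply: congM; try (by cg); apply: congV => //; rewrite /opp_unit; cg.
Qed.

Lemma near_cong_refl P : near P -> near_cong P P.
Proof. by move=> [_ mz mw]; split; apply: cong_refl; apply: mideal_val. Qed.

Lemma near_congMn P P' n : near P -> near P' -> near_cong P P' -> near_cong (P *+ n) (P' *+ n).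
Proof.
move=> hP hP' h; elim: n => [|n IH]; first by rewrite !mulr0n; apply/near_cong_refl/near0.
by rewrite !mulrS; apply: near_congD => //; apply: nearMn.
Qed.

Lemma near_cong0 P : near P -> V (zc P / q) -> near_cong P 0.
Proof.
move=> nP h; have [_ mz mw] := nP.
have [u0 _ Vui] := near_unit VP V1 V2 V3 V4 V6 mz mw.
have e := zw_unitE (near_eqn s0 nP).
have z0 : V 0 by apply: (val0 VP).
split; split; rewrite ?subr0 //; try exact: mideal_val.
have -> : wc P = zc P ^+ 3 / zw_unit al1 al2 al3 al4 al6 (zc P) (wc P) by rewrite -e mulfK.
rewrite exprS mulrAC [_ * _ / q]mulrAC.
by apply: (valM VP) => //; apply: (valM VP) => //; vl.
Qed.

End Congruence.

(* In the parameter [zc], the group law is z1 + z2 up to second order. *)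
Lemma near_linear q P Q : q != 0 -> m q -> near P -> near Q -> V (zc P / q) -> V (zc Q / q) ->
  V ((zc (P + Q) - zc P - zc Q) / q ^+ 2).
Proof.
move=> q0 mq nP nQ h1 h2.
have [_ mz1 mw1] := nP; have [_ mz2 mw2] := nQ.
have lvl R : near R -> V (zc R / q) -> exists2 om, V om & wc R = q ^+ 2 * om.
  move=> nR h; have [_ mz mw] := nR.
  have [u0 _ Vui] := near_unit VP V1 V2 V3 V4 V6 mz mw.
  have e := zw_unitE (near_eqn s0 nR).
  exists ((zc R / q) ^+ 2 * zc R / zw_unit al1 al2 al3 al4 al6 (zc R) (wc R)); first by vl.
  rewrite [LHS](_ : _ = zc R ^+ 3 / zw_unit al1 al2 al3 al4 al6 (zc R) (wc R)); last first.
    by rewrite -e mulfK.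
  by field; rewrite u0 q0.
have [om1 Vo1 eo1] := lvl _ nP h1; have [om2 Vo2 eo2] := lvl _ nQ h2.
have [ze1 Vz1 eze1] : exists2 ze, V ze & zc P = q * ze by exists (zc P / q) => //; field.
have [ze2 Vz2 eze2] : exists2 ze, V ze & zc Q = q * ze by exists (zc Q / q) => //; field.
have Vq := mideal_val mq.
have [_ ez _] := nearD_coords VP s0 V1 V2 V3 V4 V6 nP nQ.
have [B0 _ VBi] := slope_den_unit VP V1 V2 V3 V4 V6 mz1 mw1 mz2 mw2.
have [ml [D0 _ VDi] mz3 mw3] := chord_near VP V1 V2 V3 V4 V6 mz1 mw1 mz2 mw2.
have [u0 _ Vui] := opp_unitP VP V1 V3 mz3 mw3.
have [la Vla ela] : exists2 la, V la &
    slope al1 al2 al3 al4 al6 (zc P) (wc P) (zc Q) (wc Q) = q ^+ 2 * la.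
  exists ((ze1 ^+ 2 + ze1 * ze2 + ze2 ^+ 2 - al1 * om1 + al2 * om1 * (zc P + zc Q)
      + al4 * om1 * wc P) / slope_den al1 al2 al3 al4 al6 (zc P) (wc P) (zc Q) (wc Q)).
    by vl.
  by rewrite /slope /slope_num mulrA; congr (_ / _); rewrite eo1 eze1 eze2; ring.
move: ez u0 Vui; rewrite /sum_z /third_w /third_z /= ela.
have [la3 Vla3 ela3] : exists2 la3, V la3 &
    quad al1 al2 al3 al4 al6 (q ^+ 2 * la) (wc P - q ^+ 2 * la * zc P) / lead al2 al4 al6 (q ^+ 2 * la)
    = q ^+ 2 * la3.
  exists ((al1 * la + al3 * q ^+ 2 * la ^+ 2 - al2 * (om1 - la * zc P) -
    2%:R * al4 * la * (wc P - q ^+ 2 * la * zc P)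
    - 3%:R * al6 * la * (q ^+ 2 * la) * (wc P - q ^+ 2 * la * zc P)) / lead al2 al4 al6 (q ^+ 2 * la)).
    by rewrite -ela in VDi *; vl.
  by rewrite mulrA; congr (_ / _); rewrite /quad eo1; ring.
rewrite ela3; set z3 := q ^+ 2 * la3 - _ - _; set U := opp_unit _ _ _ _ => ez u0 Vui.
have eU : exists2 eta, V eta & U = 1 + q * eta.
  exists (al1 * (q * la3 - ze1 - ze2) + al3 * (q * la * z3 + (q * om1 - q * la * zc P))).
    by rewrite /z3; vl.
  by rewrite /U /opp_unit /z3 eo1 eze1 eze2; ring.
have [eta Veta eU'] := eU.
have -> : (zc (P + Q) - zc P - zc Q) / q ^+ 2 = - la3 + (q * la3 - ze1 - ze2) * eta / U.
  have -> : eta = (U - 1) / q by rewrite eU'; field.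
  by rewrite ez /z3 eze1 eze2; field; rewrite u0 q0.
by vl.
Qed.

Let near0c : near (0 : epoint E). Proof. exact: near0. Qed.

Lemma near_linearMn q P n : q != 0 -> m q -> near P -> V (zc P / q) ->
  V ((zc (P *+ n) - zc P *+ n) / q ^+ 2) /\ V (zc (P *+ n) / q).
Proof.
move=> q0 mq nP h; elim: n => [|n [IH IH']].
  by rewrite !mulr0n subr0 /zc /= !mul0r; split; apply: (val0 VP).
have h' : V ((zc (P *+ n.+1) - zc P *+ n.+1) / q ^+ 2).
  have := near_linear q0 mq nP (nearMn n nP) h IH'; rewrite !mulrS => /(valD VP)/(_ IH).
  by rewrite -mulrDl; congr (V (_ / _)); ring.
split=> //; have -> : zc (P *+ n.+1) / q =
    (zc (P *+ n.+1) - zc P *+ n.+1) / q ^+ 2 * q + n.+1%:R * (zc P / q).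
  by rewrite -mulr_natl; field.
by vl.
Qed.

Variable p : nat.
Hypotheses (p_prime : prime p) (pK : p \in [pchar K]) (r1 : rank_one V).

(** In characteristic p the linear term p z vanishes, so multiplication by p raises divisibility of
    z by q^(N+1) to q^(2N+2), in particular to q^(N+2). *)
Lemma near_mulp P a : near P -> a != 0 ->
  exists N0, forall N, (N0 <= N)%N -> near_cong a (P *+ (p ^ N)%N) 0.
Proof.
move=> nP a0; have [z0|z0] := eqVneq (zc P) 0.
  have P0 : P = 0.
    have [_ mz mw] := nP; apply: (near_inj s0 nP near0c) => //.
    have [u0 _ _] := near_unit VP V1 V2 V3 V4 V6 mz mw.
    apply: (mulIf u0); rewrite (zw_unitE (near_eqn s0 nP)) z0.
    by rewrite expr0n /wc /= mul0r.
  exists 0 => N _; rewrite P0 mul0rn; apply: near_cong_refl; exact: near0c.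
have [_ mz _] := nP; set q := zc P in z0 mz.
have key N : V (zc (P *+ (p ^ N)%N) / q ^+ N.+1).
  elim: N => [|N IH]; first by rewrite expr1 mulfV //; apply: (val1 VP).
  have [+ _] := near_linearMn p (expf_neq0 N.+1 z0) (midealX VP (ltn0Sn N) mz)
    (nearMn (p ^ N) nP) IH.
  rewrite -[zc _ *+ p]mulr_natl pcharf0 // mul0r subr0 -mulrnA -expnSr -exprM => h.
  apply: (val_trans VP _ h); first exact: expf_neq0.
  rewrite muln2 -addnn addSnnS exprD mulfK ?expf_neq0 //.
  by apply: (valX VP); apply: mideal_val.
have [N0 h0] := small_pow VP r1 a0 mz; exists N0 => N le.
apply: near_cong0; first exact: nearMn.
by apply: (val_trans VP _ (key N)); [apply: expf_neq0 | apply: h0; apply: leqW].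
Qed.

Lemma near_cong_eq P Q (t : K) : t != 0 -> m t -> near P -> near Q ->
  (forall a, a != 0 -> near_cong a P Q) -> P = Q.
Proof.
move=> t0 mt nP nQ h; apply: (near_inj s0 nP nQ); apply/eqP; rewrite -subr_eq0; apply/eqP.
  by apply: (separated t0 mt) => a /h[[_ _ ?]].
by apply: (separated t0 mt) => a /h[_ [_ _ ?]].
Qed.

(** By Euler's theorem arbitrarily high powers of p are 1 modulo n and fix P, while the p-power
    multiples of P tend to 0. *)
Lemma near_torsion P n (t : K) : t != 0 -> m t -> near P -> (0 < n)%N -> coprime p n ->
  P *+ n = 0 -> P = 0.
Proof.
move=> t0 mt nP n0 co Pn.
have fix_p j : P *+ (p ^ (totient n * j))%N = P.
  elim: j => [|j IH]; first by rewrite muln0 expn0 mulr1n.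
  rewrite mulnS expnD mulrnA.
  have -> : P *+ p ^ totient n = P; last by [].
  have /eqP := Euler_exp_totient co; rewrite eqn_mod_dvd ?expn_gt0 ?prime_gt0 //.
  case/dvdnP => e; rewrite mulnC => ee.
  have -> : (p ^ totient n = n * e + 1)%N by rewrite -ee subnK // expn_gt0 prime_gt0.
  by rewrite mulrnDr mulrnA Pn mul0rn add0r mulr1n.
apply: (near_cong_eq t0 mt nP near0c) => a a0.
have [N0 h] := near_mulp nP a0; rewrite -(fix_p N0); apply: h.
by rewrite leq_pmull // totient_gt0.
Qed.

Hypothesis complete : forall r, cauchy V r -> exists x, limit V r x.

Lemma zc_rat (k : set K) P : divring_closed [in k] -> k s -> rat k P -> k (zc P) /\ k (wc P).
Proof.
rewrite /rat /zc /wc => sk ks; case: (pt P) => [[x y] [kx ky _]|_]; split; subf sk.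
Qed.

(** The inverse of n in Z_p acts through its partial sums, which satisfy n R_N = P - p^(th N) P and
    converge by completeness. The limit is rational over k because k is closed. *)
Lemma near_divisible (k : set K) (t : K) P n : t != 0 -> m t -> divring_closed [in k] ->
  coefs_in k E -> k s -> (forall r x, (forall N, k (r N)) -> limit V r x -> k x) ->
  near P -> rat k P -> (0 < n)%N -> coprime p n ->
  exists R, [/\ near R, rat k R & R *+ n = P].
Proof.
move=> t0 mt sk cE ks kc nP kP n0 co; set th := totient n.
have [e ee] : exists e, (p ^ th = n * e + 1)%N.
  have /eqP := Euler_exp_totient co; rewrite eqn_mod_dvd ?expn_gt0 ?prime_gt0 //.
  case/dvdnP => e; rewrite mulnC => ee; exists e.
  by rewrite -ee subnK // expn_gt0 prime_gt0.
(* 1/n = - e (1 + p^th + p^(2 th) + ...) in Z_p *)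
pose R := fix R N := if N is N'.+1 then R N' + (- P) *+ (p ^ (th * N'))%N *+ e else 0.
have nNP := nearN nP.
have nR N : near (R N).
  by elim: N => [|N IH] /=; [apply: near0c | apply: nearD => //; do 2 apply: nearMn].
have kR N : rat k (R N).
  by elim: N => [|N IH] //=; apply: ratD => //; do 2 apply: ratMn => //; apply: ratN.
have Rn N : R N *+ n = P - P *+ (p ^ (th * N))%N.
  elim: N => [|N IH] /=; first by rewrite muln0 expn0 mulr1n subrr mul0rn.
  rewrite mulrnDl IH !mulNrn mulnS expnD mulnC ee -!mulrnA -addrA -opprD -mulrnDr.
  by congr (_ - _ *+ _); ring.
have far a : a != 0 -> exists N0, forall N, (N0 <= N)%N ->
    near_cong a ((- P) *+ (p ^ (th * N))%N) 0.
  move=> a0; have [N0 h] := near_mulp nNP a0; exists N0 => N le; apply: h.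
  by apply: (leq_trans le); rewrite leq_pmull // totient_gt0.
have step a : a != 0 -> exists N0, forall N, (N0 <= N)%N -> near_cong a (R N.+1) (R N).
  move=> a0; have [N0 h] := far a a0; exists N0 => N le /=.
  rewrite -{2}[R N]addr0; apply: near_congD => //.
  - by do 2 apply: nearMn.
  - exact: near_cong_refl.
  by rewrite -[0](mul0rn _ e); apply: near_congMn => //; [apply: nearMn | apply: h].
have [z hz] : exists z, limit V (fun N => zc (R N)) z.
  apply: complete => a a0; have [N0 h] := step a a0; exists N0 => N le.
  by have [[_ _ ?] _] := h N le.
have [w hw] : exists w, limit V (fun N => wc (R N)) w.
  apply: complete => a a0; have [N0 h] := step a a0; exists N0 => N le.
  by have [_ [_ _ ?]] := h N le.
have lim_m (r : nat -> K) x : (forall N, m (r N)) -> limit V r x -> m x.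
  move=> hr lim; have [N0 h] := lim t t0; have {}h := h N0 (leqnn _).
  have -> : x = r N0 - t * ((r N0 - x) / t) by field.
  by have hr0 := hr N0; mi.
have mz : m z by apply: lim_m hz => N; have [] := nR N.
have mw : m w by apply: lim_m hw => N; have [] := nR N.
have app a : a != 0 -> exists N0, forall N, (N0 <= N)%N ->
    cong a (zc (R N)) z /\ cong a (wc (R N)) w.
  move=> a0; have [N1 h1] := hz a a0; have [N2 h2] := hw a a0; exists (maxn N1 N2) => N.
  rewrite geq_max => /andP[l1 l2]; have [_ mzN mwN] := nR N.
  by split; split; try (by apply: mideal_val); [apply: h1 | apply: h2].
have e0 : eqn z w = 0.
  apply: (separated t0 mt) => a a0; have [N0 h] := app a a0.
  have [cz cw] := h N0 (leqnn _); have [_ _] := cong_eqn cz cw.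
  by rewrite (near_eqn s0 (nR N0)) sub0r mulNr => /(valN VP); rewrite opprK.
have [Q [nQ ez ew rQ]] := near_mk VP s0 V1 V2 V3 V4 V6 mz mw e0.
exists Q; split=> //.
  apply: rQ => //; first by apply: kc hz => N; have [] := zc_rat sk ks (kR N).
  by apply: kc hw => N; have [] := zc_rat sk ks (kR N).
apply: (near_cong_eq t0 mt (nearMn n nQ) nP) => a a0.
have [N1 h1] := app a a0; have [N2 h2] := far a a0; pose N := maxn N1 N2.
have c1 : near_cong a (Q *+ n) (R N *+ n).
  apply: near_congMn => //; have [[? ? hz'] [? ? hw']] := h1 N (leq_maxl _ _).
  by rewrite /near_cong ez ew; split; split=> //; rewrite -opprB mulNr; apply: (valN VP).
have c2 : near_cong a (R N *+ n) P.
  rewrite Rn -mulNrn -[X in near_cong a _ X]addr0; apply: near_congD => //; first exact: nearMn.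
    exact: near_cong_refl.
  exact: h2 (leq_maxr _ _).
have tr x y z' : cong a x y -> cong a y z' -> cong a x z'.
  move=> [? ? h] [? ? h']; split=> //.
  by rewrite -(subrKA y) mulrDl; apply: (valD VP).
by have [? ?] := c1; have [? ?] := c2; split; apply: tr; eauto.
Qed.

(* The chord through [P] and [-Q] becomes vertical as [Q] tends to [P]. *)
Lemma near_sub P x y (t : K) : t != 0 -> m t -> pt P = Some (x, y) -> weq_y E x y != 0 ->
  exists2 b, b != 0 & forall Q x2 y2, pt Q = Some (x2, y2) ->
    V ((x - x2) / b) -> V ((y - y2) / b) -> near (P - Q).
Proof.
move=> t0 mt eP eta0; set eta := weq_y E x y in eta0.
have [d [d0 Vd hd]] := denominator VP
  [seq c / eta | c <- [:: 1; a1 E; a2 E; a3 E; x; y; s^-1]].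
(* d clears the denominators of the constants divided by eta, and the factor t makes the resulting
   products small. *)
exists (d * t); first by rewrite mulf_neq0.
move=> Q x2 y2 eQ ha hb; set al := _ / _ in ha; set be := _ / _ in hb.
have ex : x - x2 = d * t * al by rewrite /al; field; rewrite d0 t0.
have ey : y - y2 = d * t * be by rewrite /be; field; rewrite d0 t0.
clearbody al be.
have md c : c \in [:: 1; a1 E; a2 E; a3 E; x; y; s^-1] -> m (d * t * (c / eta)).
  move=> hc; rewrite mulrAC; apply: midealMr => //; apply: hd.
  exact: (map_f (fun c => c / eta)).
pose u := d * t * (1 / eta) * be + d * t * (a1 E / eta) * al.
have mu_ : m (- u).
  have h1 := md 1; have h2 := md (a1 E); rewrite !inE !eqxx /= orbT in h1 h2.
  by have {}h1 := h1 isT; have {}h2 := h2 isT; rewrite /u; mi.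
have [u0 _ Vui] := unit_1D VP mu_.
have eyy : y + y2 + a1 E * x2 + a3 E = eta * (1 - u).
  have -> : y2 = y - d * t * be by rewrite -ey; ring.
  have -> : x2 = x - d * t * al by rewrite -ex; ring.
  by rewrite /u /eta /weq_y; field; rewrite -/(weq_y E x y).
have yy0 : y + y2 + a1 E * x2 + a3 E != 0 by rewrite eyy mulf_neq0.
have := ptP P; rewrite eP => -[_ _ wP]; have := ptP Q; rewrite eQ => -[_ _ wQ].
have [exx|nxx] := eqVneq x x2.
  suff -> : P = Q by rewrite subrr; apply: near0c.
  apply: pt_inj; rewrite eP eQ -exx; congr (Some (_, _)); apply/eqP.
  rewrite -subr_eq0; apply/eqP/(mulIf yy0); rewrite mul0r -exx.
  rewrite -exx in wQ; apply: (linear_comb1 (A := weq E x y - weq E x y2) (B := 0)).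
    by rewrite wP wQ subrr.
  by rewrite /weq; ring.
have al0 : al != 0.
  by apply: contraNneq nxx => h; rewrite -subr_eq0 ex h mulr0.
(* The inverse of the slope of the chord through P and -Q, see [eM]. It is small, and P - Q has
   coordinates (1 + e1) / mu^2 and -(1 + e2) / mu^3 with small e1 and e2. *)
pose mu := d * t * al / (eta * (1 - u)).
have mu0 : mu != 0 by rewrite /mu !mulf_neq0 ?invr_eq0 ?mulf_neq0.
have mmu c : c \in [:: 1; a1 E; a2 E; a3 E; x; y; s^-1] -> m (mu * c).
  move=> /md h; have -> : mu * c = d * t * (c / eta) * (al / (1 - u)).
    by rewrite /mu; field; rewrite eta0 u0.
  by apply: (midealM VP) => //; apply: (valM VP).
have [m1 ma1 ma2 ma3] : [/\ m mu, m (mu * a1 E), m (mu * a2 E) & m (mu * a3 E)].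
  rewrite -{1}[mu]mulr1; split; apply: mmu; rewrite !inE !eqxx ?orbT //.
have [mx my ms] : [/\ m (mu * x), m (mu * y) & m (mu * s^-1)].
  by split; apply: mmu; rewrite !inE !eqxx ?orbT.
have mx2 : m (mu * x2).
  have -> : mu * x2 = mu * x - mu * (d * t * al) by rewrite -ex; ring.
  by have Vt := mideal_val mt; mi.
pose e1 := mu * a1 E - mu * (mu * a2 E) - mu * (mu * x + mu * x2).
have me1 : m e1 by rewrite /e1; mi.
pose e2 := e1 + mu * a1 E * (1 + e1) + mu * mu * (mu * y) - mu * (mu * x) + mu * mu * (mu * a3 E).
have me2 : m e2 by rewrite /e2; mi.
have [n2 _ V2i] := unit_1D VP me2.
have eM : (- y2 - a1 E * x2 - a3 E - y) / (x2 - x) = mu^-1.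
  have -> : - y2 - a1 E * x2 - a3 E - y = - (y + y2 + a1 E * x2 + a3 E) by ring.
  have -> : x2 - x = - (x - x2) by ring.
  by rewrite eyy ex /mu; field; rewrite t0 d0 al0 eta0 u0 !oppr_eq0 !mulf_neq0.
have epq : pt (P - Q) = Some ((1 + e1) / mu ^+ 2, - (1 + e2) / mu ^+ 3).
  rewrite ptD ptN eP eQ /= (negPf nxx) /= eM.
  by congr (Some (_, _)); rewrite ?/e2 /e1; field.
split; rewrite /zc /wc epq.
- by rewrite mulf_neq0 ?oppr_eq0 ?invr_eq0 ?expf_neq0.
- have -> : (1 + e1) / mu ^+ 2 / (s * (- (1 + e2) / mu ^+ 3)) = - (mu * s^-1 * ((1 + e1) / (1 + e2))).
    by field; rewrite n2 mu0 s0 ?oppr_eq0.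
  by mi.
- have -> : (s ^+ 3 * (- (1 + e2) / mu ^+ 3))^-1 = - ((mu * s^-1) ^+ 3 / (1 + e2)).
    by field; rewrite n2 mu0 s0 ?oppr_eq0.
  by mi.
Qed.

End NearPoints.

(** * Descent of local Kummer classes *)

Section LocalDescent.
Variables (K : fieldType) (V : set K) (p l : nat) (E : ecurve K).
Hypotheses (VP : is_place setT V) (r1 : rank_one V) (cl : alg_closed K).
Hypothesis complete : forall r, cauchy V r -> exists x, limit V r x.
Hypotheses (pK : p \in [pchar K]) (l_prime : prime l) (l_neq_p : l != p).
Variables (k1 k2 : set K) (t s : K).
Hypotheses (sk1 : divring_closed [in k1]) (sk2 : divring_closed [in k2]).
Hypotheses (k12 : k1 `<=` k2) (inf : infinite_field k1) (cE : coefs_in k1 E).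
Hypothesis k1c : forall r x, (forall N, k1 (r N)) -> limit V r x -> k1 x.
Hypothesis k2c : forall r x, (forall N, k2 (r N)) -> limit V r x -> k2 x.
Hypotheses (t0 : t != 0) (mt : maximal_ideal V t) (kt : k1 t).
Hypotheses (s0 : s != 0) (ks : k1 s).
Hypotheses (V1 : V (s * a1 E)) (V2 : V (s ^+ 2 * a2 E)) (V3 : V (s ^+ 3 * a3 E))
  (V4 : V (s ^+ 4 * a4 E)) (V6 : V (s ^+ 6 * a6 E)).
Notation m := (maximal_ideal V).
Notation near := (near V s).
Notation B1 := (algcl k1).
Notation B2 := (algcl k2).
Notation G1 := (galois_group (algcl k1) k1).
Notation G2 := (galois_group (algcl k2) k2).
Notation res := (fun (f : K -> K) x => if `[< algcl k1 x >] then f x else x).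

Let p_prime : prime p. Proof. by case/andP: pK. Qed.
Let sB1 : divring_closed [in B1] := algcl_subfield sk1.
Let B12 : B1 `<=` B2 := algcl_sub k12.
Let cE2 : coefs_in k2 E. Proof. by case: cE => *; split; apply: k12. Qed.
Let cB1 : coefs_in B1 E := coefs_algcl sk1 cE.

Let resG f : G2 f -> G1 (res f).
Proof. exact: gal_restrict. Qed.

Lemma act_res f (P : epoint E) : rat B1 P -> act (res f) P = act f P.
Proof.
by move=> rP; apply: act_coords => x /(coords_rat rP) Bx; rewrite asboolT.
Qed.

Lemma near_act f (P : epoint E) : G2 f -> rat B2 P -> near P -> near (act f P).
Proof.
move=> Gf rP [y0 mz mw]; have sB2 := algcl_subfield sk2; have fP := gal_phom sk2 Gf.
have Bs : B2 s by apply: (sub_algcl sk2); apply: k12.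
have fs : f s = s by apply: (gal_fix Gf); apply: k12.
have h x : B2 x -> m x -> m (f x).
  by move=> Bx mx; apply/(gal_mideal VP r1 complete sk2 t0 mt (k12 kt) k2c Gf Bx).
have := pt_act sk2 cE2 Gf rP; move: rP y0 mz mw; rewrite /near /rat /zc /wc => + + + + ->.
case: (pt P) => [[x y]|] //= [Bx By _] y0 mz mw.
have Bsy : B2 (s * y) by apply: (subM sB2).
have Bs3 : B2 (s ^+ 3) by apply: (subX sB2).
have Bs3y : B2 (s ^+ 3 * y) by apply: (subM sB2).
split; first by rewrite (phom_eq0 sB2 fP By).
- have -> : f x / (s * f y) = f (x / (s * y)).
    by rewrite (phomdiv sB2 fP Bx Bsy) (phomM fP Bs By) fs.
  by apply: h => //; apply: (subdiv sB2).
- have -> : (s ^+ 3 * f y)^-1 = f (s ^+ 3 * y)^-1.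
    by rewrite (phomV sB2 fP Bs3y) (phomM fP Bs3 By) (phomX sB2 fP 3 Bs) fs.
  by apply: h => //; apply: (subV sB2).
Qed.

(** The abscissa is a root of the 2-division polynomial 4 x^3 + b2 x^2 + 2 b4 x + b6; were this
    zero, the discriminant would be 0. *)
Lemma two_torsion_rat (Q : epoint E) : Q *+ 2 = 0 -> rat B1 Q.
Proof.
move=> Q2; have [e1 e2 e3 e4 e6] := cE.
case eQ : (pt Q) => [[x y]|]; last by rewrite /rat eQ.
have := ptP Q; rewrite eQ => -[_ _ wQ].
have w0 : weq_y E x y = 0.
  apply/eqP; apply: contraTT isT => n0; move: (congr1 (@pt _ _) Q2).
  rewrite mulr2n ptD eQ /= eqxx /=; case: ifP => // /eqP h _; case/eqP: n0.
  by rewrite -h /weq_y; ring.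
have rx : 4%:R * x ^+ 3 + b2 E * x ^+ 2 + 2%:R * b4 E * x + b6 E = 0.
  apply: (linear_comb1 (A := weq_y E x y ^+ 2 - 4%:R * weq E x y) (B := 0 ^+ 2 - 4%:R * 0)).
    by rewrite w0 wQ.
  by rewrite /b2 /b4 /b6 /weq /weq_y; ring.
have kn n : k1 n%:R by rewrite -[n%:R]mulr1n; apply: (subMn sk1 n (sub1 sk1)).
have kb2 : k1 (b2 E) by rewrite /b2; subf sk1; apply: kn.
have kb4 : k1 (b4 E) by rewrite /b4; subf sk1; apply: kn.
have kb6 : k1 (b6 E) by rewrite /b6; subf sk1; apply: kn.
pose q : {poly K} := Poly [:: b6 E; 2%:R * b4 E; b2 E; 4%:R].
have kq : poly_in k1 q.
  by move=> [|[|[|[|i]]]]; rewrite coef_Poly //= ?nth_nil; subf sk1; apply: kn.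
have rq : root q x.
  by apply/rootP; rewrite horner_Poly /= mul0r add0r; apply: (linear_comb1 rx); ring.
have q0 : q != 0.
  apply/eqP => q0; have cq i : q`_i = 0 by rewrite q0 coef0.
  have := cq 3; have := cq 2; have := cq 0; rewrite !coef_Poly /= => h6 h2 h4.
  have c2 : 2%:R = 0 :> K.
    have : 2%:R * 2%:R = 0 :> K by rewrite -natrM.
    by move/eqP; rewrite mulf_eq0 orbb => /eqP.
  have c4 : 4%:R = 2%:R * 2%:R :> K by rewrite -natrM.
  have a10 : a1 E = 0.
    by move: h2; rewrite /b2 c4 c2 mul0r mul0r addr0 => /eqP; rewrite expf_eq0 => /eqP.
  have a30 : a3 E = 0.
    by move: h6; rewrite /b6 c4 c2 mul0r mul0r addr0 => /eqP; rewrite expf_eq0 => /eqP.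
  move: (curve_nz E); rewrite /disc /b4 h2 h6 a10 c2 !mul0r addr0.
  by rewrite !(mul0r, mulr0, expr0n, oppr0, addr0, subrr) /= ?eqxx.
have Bx : B1 x by exists q.
have By : B1 y.
  pose q' : {poly K} := Poly [:: - (x ^+ 3 + a2 E * x ^+ 2 + a4 E * x + a6 E);
    a1 E * x + a3 E; 1].
  have [f1 f2 f3 f4 f6] := cB1.
  apply: (algcl_root sk1 (q := q')).
  - apply/eqP => q0'; have : q'`_2 = 0 by rewrite q0' coef0.
    by rewrite coef_Poly /= => /eqP; rewrite oner_eq0.
  - by move=> [|[|[|i]]]; rewrite coef_Poly //= ?nth_nil; subf sB1.
  - by apply/rootP; rewrite horner_Poly /= mul0r add0r; apply: (linear_comb1 wQ); rewrite /weq; ring.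
by rewrite /rat eQ.
Qed.

Variable B0 : set K.
Hypotheses (sB0 : divring_closed [in B0]) (B01 : B0 `<=` B1) (cB0 : coefs_in B0 E).
Hypothesis B0_quad : forall u v, B0 u -> B0 v -> exists2 r, B0 r & r ^+ 2 + u * r + v = 0.
Hypothesis B0_dense : forall x a, a != 0 -> exists2 y, B0 y & V ((x - y) / a).

(** For x2 in B0 close to x, the Weierstrass equation has two roots r and r' in B0. The product (y -
    r)(y - r') is small, so one of the factors is. *)
Lemma dense_points x y b : weq E x y = 0 -> b != 0 -> exists (Q : epoint E) x2 y2,
  [/\ rat B0 Q, pt Q = Some (x2, y2), V ((x - x2) / b) & V ((y - y2) / b)].
Proof.
move=> wxy b0; have [b' [b'0 hb hb1]] := min_precision VP b0 (oner_neq0 _).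
rewrite divr1 in hb1; have [c [c0 Vc hc]] := denominator VP [:: weq_x E x y; x; a2 E].
have bb0 : c * b' ^+ 2 != 0 by rewrite mulf_neq0 ?expf_neq0.
have [x2 Bx2 hx2] := B0_dense x bb0; have [f1 f2 f3 f4 f6] := cB0.
set eta := _ / _ in hx2; pose eps := c * b' ^+ 2 * eta.
have ex : x2 = x - eps by rewrite /eps /eta mulrC divfK // subKr.
have Veps : V eps by apply: (valM VP) => //; apply: (valM VP) => //; apply: (valX VP).
have [||r Br er] := B0_quad (u := a1 E * x2 + a3 E)
  (v := - (x2 ^+ 3 + a2 E * x2 ^+ 2 + a4 E * x2 + a6 E)).
- by subf sB0.
- by subf sB0.
have hpt r' : B0 r' -> r' ^+ 2 + (a1 E * x2 + a3 E) * r' +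
    - (x2 ^+ 3 + a2 E * x2 ^+ 2 + a4 E * x2 + a6 E) = 0 -> V ((y - r') / b') ->
  exists (Q : epoint E) x2 y2,
    [/\ rat B0 Q, pt Q = Some (x2, y2), V ((x - x2) / b) & V ((y - y2) / b)].
  move=> Br' er' hr'; have w : weq E x2 r' = 0 by rewrite -er' /weq; ring.
  have hp : points E setT (Some (x2, r')) by [].
  exists (mkpt hp), x2, r'; split=> //.
    apply: (val_trans VP b'0 _ hb); rewrite ex subKr.
    have -> : eps / b' = c * b' * eta by rewrite /eps; field.
    by apply: (valM VP) => //; apply: (valM VP).
  exact: (val_trans VP b'0).
have [h|h1] := pselect (V ((y - r) / b')); first exact: hpt h.
pose r' := - (a1 E * x2 + a3 E) - r.
have er' : r' ^+ 2 + (a1 E * x2 + a3 E) * r' +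
    - (x2 ^+ 3 + a2 E * x2 ^+ 2 + a4 E * x2 + a6 E) = 0 by rewrite -er /r'; ring.
have Br' : B0 r' by rewrite /r'; subf sB0.
have [h|h2] := pselect (V ((y - r') / b')); first exact: hpt h.
case: (mideal1 VP).
have n1 : (y - r) / b' != 0 by apply/eqP => e; apply: h1; rewrite e; apply: (val0 VP).
have n2 : (y - r') / b' != 0 by apply/eqP => e; apply: h2; rewrite e; apply: (val0 VP).
have -> : 1 = ((y - r) / b')^-1 * (((y - r') / b')^-1 * (((y - r) / b') * ((y - r') / b'))).
  by move: ((y - r) / b') ((y - r') / b') n1 n2 => A B A0 B0'; field; rewrite A0 B0'.
apply: (midealM VP (mideal_inv VP h1)); apply: (valM VP).
  by apply: mideal_val; apply: (mideal_inv VP h2).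
have -> : (y - r) / b' * ((y - r') / b') =
    eta * (c * - weq_x E x y - 3%:R * (c * x) * eps + c * eps ^+ 2 - c * a2 E * eps).
  have e0 : (y - r) * (y - r') =
      eps * (- weq_x E x y - 3%:R * x * eps + eps ^+ 2 - a2 E * eps).
    apply: (linear_comb1 (A := weq E x y + (- (r ^+ 2 + (a1 E * x2 + a3 E) * r +
       - (x2 ^+ 3 + a2 E * x2 ^+ 2 + a4 E * x2 + a6 E)))) (B := 0 + - 0)).
      by rewrite wxy er.
    by rewrite /r' ex /weq /weq_x; ring.
  have -> : (y - r) / b' * ((y - r') / b') = (y - r) * (y - r') / b' ^+ 2 by field.
  by rewrite e0 /eps; field.
have [hw hx ha] : [/\ V (c * weq_x E x y), V (c * x) & V (c * a2 E)].
  by split; apply: hc; rewrite !inE !eqxx ?orbT.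
apply: (valM VP) => //; rewrite mulrN.
by repeat first [assumption | exact: (val_nat VP) | apply: (valN VP) | apply: (valD VP)
  | apply: (valM VP) | apply: (valX VP)].
Qed.

Variable d : (K -> K) -> epoint E.
Hypotheses (dc : Gcocycle k1 G1 d) (dl : locally_constant G1 d).
Hypothesis dt : forall f, G1 f -> ltors l (d f).

Let coprime_pl e j : coprime (p ^ e) (l ^ j).
Proof. by rewrite coprimeXl ?coprimeXr // prime_coprime // dvdn_prime2 // eq_sym. Qed.

(** Division near the origin takes place in closed fields. A field obtained from k1 by adjoining the
    coordinates of S is closed, so dividing S there gives an algebraic point. *)
Lemma rat_adjoin_coords (S : epoint E) : rat B1 S -> exists k' : set K,
  [/\ divring_closed [in k'], k1 `<=` k', k' `<=` B1, rat k' S &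
      forall r x, (forall N, k' (r N)) -> limit V r x -> k' x].
Proof.
case eS : (pt S) => [[x y]|]; last first.
  by exists k1; split=> //; rewrite /rat ?eS //; apply: (sub_algcl sk1).
rewrite /rat eS => -[Bx By w].
have sx := adjoin_subfield sk1 Bx; have kx := sub_adjoin sk1 x.
have By' : algcl (adjoin k1 x) y by apply: algcl_sub By.
exists (adjoin (adjoin k1 x) y); split.
- exact: (adjoin_subfield sx By').
- by move=> z /kx; apply: (sub_adjoin sx).
- move=> z /(adjoin_algcl sx By'); apply: (algcl_trans sk1); exact: adjoin_algcl.
- split=> //; last exact: (adjoin_gen sx).
  by apply: (sub_adjoin sx); apply: adjoin_gen.
- move=> r z; apply: (adjoin_limit VP r1 complete sx t0 mt (kx _ kt) _ By') => r' z'.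
  exact: (adjoin_limit VP r1 complete sk1 t0 mt kt k1c Bx).
Qed.

Lemma algebraic_splitting Q : rat B2 Q -> (forall f, G2 f -> d (res f) = act f Q - Q) ->
  exists2 Q', rat B1 Q' & forall f, G2 f -> d (res f) = act f Q' - Q'.
Proof.
move=> rQ hQ; have [rd hd] := dc.
(* Points killed by 2 are algebraic already; they have weq_y = 0 or no coordinates, so [near_sub]
   does not apply to them. *)
have [Q2|Q2] := eqVneq (Q *+ 2) 0; first by exists Q => //; exact: two_torsion_rat.
case eQ : (pt Q) => [[x y]|]; last first.
  by case/eqP: Q2; rewrite [Q](_ : _ = 0) ?mul0rn //; apply: pt_inj.
have w0 : weq_y E x y != 0.
  apply: contra Q2 => /eqP w0; apply/eqP/pt_inj; rewrite mulr2n ptD eQ /= eqxx /= ifT //.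
  by apply/eqP; rewrite -w0 /weq_y; ring.
have := ptP Q; rewrite eQ => -[_ _ wQ].
have [b b0 hb] := near_sub VP s0 t0 mt eQ w0.
have [Q' [x2 [y2 [rQ' eQ' hx hy]]]] := dense_points wQ b0.
have nU := hb _ _ _ eQ' hx hy; set U := Q - Q' in nU.
have rQ1 : rat B1 Q' := rat_sub B01 rQ'.
have rQ2 : rat B2 Q' := rat_sub B12 rQ1.
have rU : rat B2 U by apply: ratB => //; [exact: (algcl_subfield sk2) | exact: (coefs_algcl sk2 cE2)].
(* On G2 this is the coboundary of U, so its values are near the origin; being d minus the
   coboundary of Q', it has algebraic values and depends on finitely many elements. *)
pose e f := d (res f) - (act f Q' - Q').
have eU f : G2 f -> e f = act f U - U.
  move=> Gf; rewrite /e hQ // /U (actB sk2 cE2 Gf rQ rQ2).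
  by rewrite !opprB [Q' + _]addrC addrACA [- Q + Q']addrC.
have dres f g : G2 f -> G2 g -> d (res (f \o g)) = d (res f) + act f (d (res g)).
  move=> Gf Gg; rewrite -(act_res f (rd _ (resG Gg))) -(hd _ _ (resG Gf) (resG Gg)); congr d.
  apply/funext => z /=; have [Bz|nBz] := pselect (B1 z); last by rewrite !asboolF // asboolF.
  have Bg : B1 (g z) by have := gal_in (resG Gg) Bz; rewrite asboolT.
  by rewrite !asboolT // asboolT.
have rde f : G2 f -> rat B1 (e f).
  move=> Gf; apply: ratB => //; first exact: rd (resG Gf).
  by apply: ratB => //; rewrite -act_res //; apply: rat_act (resG Gf) _ _.
have ec : Gcocycle k2 G2 e.
  have [_ he] := cobound_cocycle sk2 cE2 rQ2.
  split=> [f /rde|f g Gf Gg]; first exact: rat_sub.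
  rewrite {1}/e (dres _ _ Gf Gg) (he _ _ Gf Gg) /e.
  have r1' := rat_sub B12 (rd _ (resG Gg)).
  have r2' : rat B2 (act g Q' - Q') by apply: ratB => //; [exact: (algcl_subfield sk2) | exact: (coefs_algcl sk2 cE2) | apply: rat_act].
  by rewrite (actB sk2 cE2 Gf r1' r2') opprD addrACA.
have [s1 [hs1 dep]] := gal_uniform sk1 cl dl.
have [|s2 [_ sub st2 _]] := gal_stable sk2 cl (s := s1 ++ coords Q').
  by move=> x0; rewrite mem_cat => /orP[/hs1/B12 //|]; exact: coords_rat.
have dep2 : depends_on G2 s2 e.
  move=> f g Gf Gg fg; rewrite /e.
  have -> : d (res f) = d (res g).
    apply: dep; try exact: resG; move=> x0 hx0; case: asboolP => // _; apply: fg.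
    by apply: sub; rewrite mem_cat hx0.
  rewrite (act_coords (f := f) (g := g)) // => x0 hx0; apply: fg.
  by apply: sub; rewrite mem_cat hx0 orbT.
have [S [_ hS close]] := average sk2 cE2 st2 ec dep2.
have [nS rS] : near S /\ rat B1 S.
  apply: (close (fun P => near P /\ rat B1 P)).
  - by split=> //; exact: near0.
  - by move=> P P' [? ?] [? ?]; split; [apply: nearD | apply: ratD].
  - by move=> P [? ?]; split; [apply: nearN | apply: ratN].
  - move=> f Gf; split; last exact: rde.
    by rewrite eU //; apply: nearB => //; apply: near_act.
have D0 : (0 < #|Delta k2 s2|)%N := cardG_gt0 (Delta_grp k2 s2).
(* Write |Delta| = h p^a with h prime to p. Only h is divided out near the origin; p^a is undone at
   the end on l-power torsion. *)
have [h co eh] := pfactor_coprime p_prime D0; set a := logn p _ in eh.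
have h0 : (0 < h)%N by move: D0; rewrite eh muln_gt0 => /andP[].
have [k' [sk' kk' k'B rS' k'c]] := rat_adjoin_coords rS.
have cE' : coefs_in k' E by case: cE => *; split; apply: kk'.
have [R [nR rR eR]] := near_divisible VP s0 V1 V2 V3 V4 V6 p_prime pK r1 complete t0 mt
  sk' cE' (kk' _ ks) k'c nS rS' h0 co.
have rR1 : rat B1 R := rat_sub k'B rR.
have rR2 : rat B2 R := rat_sub B12 rR1.
(* Both sides are near the origin and agree after multiplication by h, which is injective there. *)
have eR' f : G2 f -> e f *+ (p ^ a)%N = act f R - R.
  move=> Gf; have ne : near (e f) by rewrite eU //; apply: nearB => //; apply: near_act.
  apply/eqP; rewrite -subr_eq0; apply/eqP.
  apply: (near_torsion VP s0 V1 V2 V3 V4 V6 p_prime pK r1 t0 mt _ h0 co).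
    by apply: nearB => //; [apply: nearMn | apply: nearB => //; apply: near_act].
  rewrite mulrnBl -mulrnA mulnC -eh hS // mulrnBl -(actMn sk2 cE2 Gf _ rR2) eR.
  by rewrite subrr.
have [|s3 [_ sub3 st3 _]] := gal_stable sk1 cl (s := s1); first exact: hs1.
have [|j hj] := uniform_torsion (c := d) st3 _ dt.
  by move=> f g Gf Gg fg; apply: dep => // z /sub3; exact: fg.
have [al hal] := inverse_mod (epoint E) (coprime_pl a j).
exists ((Q' *+ (p ^ a)%N + R) *+ al).
  by apply: ratMn => //; apply: ratD => //; apply: ratMn.
move=> f Gf; have rX : rat B2 (Q' *+ (p ^ a)%N).
  by apply: ratMn => //; [exact: (algcl_subfield sk2) | exact: (coefs_algcl sk2 cE2)].
have rY : rat B2 (Q' *+ (p ^ a)%N + R).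
  by apply: ratD => //; [exact: (algcl_subfield sk2) | exact: (coefs_algcl sk2 cE2)].
rewrite (actMn sk2 cE2 Gf _ rY) -mulrnBl (actD sk2 cE2 Gf rX rR2) (actMn sk2 cE2 Gf _ rQ2).
rewrite opprD addrACA -eR' // -mulrnBl -mulrnDl /e addrC subrK hal //.
exact: hj (resG Gf).
Qed.

Variable M0 : set K.
Hypotheses (M0B : M0 `<=` B1).
Hypothesis M0_dense : forall x a, k2 x -> a != 0 -> exists2 y, M0 y & V ((x - y) / a).
Hypothesis M0_stab : forall f x, G1 f -> M0 x -> M0 (f x).
Hypothesis M0_pro_p : forall f x, G1 f -> M0 x -> exists N, iter (p ^ N)%N f x = x.

(** Once the coboundary of the algebraic point is subtracted, the cocycle vanishes on G2. As k2 need
    not be algebraic over k1, the finite p-quotient is taken from the algebraic elements M0 that are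
    dense in k2. *)
Lemma splitting_point Q : rat B2 Q -> (forall f, G2 f -> d (res f) = act f Q - Q) ->
  exists2 Q0, rat B1 Q0 & forall f, G1 f -> d f = act f Q0 - Q0.
Proof.
move=> rQ hQ; have [Q' rQ' hQ'] := algebraic_splitting rQ hQ; have [rd hd] := dc.
pose c f := d f - (act f Q' - Q').
have [rq hq] := cobound_cocycle sk1 cE rQ'.
have cc : Gcocycle k1 G1 c.
  split=> [f Gf|f g Gf Gg]; first by apply: ratB => //; [exact: rd | exact: rq].
  by rewrite /c (hd _ _ Gf Gg) (hq _ _ Gf Gg) (actB sk1 cE Gf (rd _ Gg) (rq _ Gg)) opprD addrACA.
have [s1 [hs1 dep]] := gal_uniform sk1 cl dl.
pose s2 := s1 ++ coords Q'.
have hs2 z : z \in s2 -> B1 z by rewrite mem_cat => /orP[/hs1 //|]; exact: coords_rat.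
have depc f g : G1 f -> G1 g -> (forall z, z \in s2 -> f z = g z) -> c f = c g.
  move=> Gf Gg fg; rewrite /c (dep f g) // => [|z hz]; last by apply: fg; rewrite mem_cat hz.
  by rewrite (act_coords (f := f) (g := g)) // => z hz; apply: fg; rewrite mem_cat hz orbT.
have [s3 [hs3 ext]] := galois_extend pK cl sk1 sk2 k12 inf hs2.
(* Each x in s3 lies in k2 and is approximated by some y in M0; by Krasner's lemma, whatever fixes y
   fixes x. *)
have [s4 [hs4 kr]] : exists s4 : seq K, (forall y, y \in s4 -> M0 y) /\
    forall f, G1 f -> (forall y, y \in s4 -> f y = y) -> forall x, x \in s3 -> f x = x.
  elim: s3 hs3 {ext} => [|x s3 IH] hs3; first by exists [::].
  have [|s4 [hs4 kr]] := IH; first by move=> z hz; apply: hs3; rewrite inE hz orbT.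
  have [Bx kx] := hs3 _ (mem_head _ _).
  have [y My hy] := krasner VP r1 cl complete sk1 t0 mt kt k1c Bx M0B (fun a => M0_dense kx).
  exists (y :: s4); split=> [z|f Gf hf z]; rewrite inE => /orP[/eqP -> //|].
  - exact: hs4.
  - by apply: hy => //; apply: hf; rewrite mem_head.
  - by apply: kr => // z' hz'; apply: hf; rewrite inE hz' orbT.
have [|s5 [_ sub5 st5 hs5]] := gal_stable sk1 cl (s := s4); first by move=> z /hs4/M0B.
have dep5 : depends_on G1 s5 c.
  move=> f g Gf Gg fg; have [f' [Gf' e e']] := gal_inv sk1 Gf.
  have Gh := gal_comp Gf' Gg.
  have [|u Gu hu] := ext _ Gh.
    apply: kr => // y /sub5 hy /=; rewrite -fg //; exact: (congr1 (fun h => h y) e').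
  have -> : g = f \o (f' \o g).
    by apply/funext => z /=; rewrite -[LHS](congr1 (fun h => h (g z)) e).
  have [_ hc] := cc; rewrite hc //; have -> : c (f' \o g) = c (res u).
    apply: depc => //; first exact: resG.
    by move=> z hz; rewrite asboolT ?hu //; exact: hs2.
  by rewrite /c hQ' // act_res // subrr (act0 sk1 cE Gf) addr0.
have [S [rS hS _]] := average sk1 cE st5 cc dep5.
have [|a ha] := Delta_pgroup p_prime (k := k1) (s := s5).
  by move=> f z Gf /hs5[g [y [Gg /hs4 My ->]]]; apply: M0_pro_p => //; apply: M0_stab.
have [|s6 [_ sub6 st6 _]] := gal_stable sk1 cl (s := s1); first exact: hs1.
have [|j hj] := uniform_torsion (c := d) st6 _ dt.
  by move=> f g Gf Gg fg; apply: dep => // z /sub6; exact: fg.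
have [al hal] := inverse_mod (epoint E) (coprime_pl a j).
have rX : rat B1 (Q' *+ (p ^ a)%N) by apply: ratMn.
have rY : rat B1 (Q' *+ (p ^ a)%N + S) by apply: ratD.
exists ((Q' *+ (p ^ a)%N + S) *+ al); first exact: ratMn.
move=> f Gf.
rewrite (actMn sk1 cE Gf _ rY) -mulrnBl (actD sk1 cE Gf rX rS) (actMn sk1 cE Gf _ rQ').
rewrite opprD addrACA -hS // ha -mulrnBl -mulrnDl /c addrC subrK hal //.
exact: hj.
Qed.

(** Invariance of P = l^j Q0 puts its coordinates in a purely inseparable extension only. The
    multiple p^i P is rational or killed by 2, and the inverse [al] of p^i modulo l^j restores the
    cocycle. *)
Lemma local_descent Q : rat B2 Q -> (forall f, G2 f -> d (res f) = act f Q - Q) ->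
  exists Q0 j, [/\ rat B1 Q0, rat k1 (Q0 *+ (l ^ j)%N) & forall f, G1 f -> d f = act f Q0 - Q0].
Proof.
move=> rQ hQ; have [Q0 r0 h0] := splitting_point rQ hQ.
have [s1 [hs1 dep]] := gal_uniform sk1 cl dl.
have [|s6 [_ sub6 st6 _]] := gal_stable sk1 cl (s := s1); first exact: hs1.
have [|j hj] := uniform_torsion (c := d) st6 _ dt.
  by move=> f g Gf Gg fg; apply: dep => // z /sub6; exact: fg.
pose P := Q0 *+ (l ^ j)%N; have rP : rat B1 P by apply: ratMn.
have fixP f : G1 f -> act f P = P.
  move=> Gf; apply/eqP; rewrite -subr_eq0 /P (actMn sk1 cE Gf _ r0) -mulrnBl -h0 //.
  by rewrite hj.
have [e re] : exists e, rat (kroot p k1 e) P.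
  case eP : (pt P) => [[x y]|]; last by exists 0%N; rewrite /rat eP.
  move: rP fixP; rewrite /rat eP => -[Bx By w] fixP.
  have fx f : G1 f -> f x = x /\ f y = y.
    move=> Gf; have := pt_act sk1 cE Gf (P := P); rewrite fixP // eP /=.
    by rewrite /rat eP => /(_ (And3 Bx By w))[<- <-].
  have [e1 h1] := gal_fixed sk1 cl pK Bx (fun f Gf => (fx f Gf).1).
  have [e2 h2] := gal_fixed sk1 cl pK By (fun f Gf => (fx f Gf).2).
  have mono a b z : kroot p k1 a z -> kroot p k1 (a + b) z.
    by rewrite /kroot /= expnD exprM => h; apply: subX.
  exists (e1 + e2)%N; split=> //; first exact: mono.
  by rewrite addnC; apply: mono.
have [i hi] := kroot_mulp pK sk1 cE re.
have [al hal] := inverse_mod (epoint E) (coprime_pl i j).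
have tw (X : epoint E) : rat B1 X -> (forall f, G1 f -> act f X - X = d f *+ (p ^ i)%N) ->
    rat B1 (X *+ al) /\ forall f, G1 f -> d f = act f (X *+ al) - X *+ al.
  move=> rX hX; split=> [|f Gf]; first exact: ratMn.
  by rewrite (actMn sk1 cE Gf _ rX) -mulrnBl hX // hal // hj.
have rpi : rat B1 (Q0 *+ (p ^ i)%N) by apply: ratMn.
have dpi f : G1 f -> act f (Q0 *+ (p ^ i)%N) - Q0 *+ (p ^ i)%N = d f *+ (p ^ i)%N.
  by move=> Gf; rewrite (actMn sk1 cE Gf _ r0) -mulrnBl -h0.
have ec : Q0 *+ (p ^ i)%N *+ (l ^ j)%N = P *+ (p ^ i)%N by rewrite -!mulrnA mulnC.
case: hi => [hi|hi].
  have [rX hX] := tw _ rpi dpi; exists (Q0 *+ (p ^ i)%N *+ al), j; split=> //.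
  rewrite -mulrnA mulnC mulrnA ec; apply: ratMn => //.
(* Here p^i P is killed by 2. For l = 2 one more factor l removes it; for l odd it is invariant
   under l^j and the Galois group, so it can be subtracted. *)
have [l2|l2] := eqVneq l 2%N.
  have [rX hX] := tw _ rpi dpi; exists (Q0 *+ (p ^ i)%N *+ al), j.+1; split=> //.
  rewrite -mulrnA mulnC expnSr -mulnA mulrnA ec l2 mulrnA hi mul0rn.
  exact: rat0.
pose Y := P *+ (p ^ i)%N.
have rY : rat B1 Y by apply: ratMn.
have [||rX hX] := tw (Q0 *+ (p ^ i)%N - Y); first exact: ratB.
  move=> f Gf; rewrite (actB sk1 cE Gf rpi rY) (actMn sk1 cE Gf _ rP) fixP //.
  by rewrite opprB addrA subrK dpi.
exists ((Q0 *+ (p ^ i)%N - Y) *+ al), j; split=> //.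
rewrite -mulrnA mulnC mulrnA mulrnBl ec -/Y.
have -> : Y *+ (l ^ j)%N = Y.
  have odd_lj : odd (l ^ j) by rewrite oddX; case: (even_prime l_prime) l2 => [->|->]; rewrite ?orbT.
  rewrite -[(l ^ j)%N]odd_double_half odd_lj -muln2 mulnC mulrnDr mulr1n mulrnA.
  by rewrite hi mul0rn addr0.
by rewrite subrr mul0rn; exact: rat0.
Qed.
End LocalDescent.

(** * Cohomology classes *)

Section Classes.
Variables (K : fieldType) (k : set K) (E : ecurve K) (l : nat).
Hypotheses (sk : divring_closed [in k]) (cE : coefs_in k E).
Notation B := (algcl k).
Notation G := (galois_group (algcl k) k).
Notation A := (ltorsion E l (algcl k)).

Let sB : divring_closed [in B] := algcl_subfield sk.
Let cB : coefs_in B E := coefs_algcl sk cE.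

(** Cocycles with values in the group [epoint], to which group theory applies; [cocycleP] identifies
    them on G with the cocycles valued in raw points. *)
Definition tcocycle (c : (K -> K) -> epoint E) :=
  [/\ Gcocycle k G c, locally_constant G c & forall f, G f -> ltors l (c f)].

Definition tclass (c : (K -> K) -> epoint E) := coh_class E G A (@pt K E \o c).

Definition cohomologous (c c' : (K -> K) -> epoint E) :=
  exists2 T : epoint E, rat B T /\ ltors l T & forall f, G f -> c' f = c f + (act f T - T).

Lemma ltorsionP P : A P <-> exists T : epoint E, [/\ P = pt T, rat B T & ltors l T].
Proof.
split=> [[hP [n hn]]|[T [-> rT [n hn]]]].
  have h : points E setT P by case: (P) hP => [[x y] [? ? ?]|].
  exists (mkpt h); split=> //; exists n; apply: pt_inj; rewrite ptMn //.
by split=> //; exists n; rewrite -ptMn hn.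
Qed.

Lemma pt_coboundary f (T : epoint E) : G f -> rat B T -> coboundary E (pt T) f = pt (act f T - T).
Proof. by move=> Gf rT; rewrite /coboundary ptD ptN (pt_act sk cE Gf rT). Qed.

Lemma cocycleP c : cocycle E G A c <-> exists c', tcocycle c' /\ forall f, G f -> c f = pt (c' f).
Proof.
split=> [[h1 h2 h3]|[c' [[[r1 r2] r3 r4] h]]]; last first.
  split=> [f Gf|f g Gf Gg|f Gf].
  - by apply/ltorsionP; exists (c' f); split; [exact: h | exact: r1 | exact: r4].
  - by rewrite !h //; [rewrite r2 // ptD (pt_act sk cE Gf (r1 _ Gg)) | exact: gal_comp].
  - have [s hs] := r3 f Gf; exists s => g Gg fg; rewrite !h //; congr pt; exact: hs.
have /choice[c' hc] : forall f, exists T : epoint E, G f -> [/\ c f = pt T, rat B T & ltors l T].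
  move=> f; have [Gf|] := pselect (G f); last by exists 0.
  by have /ltorsionP[T hT] := h1 f Gf; exists T.
exists c'; split; last by move=> f /hc[].
split; last by move=> f /hc[].
- split=> [f /hc[]//|f g Gf Gg]; apply: pt_inj; have Gfg := gal_comp Gf Gg.
  have [e1 _ _] := hc _ Gf; have [e2 r2 _] := hc _ Gg; have [e3 _ _] := hc _ Gfg.
  by rewrite ptD (pt_act sk cE Gf r2) -e1 -e2 -e3 h2.
- move=> f Gf; have [s hs] := h3 f Gf; exists s => g Gg fg; apply: pt_inj.
  by have [<- _ _] := hc _ Gf; have [<- _ _] := hc _ Gg; apply: hs.
Qed.

Lemma coh_class_ext c c' : (forall f, G f -> c f = c' f) -> coh_class E G A c = coh_class E G A c'.
Proof.
move=> h; apply/seteqP; split=> d [hd [T hT e]]; split=> //; exists T => // f Gf.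
  by rewrite -h // e.
by rewrite h // e.
Qed.

Lemma tclassP c d : tclass c d <-> exists d', [/\ tcocycle d', forall f, G f -> d f = pt (d' f)
  & cohomologous c d'].
Proof.
split=> [[/cocycleP[d' [hd' e]] [_ /ltorsionP[T [-> rT lT]] h]]|[d' [hd' e [T [rT lT] h]]]].
  exists d'; split=> //; exists T => // f Gf; apply: pt_inj.
  by rewrite -e // h // ptD pt_coboundary.
split; first by apply/cocycleP; exists d'.
exists (pt T); first by apply/ltorsionP; exists T.
by move=> f Gf; rewrite e // h // ptD pt_coboundary.
Qed.

Lemma cohomologous_refl c : cohomologous c c.
Proof.
exists 0; first by split; [exact: rat0 | exact: ltors0].
by move=> f Gf; rewrite (act0 sk cE Gf) subr0 addr0.
Qed.

Lemma tclass_refl c : tcocycle c -> tclass c (@pt K E \o c).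
Proof. by move=> hc; apply/tclassP; exists c; split=> //; exact: cohomologous_refl. Qed.

Lemma cohomologous_sym c c' : cohomologous c c' -> cohomologous c' c.
Proof.
move=> [T [rT lT] h]; exists (- T); first by split; [exact: ratN | exact: ltorsN].
by move=> f Gf; rewrite h // (actN sk cE Gf rT) -opprD addrK.
Qed.

Lemma cohomologous_trans c1 c2 c3 : cohomologous c1 c2 -> cohomologous c2 c3 -> cohomologous c1 c3.
Proof.
move=> [T [rT lT] h] [T' [rT' lT'] h']; exists (T + T').
  by split; [exact: ratD | exact: ltorsD].
move=> f Gf; rewrite h' // h // (actD sk cE Gf rT rT') opprD -addrA; congr (_ + _).
by rewrite addrACA.
Qed.

Lemma tclass_eq c c' : tcocycle c' -> tclass c = tclass c' <-> cohomologous c c'.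
Proof.
move=> hc'; split=> [e|h].
  have := tclass_refl hc'; rewrite -e => /tclassP[d' [hd e' [T rT h]]].
  by exists T => // f Gf; rewrite -h //; apply: pt_inj; rewrite -e'.
apply/seteqP; split=> d /tclassP[d' [hd e hcd]]; apply/tclassP; exists d'; split=> //.
  exact: cohomologous_trans (cohomologous_sym h) hcd.
exact: cohomologous_trans h hcd.
Qed.

Lemma H1P X : H1 E G A X <-> exists2 c, tcocycle c & X = tclass c.
Proof.
split=> [[c /cocycleP[c' [hc e]] ->]|[c hc ->]].
  by exists c' => //; apply: coh_class_ext.
by exists (@pt K E \o c) => //; apply/cocycleP; exists c.
Qed.

Lemma tcocycleD c c' : tcocycle c -> tcocycle c' -> tcocycle (fun f => c f + c' f).
Proof.
move=> [[r1 h1] c1 t1] [[r2 h2] c2 t2]; split.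
- split=> [f Gf|f g Gf Gg]; first by apply: ratD => //; [exact: r1 | exact: r2].
  by rewrite h1 // h2 // (actD sk cE Gf (r1 _ Gg) (r2 _ Gg)) addrACA.
- move=> f Gf; have [s hs] := c1 f Gf; have [s' hs'] := c2 f Gf; exists (s ++ s') => g Gg fg.
  by rewrite (hs g) ?(hs' g) // => x hx; apply: fg; rewrite mem_cat hx ?orbT.
- by move=> f Gf; apply: ltorsD; [exact: t1 | exact: t2].
Qed.

Lemma H1_addE c c' : tcocycle c -> tcocycle c' ->
  H1_add E G A (tclass c) (tclass c') = tclass (fun f => c f + c' f).
Proof.
move=> hc hc'; have key d d' : tclass c d -> tclass c' d' ->
    coh_class E G A (fun f => padd E (d f) (d' f)) = tclass (fun f => c f + c' f).
  move=> /tclassP[d1 [hd e [T [rT lT] h]]] /tclassP[d2 [hd' e' [T' [rT' lT'] h']]].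
  rewrite [LHS](_ : _ = tclass (fun f => d1 f + d2 f)); last first.
    by apply: coh_class_ext => f Gf; rewrite e // e'.
  apply/esym/tclass_eq; first exact: tcocycleD.
  exists (T + T'); first by split; [exact: ratD | exact: ltorsD].
  move=> f Gf; rewrite h // h' // (actD sk cE Gf rT rT') opprD.
  by rewrite addrACA; congr (_ + _); rewrite addrACA.
apply/seteqP; split=> [d [x [y [hx hy hd]]]|d hd]; first by rewrite -(key _ _ hx hy).
exists (@pt K E \o c), (@pt K E \o c'); split; try exact: tclass_refl.
by rewrite key //; exact: tclass_refl.
Qed.

(** A torsion point T absorbs the coboundary between c and that of Q: c equals the coboundary of Q +
    T on the nose, at the price of a higher power of l. *)
Lemma kummerP c : tcocycle c ->
  (exists n P Q, [/\ points E k P, points E B Q, pmul E (l ^ n)%N Q = P &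
    tclass c = coh_class E G A (coboundary E Q)]) <->
  exists (Q : epoint E) n, [/\ rat B Q, rat k (Q *+ (l ^ n)%N) & forall f, G f -> c f = act f Q - Q].
Proof.
move=> hc; split=> [[n [P [Q [kP rQ eP e]]]]|[Q [n [rQ kQ h]]]]; last first.
  exists n, (pt (Q *+ (l ^ n)%N)), (pt Q); split=> //; first by rewrite ptMn.
  by apply: coh_class_ext => f Gf; rewrite pt_coboundary // -h.
have hQ : points E setT Q by case: (Q) rQ => [[x y] [? ? ?]|].
have {}rQ : rat B (mkpt hQ) by [].
have := tclass_refl hc; rewrite e => -[_ [_ /ltorsionP[T [-> rT [j hj]]] h]].
have kT : rat k (mkpt hQ *+ (l ^ n)%N) by rewrite /rat ptMn eP.
exists (mkpt hQ + T), (n + j)%N; split; first exact: ratD.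
  rewrite mulrnDl [T *+ _](ltors_mono (leq_addl n j) hj) addr0 expnD mulrnA.
  exact: ratMn.
move=> f Gf; apply/pt_inj/(etrans (h f Gf)).
have eQ : coboundary E Q f = pt (act f (mkpt hQ) - mkpt hQ) := pt_coboundary Gf rQ.
rewrite (pt_coboundary Gf rT) eQ -ptD; congr pt.
by rewrite (actD sk cE Gf rQ rT) opprD addrACA.
Qed.

End Classes.

Lemma pinv_left (K K' : Type) (f : K -> K') d x : injective f -> 'pinv_d setT f (f x) = x.
Proof. by move=> fi; apply: pinvKV; rewrite ?inE //; move=> y z _ _; apply: fi. Qed.

(** * Restriction and conjugation of classes *)

Section TowerClasses.
Variables (K : fieldType) (k1 k2 : set K) (E : ecurve K) (l : nat).
Hypotheses (cl : alg_closed K) (sk1 : divring_closed [in k1]) (sk2 : divring_closed [in k2]).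
Hypotheses (k12 : k1 `<=` k2) (cE : coefs_in k1 E) (alg : algcl k1 = setT).
Notation G1 := (galois_group (algcl k1) k1).
Notation G2 := (galois_group (algcl k2) k2).
Notation A2 := (ltorsion E l (algcl k2)).

Let alg2 : algcl k2 = setT.
Proof. by apply/seteqP; split=> // x _; apply: (algcl_sub k12); rewrite alg. Qed.
Let G21 f : G2 f -> G1 f.
Proof. by rewrite alg alg2 => -[h1 h2 h3 h4]; split=> // x /k12; apply: h3. Qed.
Let cE2 : coefs_in k2 E. Proof. by case: cE => *; split; apply: k12. Qed.
Let r1 (P : epoint E) : rat (algcl k1) P. Proof. by rewrite alg; exact: ptP. Qed.
Let r2 (P : epoint E) : rat (algcl k2) P. Proof. by rewrite alg2; exact: ptP. Qed.

Lemma tcocycle_res c : tcocycle k1 l c -> tcocycle k2 (E := E) l c.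
Proof.
move=> [[_ h] lc tc]; split; last by move=> f /G21; exact: tc.
- by split=> // f g /G21 Gf /G21 Gg; exact: h.
- by move=> f /G21 Gf; have [s hs] := lc f Gf; exists s => g /G21; exact: hs.
Qed.

Lemma cohomologous_res c c' : cohomologous k1 l c c' -> cohomologous k2 (E := E) l c c'.
Proof. by move=> [T [_ lT] h]; exists T => // f /G21; exact: h. Qed.

Lemma H1_resE c : tcocycle k1 l c ->
  H1_res E G2 A2 (tclass k1 l c) = tclass k2 (E := E) l c.
Proof.
move=> hc; have key d : tclass k1 l c d -> coh_class E G2 A2 d = tclass k2 l c.
  move=> /(tclassP l sk1 cE)[d' [hd e h]].
  rewrite (coh_class_ext E l (c' := @pt K E \o d')); last by move=> f /G21; exact: e.
  apply/esym/(tclass_eq sk2 cE2); first exact: tcocycle_res.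
  exact: cohomologous_res.
apply/seteqP; split=> [d [x hx hd]|d hd]; first by rewrite -(key _ hx).
exists (@pt K E \o c); first exact: (tclass_refl sk1 cE).
by rewrite key //; exact: (tclass_refl sk1 cE).
Qed.

Hypothesis k2stab : forall f x, G1 f -> k2 x -> k2 (f x).

Section Conjugation.
Variables (g g' : K -> K).
Hypotheses (Gg : G1 g) (Gg' : G1 g') (gK : g \o g' = id) (g'K : g' \o g = id).

Let gKx x : g (g' x) = x. Proof. exact: (congr1 (fun h => h x) gK). Qed.
Let g'Kx x : g' (g x) = x. Proof. exact: (congr1 (fun h => h x) g'K). Qed.

Lemma conj_gal f : G2 f -> G2 (g' \o f \o g).
Proof.
move=> Gf; have := gal_comp (gal_comp Gg' (G21 Gf)) Gg; rewrite alg alg2 => -[h1 h2 h3 h4].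
by split=> // x kx /=; rewrite (gal_fix Gf (k2stab Gg kx)) g'Kx.
Qed.

Definition conj_cocycle (c : (K -> K) -> epoint E) f := act g (c (g' \o f \o g)).

Let actg_comp f (P : epoint E) : G1 f -> act g (act (g' \o f \o g) P) = act f (act g P).
Proof.
move=> Gf; have Gc := gal_comp (gal_comp Gg' Gf) Gg.
rewrite -(act_comp sk1 cE Gg Gc (r1 P)) -(act_comp sk1 cE Gf Gg (r1 P)); congr act.
by apply/funext => x /=; rewrite gKx.
Qed.

Lemma tcocycle_conj c : tcocycle k2 l c -> tcocycle k2 l (conj_cocycle c).
Proof.
move=> [[_ h] lc tc]; split.
- split=> // f f' Gf Gf'; have [Gc Gc'] := (conj_gal Gf, conj_gal Gf').
  rewrite /conj_cocycle -(actg_comp _ (G21 Gf)).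
  have -> : g' \o (f \o f') \o g = (g' \o f \o g) \o (g' \o f' \o g).
    by apply/funext => x /=; rewrite gKx.
  by rewrite h // (actD sk1 cE Gg (r1 _) (r1 _)).
- move=> f Gf; have [s hs] := lc _ (conj_gal Gf); exists (map g s) => f' Gf' ff'.
  rewrite /conj_cocycle (hs (g' \o f' \o g)) //; first exact: conj_gal.
  by move=> x xs /=; rewrite ff' // map_f.
- move=> f Gf; have [n hn] := tc _ (conj_gal Gf); exists n.
  by rewrite -(actMn sk1 cE Gg _ (r1 _)) hn (act0 sk1 cE Gg).
Qed.

Lemma H1_conjE c : tcocycle k2 l c ->
  H1_conj E G2 A2 g (tclass k2 l c) = tclass k2 l (conj_cocycle c).
Proof.
move=> hc; have key d : tclass k2 l c d -> coh_class E G2 A2 (fun f =>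
    map_point g (d ('pinv_(fun=> 0) setT g \o f \o g))) = tclass k2 l (conj_cocycle c).
  move=> /(tclassP l sk2 cE2)[d' [hd e [T [_ lT] h]]].
  have ginj : injective g := can_inj g'Kx.
  rewrite (coh_class_ext E l (c' := @pt K E \o conj_cocycle d')); last first.
    move=> f Gf; have -> : 'pinv_(fun=> 0) setT g \o f \o g = g' \o f \o g.
      by apply/funext => x /=; rewrite -{1}[f (g x)]gKx pinv_left.
    by rewrite (e _ (conj_gal Gf)) -(pt_act sk1 cE Gg (r1 _)).
  apply/esym/(tclass_eq sk2 cE2); first exact: tcocycle_conj.
  exists (act g T).
    split=> //; have [n hn] := lT; exists n.
    by rewrite -(actMn sk1 cE Gg _ (r1 _)) hn (act0 sk1 cE Gg).
  move=> f Gf; rewrite /conj_cocycle h; last exact: conj_gal.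
  rewrite (actD sk1 cE Gg (r1 _) (r1 _)) (actB sk1 cE Gg (r1 _) (r1 _)).
  by rewrite (actg_comp _ (G21 Gf)).
apply/seteqP; split=> [d [x hx hd]|d hd]; first by rewrite -(key _ hx).
exists (@pt K E \o c); first exact: (tclass_refl sk2 cE2).
by rewrite key //; exact: (tclass_refl sk2 cE2).
Qed.

(* A class coming from k1 is fixed by conjugation: g c(g^-1 f g) = c(f) + (f - 1) c(g). *)
Lemma conj_cohomologous c : tcocycle k1 l c -> cohomologous k2 l c (conj_cocycle c).
Proof.
move=> [[_ h] _ tc]; exists (c g); first by split=> //; exact: tc.
move=> f /G21 Gf; have Gfg := gal_comp Gf Gg; rewrite /conj_cocycle.
have -> : g' \o f \o g = g' \o (f \o g) by [].
rewrite h // (actD sk1 cE Gg (r1 _) (r1 _)).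
have -> : act g (c g') = - c g.
  apply/eqP; rewrite -addr_eq0 addrC -h // gK; apply/eqP.
  by have hG : Gcocycle k1 G1 c; [split | exact: (Gcocycle1 hG)].
rewrite -(act_comp sk1 cE Gg Gg' (r1 _)) gK (act_id (c (f \o g))) h //.
by rewrite addrC -addrA.
Qed.
End Conjugation.
End TowerClasses.

(** * Localization of classes at a place *)

Section Localization.
Variables (K0 : fieldType) (V0 : set K0) (K : completion V0) (k0 : set K0) (l : nat).
Variables (E0 : ecurve K0) (E1 : ecurve K).
Hypotheses (V0P : is_place setT V0) (cl0 : alg_closed K0) (cl : alg_closed K).
Hypotheses (sk0 : divring_closed [in k0]) (alg0 : algcl k0 = setT) (cE0 : coefs_in k0 E0).
Notation em := (compl_emb K).
Hypothesis EE : map_curve em E0 = E1.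
Notation k := (@closure_of _ _ K k0).
Notation B := (algcl (@closure_of _ _ K k0)).
Notation G0 := (galois_group (algcl k0) k0).
Notation G := (galois_group (algcl (@closure_of _ _ K k0)) (@closure_of _ _ K k0)).

Let sk : divring_closed [in k] := closure_subfield K V0P sk0.
Let sT : divring_closed [in [set: K0]] := subfield_setT K0.
Let emP : partial_hom setT em := rmorph_partial_hom em.
Let cT : coefs_in setT E0. Proof. by []. Qed.
Let ratT (P : epoint E0) : rat setT P. Proof. exact: ptP. Qed.
Let rB (P : epoint E0) : rat (algcl k0) P. Proof. by rewrite alg0; exact: ptP. Qed.
Let emk y : k0 y -> k (em y). Proof. exact: closure_emb. Qed.

Lemma coefs_closure : coefs_in k E1.
Proof. by rewrite -EE; case: cE0 => *; split; apply: emk. Qed.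
Let cE1 := coefs_closure.

Lemma map_poly_closure q : poly_in k0 q -> poly_in k (map_poly em q).
Proof. by move=> hq i; rewrite coef_map; apply: emk. Qed.

Lemma algcl_emb x : B (em x).
Proof.
have [q [q0 hq rq]] : algcl k0 x by rewrite alg0.
exists (map_poly em q); split; first by rewrite map_poly_eq0.
  exact: map_poly_closure.
by rewrite fmorph_root.
Qed.

Definition resloc (f : K -> K) : K0 -> K0 := 'pinv_(fun=> 0) setT em \o f \o em.

Lemma emb_inj : injective em. Proof. exact: fmorph_inj. Qed.

(** f (em x) is a root of a polynomial over k0, which splits in K0; so it lies in the image of em,
    where the partial inverse in [resloc] is meaningful. *)
Lemma resloc_emb f x : G f -> em (resloc f x) = f (em x).
Proof.
move=> Gf; have [q [q0 hq rq]] : algcl k0 x by rewrite alg0.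
have rq' : root (map_poly em q) (f (em x)).
  apply: (gal_root sk Gf (map_poly_closure hq) (algcl_emb x)).
  by rewrite fmorph_root.
have [rs ers] := poly_splits cl0 q0; move: rq'; rewrite ers map_polyZ rmorph_prod /=.
rewrite rootZ ?fmorph_eq0 ?lead_coef_eq0 //.
have -> : \prod_(r <- rs) map_poly em ('X - r%:P) = \prod_(r <- map em rs) ('X - r%:P).
  by rewrite big_map; apply: eq_bigr => r _; rewrite map_polyXsubC.
rewrite root_prod_XsubC => /mapP[r _ er].
by rewrite /resloc /= er pinv_left //; exact: emb_inj.
Qed.

Lemma resloc_comp f g : G f -> G g -> resloc (f \o g) = resloc f \o resloc g.
Proof.
move=> Gf Gg; apply/funext => x; apply: emb_inj.
by rewrite (resloc_emb _ (gal_comp Gf Gg)) /= (resloc_emb _ Gf) (resloc_emb _ Gg).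
Qed.

Lemma resloc_gal f : G f -> G0 (resloc f).
Proof.
move=> Gf; have [f' [Gf' e e']] := gal_inv sk Gf; have fP := gal_phom sk Gf.
have sB := algcl_subfield sk.
rewrite alg0; split.
- split=> //.
    by move=> x y _ _ /(congr1 em); rewrite !resloc_emb // => /(gal_inj Gf)/emb_inj.
  move=> y _; exists (resloc f' y) => //; apply: emb_inj; rewrite !resloc_emb //.
  exact: (congr1 (fun h => h (em y)) e).
- move=> x y _ _; split; apply: emb_inj; rewrite ?(rmorphD, rmorphM) /= !resloc_emb //.
    by rewrite rmorphD (phomD fP); try exact: algcl_emb.
  by rewrite rmorphM (phomM fP); try exact: algcl_emb.
- by move=> x kx; apply: emb_inj; rewrite resloc_emb // (gal_fix Gf (emk kx)).
- by move=> x [].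
Qed.

Definition embed : epoint E0 -> epoint E1 := pmap E1 em.

Lemma pt_embed P : pt (embed P) = map_point em (pt P).
Proof. exact: (pt_pmap sT emP cT EE (ratT P)). Qed.

Lemma rat_embed P : rat B (embed P).
Proof.
have := ptP (embed P); rewrite /rat pt_embed; case: (pt P) => [[x y]|] //= [_ _ e].
by split=> //; exact: algcl_emb.
Qed.

Lemma act_embed f P : G f -> act f (embed P) = embed (act (resloc f) P).
Proof.
move=> Gf; apply: pt_inj; rewrite (pt_act sk cE1 Gf (rat_embed P)) !pt_embed.
rewrite (pt_act sk0 cE0 (resloc_gal Gf) (rB P)); case: (pt P) => [[x y]|] //=.
by rewrite !resloc_emb.
Qed.

Definition local_cocycle (c : (K0 -> K0) -> epoint E0) (f : K -> K) := embed (c (resloc f)).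

Lemma tcocycle_local c : tcocycle k0 l c -> tcocycle k l (local_cocycle c).
Proof.
move=> [[_ h] lc tc]; split.
- split=> [f _|f g Gf Gg]; first exact: rat_embed.
  rewrite /local_cocycle resloc_comp // h; try exact: resloc_gal.
  rewrite /embed (pmapD sT emP cT EE (ratT _) (ratT _)) -/embed; congr (_ + _).
  by rewrite act_embed.
- move=> f Gf; have [s hs] := lc _ (resloc_gal Gf); exists (map em s) => g Gg fg.
  rewrite /local_cocycle (hs (resloc g)) //; first exact: resloc_gal.
  by move=> x xs; apply: emb_inj; rewrite !resloc_emb // fg // map_f.
- move=> f Gf; have [n hn] := tc _ (resloc_gal Gf); exists n.
  by rewrite /local_cocycle /embed -(pmapMn sT emP cT EE _ (ratT _)) hn (pmap0 sT emP cT EE).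
Qed.

Lemma localizationE c : tcocycle k0 l c ->
  [set d | exists2 x, tclass k0 l c x & coh_class E1 G (ltorsion E1 l B)
    (fun f => map_point em (x ('pinv_(fun=> 0) setT em \o f \o em))) d]
  = tclass k l (local_cocycle c).
Proof.
move=> hc; have key d : tclass k0 l c d -> coh_class E1 G (ltorsion E1 l B)
    (fun f => map_point em (d ('pinv_(fun=> 0) setT em \o f \o em))) = tclass k l (local_cocycle c).
  move=> /(tclassP l sk0 cE0)[d' [hd e [T [_ lT] h]]].
  rewrite (coh_class_ext E1 l (c' := @pt K E1 \o local_cocycle d')); last first.
    by move=> f Gf; rewrite [d _](e _ (resloc_gal Gf)) -pt_embed.
  apply/esym/(tclass_eq sk cE1); first exact: tcocycle_local.
  exists (embed T).
    split; first exact: rat_embed.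
    by have [n hn] := lT; exists n; rewrite /embed -(pmapMn sT emP cT EE _ (ratT _)) hn (pmap0 sT emP cT EE).
  move=> f Gf; rewrite /local_cocycle h; last exact: resloc_gal.
  rewrite act_embed // /embed (pmapD sT emP cT EE (ratT _) (ratT _)).
  by rewrite (pmapB sT emP cT EE (ratT _) (ratT _)).
apply/seteqP; split=> [d [x hx hd]|d hd]; first by rewrite -(key _ hx).
exists (@pt K0 E0 \o c); first exact: (tclass_refl sk0 cE0).
by rewrite key //; exact: (tclass_refl sk0 cE0).
Qed.

End Localization.

(** If w contained k, every element of K, being algebraic over k, would be integral over w, and w
    would be all of K. *)
Lemma is_place_restrict (K : fieldType) (w : place K) (k : set K) :
  divring_closed [in k] -> algcl k = setT -> is_place k (w `&` k).
Proof.
move=> sk alg; have wP := place_ringP w; split.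
- by move=> x [].
- split.
  + by apply/mem_set; split; [exact: (val1 wP) | exact: (sub1 sk)].
  + move=> x y /set_mem[wx kx] /set_mem[wy ky]; apply/mem_set.
    by split; [exact: (valB wP) | exact: (subB sk)].
  + move=> x y /set_mem[wx kx] /set_mem[wy ky]; apply/mem_set.
    by split; [exact: (valM wP) | exact: (subM sk)].
- by move=> x kx; case: (val_total wP x) => h; [left | right]; split=> //; exact: (subV sk).
- move=> e; have kw x : k x -> (w : set K) x by rewrite -e => -[].
  have [_ _ _ nT] := wP; apply: nT; apply/seteqP; split=> // x _.
  have [q [q0 hq rx]] : algcl k x by rewrite alg.
  apply: (val_integral wP (q := (lead_coef q)^-1 *: q)).
  + by rewrite monicE lead_coefZ mulVf // lead_coef_eq0.
  + by move=> i; rewrite coefZ; apply/kw/(subM sk) => //; apply: (subV sk); apply: hq.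
  + by rewrite rootZ // invr_eq0 lead_coef_eq0.
Qed.

(** * Selmer groups in a pro-p tower *)

Section SelmerTower.
Variables (K0 : fieldType) (C : forall w : place K0, completion w) (p l : nat).
Variables (E0 : ecurve K0) (k1 k2 : set K0).
Hypotheses (cl0 : alg_closed K0) (pK : p \in [pchar K0]).
Hypotheses (l_prime : prime l) (l_neq_p : l != p).
Hypotheses (sk1 : divring_closed [in k1]) (sk2 : divring_closed [in k2]) (k12 : k1 `<=` k2).
Hypotheses (inf : infinite_field k1) (cE : coefs_in k1 E0) (alg : algcl k1 = setT).
Notation G1 := (galois_group (algcl k1) k1).
Notation G2 := (galois_group (algcl k2) k2).
Notation kw k w := (@closure_of _ _ (C w) k).
Notation Gw k w := (galois_group (algcl (@closure_of _ _ (C w) k)) (@closure_of _ _ (C w) k)).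
Notation Vw w := (@compl_ring _ _ (C w)).
Hypothesis k2stab : forall f x, G1 f -> k2 x -> k2 (f x).
Hypothesis k2pro_p : forall f x, G1 f -> k2 x -> exists N, iter (p ^ N)%N f x = x.
Hypothesis rank1 : forall w : place K0, rank_one (w : set K0).

Implicit Type c : (K0 -> K0) -> epoint E0.

Let alg2 : algcl k2 = setT.
Proof. by apply/seteqP; split=> // x _; apply: (algcl_sub k12); rewrite alg. Qed.
Let cE2 : coefs_in k2 E0. Proof. by case: cE => *; split; apply: k12. Qed.

Let local_nz (w : place K0) : disc (map_curve (compl_emb (C w)) E0) != 0.
Proof.
by rewrite (disc_map (subfield_setT K0) (rmorph_partial_hom _)) ?fmorph_eq0 ?curve_nz.
Qed.

Let Ew (w : place K0) : ecurve (C w) := Ecurve (local_nz w).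

(** The Kummer condition at w for a cocycle itself instead of its class, in the form provided by
    [kummerP]. *)
Definition locally_kummer (k : set K0) (c : (K0 -> K0) -> epoint E0) (w : place K0) :=
  exists (Q : epoint (Ew w)) n, [/\ rat (algcl (kw k w)) Q,
    rat (kw k w) (Q *+ (l ^ n)%N) &
    forall f, Gw k w f ->
      local_cocycle (Ew w) c f = act f Q - Q].

Let kummer_local (k : set K0) c w : divring_closed [in k] -> algcl k = setT ->
  coefs_in k E0 -> tcocycle k l c ->
  kummer_image E0 l k (@localization _ C E0 l w k (tclass k l c)) <-> locally_kummer k c w.
Proof.
move=> sk algk cEk hc; have wP := place_ringP w.
have sc := closure_subfield (C w) wP sk.
have cc := coefs_closure (E1 := Ew w) cEk erefl.
have hl := tcocycle_local wP cl0 sk algk cEk (erefl : _ = Ew w :> weierstrass _) hc.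
have e := localizationE wP cl0 sk algk cEk (erefl : _ = Ew w :> weierstrass _) hc.
have h := kummerP sc cc hl.
by rewrite /locally_kummer -h -e.
Qed.

(** Every place w of the closure restricts to a place of k, so the conditions at the places of k
    amount to one condition for each w. *)
Lemma selmerP (k : set K0) X : divring_closed [in k] -> algcl k = setT -> coefs_in k E0 ->
  selmer C E0 l k X <-> exists c, [/\ tcocycle k l c, X = tclass k l c &
    forall w, locally_kummer k c w].
Proof.
move=> sk algk cEk; rewrite /selmer -algk; split=> [[/(H1P l sk cEk)[c hc eX] h]|[c [hc eX h]]].
  exists c; split=> // w; apply/kummer_local => //; rewrite -eX.
  by apply: (h _ (is_place_restrict w sk algk)).
split; first by apply/(H1P l sk cEk); exists c.
by move=> v _ w _; rewrite eX; apply/kummer_local.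
Qed.

Lemma selmer_resE c : tcocycle k1 l c -> selmer_res E0 l k2 (tclass k1 l c) = tclass k2 l c.
Proof. by move=> hc; rewrite /selmer_res -alg2 H1_resE. Qed.

Let res_resloc w (f : C w -> C w) :
  resloc (fun x => if `[< algcl (kw k1 w) x >] then f x else x) = resloc f.
Proof. by apply/funext => x; rewrite /resloc /= asboolT //; apply: algcl_emb. Qed.

Let closure12 w : kw k1 w `<=` kw k2 w.
Proof. by move=> x h a a0; have [y /k12 ky hy] := h a a0; exists y. Qed.

Lemma locally_kummer_res c w : locally_kummer k1 c w -> locally_kummer k2 c w.
Proof.
have wP := place_ringP w; have clw := compl_alg_closed (K := C w) wP (@rank1 w) cl0.
move=> [Q [n [rQ kQ h]]]; exists Q, n; split.
- by apply: rat_sub rQ; apply: algcl_sub; exact: closure12.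
- by apply: rat_sub kQ; exact: closure12.
- move=> f Gf; rewrite -(act_res f rQ) -h.
    by rewrite /local_cocycle res_resloc.
  exact: (gal_restrict clw (closure_subfield _ wP sk1) (closure_subfield _ wP sk2) (@closure12 w) Gf).
Qed.

Lemma locally_kummer_descent c w : tcocycle k1 l c -> locally_kummer k2 c w ->
  locally_kummer k1 c w.
Proof.
move=> hc [Q [n [rQ kQ h]]].
have wP := place_ringP w; have wr := @rank1 w.
have VP := compl_ringP (C w); have clw := compl_alg_closed (K := C w) wP wr cl0.
have r1 := compl_rank_one (K := C w) wP wr.
have sc1 := closure_subfield (C w) wP sk1; have sc2 := closure_subfield (C w) wP sk2.
have cc := coefs_closure (E1 := Ew w) cE erefl.
have [[gc hgc] lc tc] := tcocycle_local wP cl0 sk1 alg cE (erefl : _ = Ew w :> weierstrass _) hc.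
have pKw : p \in [pchar C w] := rmorph_pchar (compl_emb (C w)) pK.
have infw : infinite_field (kw k1 w).
  move=> rs; have [u ku hu] := inf (map ('pinv_(fun=> 0) setT (compl_emb (C w))) rs).
  exists (compl_emb (C w) u); first exact: closure_emb.
  apply: contra hu => hu; apply/mapP; exists (compl_emb (C w) u) => //.
  by rewrite pinv_left //; exact: fmorph_inj.
have [t kt [t0 mt]] : exists2 t, kw k1 w t & t != 0 /\
    maximal_ideal (Vw w) t.
  apply: closure_small.
  (* The place restricted to k1 is nontrivial, so k1 has a nonintegral element; its inverse is
     small. *)
  have [x kx nx] : exists2 x, k1 x & ~ (w : set K0) x.
    have [_ _ _ ne] := is_place_restrict w sk1 alg; apply: contrapT => no; apply: ne.
    apply/seteqP; split=> [x []//|x kx]; split=> //; apply: contrapT => nx.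
    by apply: no; exists x.
  exists x^-1; first exact: (subV sk1).
  split; last exact: (mideal_inv wP).
  by rewrite invr_eq0; apply/eqP => x0; apply: nx; rewrite x0; apply: (val0 wP).
have Vt N : Vw w (t ^+ N) by apply: (valX VP); case: mt.
(* By rank one some power of t clears the denominators of all coefficients; it is taken as the
   scaling s. *)
have [N hN] : exists N, forall a, a \in [:: a1 (Ew w); a2 (Ew w); a3 (Ew w); a4 (Ew w); a6 (Ew w)] ->
    Vw w (t ^+ N * a).
  elim: [:: a1 _; _; _; _; _] => [|a rs [N hN]]; first by exists 0.
  have [N' hN'] : exists N', Vw w (t ^+ N' * a).
    have [->|a0] := eqVneq a 0; first by exists 0; rewrite mulr0; apply: (val0 VP).
    have [|N' hN'] := r1 a^-1 t _ mt; first by rewrite invr_eq0.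
    by exists N'; rewrite invrK in hN'.
  exists (N + N')%N => b; rewrite inE exprD => /orP[/eqP -> | /hN hb].
    by rewrite -mulrA; apply: (valM VP).
  by rewrite mulrAC; apply: (valM VP).
pose s := t ^+ N; have s0 : s != 0 by apply: expf_neq0.
have ks : kw k1 w s by apply: (subX sc1).
have Vs i a : a \in [:: a1 (Ew w); a2 (Ew w); a3 (Ew w); a4 (Ew w); a6 (Ew w)] ->
    Vw w (s ^+ i.+1 * a).
  by move=> /hN ha; rewrite exprSr -mulrA; apply: (valM VP) => //; apply: (valX VP); apply: Vt.
have [h1 h2 h3 h4 h6] : [/\ Vw w (s * a1 (Ew w)),
   Vw w (s ^+ 2 * a2 (Ew w)), Vw w (s ^+ 3 * a3 (Ew w)),
   Vw w (s ^+ 4 * a4 (Ew w)) & Vw w (s ^+ 6 * a6 (Ew w))].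
  by split; [rewrite -[s]expr1|..]; apply: Vs; rewrite !inE eqxx ?orbT.
(* The image of the algebraically closed field K0 serves as [B0]: it is dense and solves quadratic
   equations. *)
have remb := range_subfield (compl_emb (C w)).
have B01 : range (compl_emb (C w)) `<=` algcl (kw k1 w).
  by move=> _ [x _ <-]; apply: algcl_emb.
have cB0 : coefs_in (range (compl_emb (C w))) (Ew w).
  by split; [exists (a1 E0) | exists (a2 E0) | exists (a3 E0) | exists (a4 E0) | exists (a6 E0)].
have quad0 u v : range (compl_emb (C w)) u -> range (compl_emb (C w)) v ->
    exists2 r, range (compl_emb (C w)) r & r ^+ 2 + u * r + v = 0.
  move=> [x _ <-] [y _ <-]; have sq : size (Poly [:: y; x; 1]) = 3%N.
    by rewrite (PolyK (c := 0)) //= oner_eq0.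
  have [|r /rootP rr] := cl0 (q := Poly [:: y; x; 1]); first by rewrite sq.
  exists (compl_emb (C w) r); first by exists r.
  rewrite -rmorphXn -!rmorphM -!rmorphD -[RHS](rmorph0 (compl_emb (C w))) -rr; congr (compl_emb (C w) _).
  by rewrite horner_Poly /=; ring.
have dense0 (x a : C w) : a != 0 -> exists2 y, range (compl_emb (C w)) y &
    Vw w ((x - y) / a).
  by move=> a0; have [y hy] := compl_dense x a0; exists (compl_emb (C w) y) => //; exists y.
(* The image of k2 is dense in its closure and consists of elements algebraic over the closure of
   k1, as Krasner's lemma requires. *)
pose M0 : set (C w) := compl_emb (C w) @` k2.
have M0B : M0 `<=` algcl (kw k1 w).
  by move=> _ [x _ <-]; apply: algcl_emb.
have M0d (x a : C w) : kw k2 w x -> a != 0 -> exists2 y, M0 y &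
    Vw w ((x - y) / a).
  by move=> hx a0; have [y ky hy] := hx a a0; exists (compl_emb (C w) y) => //; exists y.
have M0s f x : Gw k1 w f ->
    M0 x -> M0 (f x).
  move=> Gf [y ky <-]; rewrite -(resloc_emb wP cl0 sk1 alg _ Gf); exists (resloc f y) => //.
  by apply: k2stab => //; exact: (resloc_gal wP cl0 sk1 alg Gf).
have M0p f x : Gw k1 w f ->
    M0 x -> exists N, iter (p ^ N)%N f x = x.
  move=> Gf [y ky <-]; have [n0 hn0] := k2pro_p (resloc_gal wP cl0 sk1 alg Gf) ky; exists n0.
  rewrite -[in RHS]hn0; elim: (p ^ n0)%N => [|j IH] //.
  by rewrite !iterS IH (resloc_emb wP cl0 sk1 alg _ Gf).
have hQ f : Gw k2 w f ->
    local_cocycle (Ew w) c (fun x => if `[< algcl (kw k1 w) x >] then f x else x)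
    = act f Q - Q.
  by move=> Gf; rewrite /local_cocycle res_resloc -h.
have [Q0 [j [rQ0 kQ0 hQ0]]] := local_descent VP r1 clw
  (fun r hr => cauchy_limit hr) pKw l_prime l_neq_p sc1 sc2 (@closure12 w) infw cc
  (fun r x hr hx => closure_limit hr hx) (fun r x hr hx => closure_limit hr hx)
  t0 mt kt s0 ks h1 h2 h3 h4 h6 remb B01 cB0 quad0 dense0 (conj gc hgc) lc tc
  M0B M0d M0s M0p rQ hQ.
by exists Q0, j.
Qed.

Lemma restrict_gal g g' : G1 g -> G1 g' -> g \o g' = id -> g' \o g = id ->
  galois_group k2 k1 (fun x => if `[< k2 x >] then g x else x).
Proof.
move=> Gg Gg' e e'; split.
- split=> [x kx|x y /set_mem kx /set_mem ky|y ky].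
  + by rewrite asboolT //; apply: k2stab.
  + by rewrite !asboolT // => /(gal_inj Gg).
  + have ky' := k2stab Gg' ky; exists (g' y) => //; rewrite asboolT //.
    exact: (congr1 (fun h => h y) e).
- move=> x y kx ky; have gP := gal_phom sk1 Gg.
  rewrite !asboolT //; [|exact: (subM sk2)|exact: (subD sk2)].
  by rewrite (phomD gP) ?(phomM gP) // alg.
- by move=> x kx; rewrite asboolT ?(gal_fix Gg kx) //; exact: k12.
- by move=> x nx; rewrite asboolF.
Qed.

Lemma selmer_bij :
  set_bij (selmer C E0 l k1) (selmer_invariants C E0 l k1 k2) (selmer_res E0 l k2).
Proof.
split.
- move=> X /(selmerP _ sk1 alg cE)[c [hc -> h]]; rewrite selmer_resE //.
  have hc2 := tcocycle_res k12 alg hc.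
  split; first by apply/(selmerP _ sk2 alg2 cE2); exists c; split=> // w; exact: locally_kummer_res.
  move=> gamma g _ Gg _; rewrite -alg in Gg; have [g' [Gg' e e']] := gal_inv sk1 Gg.
  rewrite -alg2 (H1_conjE sk1 sk2 k12 cE alg k2stab Gg Gg' e e' hc2).
  apply/esym/(tclass_eq sk2 cE2); first exact: (tcocycle_conj sk1 k12 cE alg k2stab Gg Gg' e e' hc2).
  exact: (conj_cohomologous sk1 k12 cE alg Gg Gg' e hc).
- move=> X Y /set_mem/(selmerP _ sk1 alg cE)[c [hc -> _]].
  move=> /set_mem/(selmerP _ sk1 alg cE)[c' [hc' -> _]]; rewrite !selmer_resE //.
  move=> /(tclass_eq sk2 cE2 _ (tcocycle_res k12 alg hc'))[T [rT lT] h].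
  have rA (P : epoint E0) : rat (algcl k1) P by rewrite alg; exact: ptP.
  (* T makes the two cocycles cohomologous over k2, so d vanishes on G2 and [infres_inj] applies. *)
  pose d f := c' f - (c f + (act f T - T)).
  have [[_ h1] l1 t1] := hc; have [[_ h1'] l1' t1'] := hc'.
  have [_ hT] := cobound_cocycle sk1 cE (rA T).
  have dc : Gcocycle k1 G1 d.
    split=> // f g Gf Gg; have -> : act f (d g) = act f (c' g) - (act f (c g) + act f (act g T - T)).
      by rewrite (actB sk1 cE Gf (rA (c' g)) (rA _)) (actD sk1 cE Gf (rA (c g)) (rA _)).
    by rewrite /d h1 // h1' // hT // [c f + _ + _]addrACA opprD addrACA.
  have dl : locally_constant G1 d.
    move=> f Gf; have [s hs] := l1 f Gf; have [s' hs'] := l1' f Gf.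
    exists (s ++ s' ++ coords T) => f' Gf' ff'; rewrite /d (hs f') // ?(hs' f') //.
    + rewrite (act_coords (f := f') (g := f)) // => x hx; apply: ff'.
      by rewrite !mem_cat hx !orbT.
    + by move=> x hx; apply: ff'; rewrite !mem_cat hx !orbT.
    + by move=> x hx; apply: ff'; rewrite !mem_cat hx.
  have dt f : G1 f -> ltors l (d f).
    move=> Gf; apply: ltorsD; first exact: t1'.
    apply/ltorsN/ltorsD; first exact: t1.
    apply: ltorsD; last exact: ltorsN.
    by have [n hn] := lT; exists n; rewrite -(actMn sk1 cE Gf _ (rA _)) hn (act0 sk1 cE Gf).
  have d0 f : G2 f -> d f = 0 by move=> Gf; rewrite /d h // subrr.
  have [S lS hS] := infres_inj pK cl0 l_prime l_neq_p sk1 sk2 k12 inf cE alg k2stab k2pro_p dc dl dt d0.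
  apply/(tclass_eq sk1 cE _ hc'); exists (T + S); first by split; [exact: rA | exact: ltorsD].
  move=> f Gf; rewrite (actD sk1 cE Gf (rA _) (rA _)) opprD [X in _ + X]addrACA -hS // /d.
  by rewrite addrA [RHS]addrC subrK.
- move=> Z [/(selmerP _ sk2 alg2 cE2)[c [hc -> hk]] inv].
  have [gc lc tc] := hc.
  (* Invariance of the class supplies the coboundaries that the corestriction argument requires. *)
  have [g g' Gg Gg' e e'|c1 [gc1 lc1 tc1 [Q lQ hQ]]] := infres_surj pK cl0 l_prime l_neq_p
      sk1 sk2 k12 inf cE alg k2stab k2pro_p gc lc tc.
    have Gg1 := Gg; rewrite alg in Gg1.
    have := inv _ g (restrict_gal Gg Gg' e e') Gg1.
    rewrite -alg2 (H1_conjE sk1 sk2 k12 cE alg k2stab Gg Gg' e e' hc) => hinv.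
    have {}hinv := esym (hinv (fun x kx => esym (ifT _ _ (introT (asboolP _) kx)))).
    have hcc := tcocycle_conj sk1 k12 cE alg k2stab Gg Gg' e e' hc.
    by have /(tclass_eq sk2 cE2 _ hcc)[T [_ lT] hT] := hinv; exists T.
  have hc1 : tcocycle k1 l c1 by [].
  have hc12 := tcocycle_res k12 alg hc1.
  have rA (P : epoint E0) : rat (algcl k2) P by rewrite alg2; exact: ptP.
  have e : tclass k2 l c = tclass k2 l c1.
    by apply/(tclass_eq sk2 cE2) => //; exists Q.
  exists (tclass k1 l c1); last by rewrite selmer_resE // -e.
  apply/(selmerP _ sk1 alg cE); exists c1; split=> // w; apply: locally_kummer_descent => //.
  (* The lift c1 has the class of c over k2, and the Kummer condition depends only on the class. *)
  have [c2 [hc2 e2 h2]] : exists c2, [/\ tcocycle k2 l c2, tclass k2 l c1 = tclass k2 l c2 &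
      forall w, locally_kummer k2 c2 w] by exists c; split=> //; rewrite e.
  apply/(kummer_local _ sk2 alg2 cE2 hc12); rewrite e2.
  by apply/(kummer_local _ sk2 alg2 cE2 hc2).
Qed.

Lemma selmer_res_add X Y : selmer C E0 l k1 X -> selmer C E0 l k1 Y ->
  selmer_res E0 l k2 (selmer_add E0 l k1 X Y) =
  selmer_add E0 l k2 (selmer_res E0 l k2 X) (selmer_res E0 l k2 Y).
Proof.
move=> /(selmerP _ sk1 alg cE)[c [hc -> _]] /(selmerP _ sk1 alg cE)[c' [hc' -> _]].
have -> : selmer_add E0 l k1 (tclass k1 l c) (tclass k1 l c') = tclass k1 l (fun f => c f + c' f).
  by rewrite /selmer_add -alg (H1_addE sk1 cE hc hc').
rewrite (selmer_resE (tcocycleD sk1 cE hc hc')) (selmer_resE hc) (selmer_resE hc').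
by rewrite /selmer_add -alg2 (H1_addE sk2 cE2 (tcocycle_res k12 alg hc) (tcocycle_res k12 alg hc')).
Qed.

End SelmerTower.

(** * Algebraic closures of global function fields *)

Lemma closed_field_alg_closed (K : closedFieldType) : alg_closed K.
Proof. by move=> q sq; exact/closed_rootP. Qed.

Section FunctionField.
Variables (p : nat) (F : fieldExtType {fraction {poly 'F_p}}).
Variables (Fbar : closedFieldType) (iota : {rmorphism F -> Fbar}).
Hypotheses (p_prime : prime p) (Fbar_algebraic : forall x : Fbar, algebraicOver iota x).

Lemma function_field_pchar : p \in [pchar Fbar].
Proof.
apply: (rmorph_pchar iota); apply: (rmorph_pchar (in_alg F)).
by apply: (rmorph_pchar (@tofrac _)); apply: (rmorph_pchar (@polyC _)); apply: pchar_Fp.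
Qed.

Lemma constants_morphism : exists2 j : {rmorphism {poly 'F_p} -> Fbar}, injective j &
  forall c : {poly 'F_p}, j c = iota (tofrac c)%:A.
Proof.
exists (iota \o in_alg F \o @tofrac _)%FUN => //.
move=> x y e; have /eqP := fmorph_inj (in_alg F) (fmorph_inj iota e).
by rewrite tofrac_eq => /eqP.
Qed.

Lemma algcl_range : algcl (range iota) = setT.
Proof.
apply/seteqP; split=> // x _; have [q q0 rq] := Fbar_algebraic x.
exists (map_poly iota q); split=> //; first by rewrite map_poly_eq0.
by move=> i; rewrite coef_map; exists q`_i.
Qed.

Lemma infinite_range : infinite_field (range iota).
Proof.
have [j jinj hj] := constants_morphism => rs.
pose us := [seq j 'X^i | i <- seq.iota 0 (size rs).+1].
have [all_in|/allPn[_ /mapP[i _ ->] h]] := boolP (all (mem rs) us); last first.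
  by exists (j 'X^i) => //; rewrite hj; exists (tofrac 'X^i)%:A.
have uu : uniq us.
  rewrite map_inj_uniq ?iota_uniq // => a b /jinj/(congr1 (fun q : {poly 'F_p} => size q)).
  by rewrite !size_polyXn => -[].
have := uniq_leq_size uu (allP all_in).
by rewrite size_map size_iota ltnn.
Qed.

Lemma function_field_rank_one (w : place Fbar) : rank_one (w : set Fbar).
Proof.
have [j jinj hj] := constants_morphism.
apply: (rank_one_place (place_ringP w) jinj) => x.
(* F is finite over F_p(t), so Fbar is algebraic over the image k0 of F_p(t), whose elements are
   quotients of polynomials. *)
pose k0 : set Fbar := range (iota \o in_alg F).
have sk0 : divring_closed [in k0] := range_subfield (iota \o in_alg F)%FUN.
have ik0 : range iota `<=` algcl k0.
  move=> _ [y _ <-]; exists (map_poly iota (minPoly 1 y)); split.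
  - by rewrite map_poly_eq0 monic_neq0 ?monic_minPoly.
  - move=> i; rewrite coef_map; have /polyOverP/(_ i)/vlineP[c ->] := minPolyOver 1 y.
    by exists c.
  - by rewrite fmorph_root root_minPoly.
have [q [q0 hq rq]] : algcl k0 x by apply: (algcl_trans sk0 ik0); rewrite algcl_range.
exists q; split=> // i; have [c _ <-] := hq i; have [n [d [d0 ->]]] := fraction_div c.
exists n, d; rewrite !hj; split.
  by rewrite fmorph_eq0 scaler_eq0 oner_eq0 orbF tofrac_eq0.
by rewrite /= -fmorph_div /= -!in_algE -fmorph_div.
Qed.

Variables (L M : set Fbar).
Hypotheses (sL : divring_closed [in L]) (sM : divring_closed [in M]).
Hypotheses (iL : range iota `<=` L) (LM : L `<=` M) (algL : algcl L = setT).
Notation G := (galois_group (algcl L) L).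

Lemma normal_stable : normal_over iota M -> forall f x, G f -> M x -> M (f x).
Proof.
move=> norm f x Gf Mx.
have iE y : range iota y <-> exists a, iota a = y.
  by split=> [[a _ <-]|[a <-]]; exists a.
have ax : algcl (range iota) x by rewrite algcl_range.
have [m [_ irr rx _]] := minpoly iE ax.
apply: (norm m irr x) => //; apply: (gal_root sL Gf) => //; last by rewrite algL.
by move=> i; rewrite coef_map; apply: iL; exists m`_i.
Qed.

Hypothesis stab : forall f x, G f -> M x -> M (f x).

(** Under phi the p^N-th iterate of f becomes the p^N-th multiple, which is close to 0 for N large;
    continuity of the inverse of phi then makes the iterate fix x. *)
Lemma pro_p_iter : isomorphic_ZpN p (galois_group M (range iota)) ->
  forall f x, G f -> M x -> exists N, iter (p ^ N)%N f x = x.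
Proof.
move=> [phi [_ phiD _ cont]] f x Gf Mx.
pose r (g : Fbar -> Fbar) y := if `[< M y >] then g y else y.
have Gr g : G g -> galois_group M (range iota) (r g).
  move=> Gg; have [g' [Gg' e e']] := gal_inv sL Gg.
  have [h1 h2 h3 h4] := restrict_gal sL sM LM algL stab Gg Gg' e e'.
  by split=> // y /iL; exact: h3.
have rD g h : G g -> G h -> r (g \o h) = r g \o r h.
  move=> Gg Gh; apply/funext => y; rewrite /r /=.
  have [My|nMy] := pselect (M y); last by rewrite (asboolF nMy) (asboolF nMy).
  by rewrite (asboolT My) (asboolT (stab Gh My)).
have phi0 i n : phi (r id) i n = 0.
  have := phiD _ _ (Gr _ (gal_id L)) (Gr _ (gal_id L)) i n.
  rewrite -rD; try exact: gal_id.
  by rewrite -[X in X = _]addr0 => /addrI.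
have Giter n : G (iter n f).
  by elim: n => [|n IH]; [exact: gal_id | exact: (gal_comp Gf IH)].
have phi_iter n i k : phi (r (iter n f)) i k = phi (r f) i k *+ n.
  elim: n => [|n IH]; first by rewrite mulr0n; exact: phi0.
  rewrite mulrS -IH -phiD; [|exact: Gr|exact: Gr].
  by rewrite -rD.
have [N hN] := cont _ x (Gr _ (gal_id L)); exists N.
have := hN _ (Gr _ (Giter (p ^ N)%N)); rewrite /r (asboolT Mx); apply=> i k _ kN.
(* Only indices k < N have to be checked, and for these p^(k+1) divides p^N. *)
have pk (a : 'Z_(p ^ k.+1)) : a *+ (p ^ k.+1)%N = 0.
  by rewrite -mulr_natr pchar_Zp ?mulr0 // -{1}(expn0 p) ltn_exp2l ?prime_gt1.
by rewrite phi_iter phi0 -(subnKC kN) expnD mulrnA pk mul0rn.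
Qed.

End FunctionField.

Theorem theorem3p4 (p l : nat) (p_prime : prime p) (l_prime : prime l)
    (l_neq_p : l != p)
    (F : fieldExtType {fraction {poly 'F_p}})
    (Fbar : closedFieldType) (iota : {rmorphism F -> Fbar})
    (Fbar_algebraic : forall x : Fbar, algebraicOver iota x)
    (C : forall w : place Fbar, completion w)
    (E : weierstrass F) (E_elliptic : disc E != 0)
    (E_nonisotrivial : ~ constant_field (jinv E))
    (E_reduction : forall v : place F,
       good_reduction v E \/ split_multiplicative_reduction v E)
    (calF : set Fbar) (calF_galois : galois_over iota calF)
    (calF_group : isomorphic_ZpN p (galois_group calF (range iota)))
    (Fn : nat -> set Fbar)
    (Fn_0 : Fn 0%N = range iota)
    (Fn_intermediate : forall n, intermediate_field iota (Fn n))
    (Fn_finite : forall n, finite_over iota (Fn n))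
    (Fn_increasing : forall n, Fn n `<=` Fn n.+1)
    (Fn_union : \bigcup_n Fn n = calF)
    (n : nat) :
  let W := map_curve iota E in
  set_bij (selmer C W l (Fn n)) (selmer_invariants C W l (Fn n) calF)
    (selmer_res W l calF) /\
  (forall X Y, selmer C W l (Fn n) X -> selmer C W l (Fn n) Y ->
     selmer_res W l calF (selmer_add W l (Fn n) X Y) =
     selmer_add W l calF (selmer_res W l calF X) (selmer_res W l calF Y)).
Proof.
move=> W; have pK := function_field_pchar iota p_prime.
have [[sM _] _ norm] := calF_galois; have [sL iL] := Fn_intermediate n.
have LM : Fn n `<=` calF by rewrite -Fn_union; exact: bigcup_sup.
have algL : algcl (Fn n) = setT.
  apply/seteqP; split=> // x _; apply: (algcl_sub iL).
  by rewrite (algcl_range Fbar_algebraic).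
have inf : infinite_field (Fn n).
  move=> rs; have [u ru hu] := infinite_range iota rs; exists u => //; exact: iL.
have W_nz : disc W != 0.
  by rewrite (disc_map (subfield_setT F) (rmorph_partial_hom iota)) ?fmorph_eq0.
have cW : coefs_in (Fn n) (Ecurve W_nz) by split; apply: iL; eexists.
have stab := normal_stable Fbar_algebraic sL iL algL norm.
have pro_p := pro_p_iter p_prime sL sM iL LM algL stab calF_group.
have rk (w : place Fbar) : rank_one (w : set Fbar) by exact: function_field_rank_one.
have cl := @closed_field_alg_closed Fbar.
split.
  exact: (selmer_bij C (E0 := Ecurve W_nz) cl pK l_prime l_neq_p sL sM LM inf cW algL stab pro_p rk).
exact: (selmer_res_add (C := C) (E0 := Ecurve W_nz) cl sL sM LM cW algL).
Qed.
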